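(* Let $G$ be the golden gnomon and $C$ the constant defined in the context. The homothet $W=C^{-1}G$ contains a congruent copy of every rectifiable arc of length $1$. No smaller positive homothet of $G$ has this property, i.e. for $0<r<C^{-1}$ the triangle $rG$ does not contain a congruent copy of every rectifiable arc of length $1$. Numerically, $C^{-1}=0.779620091240\ldots$.
   Context: Put $\beta=\pi/5$, $s=\sin\beta$, $c=\cos\beta$, and $G=\operatorname{conv}\{(-c,0),(c,0),(0,s)\}\subset\mathbb R^2$ (the golden gnomon). A congruent copy is an image under a translation composed with a rotation (for $G$, allowing reflections gives the same notion, since $G$ is reflection symmetric). Definition of $C$. Let $$\mathcal Q(t)=(7+30c)(t^4+1)+(94+300c)(t^3+t)+(134+428c)t^2-4sc\,(t^2-1)(t^2-4t+1),$$ and let $p$ be its unique zero in $[-\frac18,-\frac19]$. Let $$\mathcal N(t)=4ct^2s+4ct^2+24cts+4cs-4c+2t^2s-t^2+4ts+2s+1,$$ $$\mathcal D(t)=12ct^2s+12ct^2+24ct+20cs+12c+6t^2s+3t^2+10t+2s+3,$$ $$q=\frac{\mathcal N(p)}{\mathcal D(p)},\quad a=2\arctan p,\quad b=2\arctan q,\quad \lambda=\frac1s\left(\sin a+1+\frac{\sin(a+\beta)-\sin(b+\beta)}{2c}\right),$$ and $C=2sc\left(\frac{b-a}{c}+\lambda\right)=1.282676025459\ldots$. *)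

(* Defs.v *)
From Stdlib Require Import Reals Rgeom.
From Coquelicot Require Import Coquelicot.
Open Scope R_scope.

Definition plane : Type := (R * R)%type.

Definition convex (K : plane -> Prop) : Prop :=
  forall A B t, K A -> K B -> 0 <= t <= 1 ->
    K ((1 - t) * fst A + t * fst B, (1 - t) * snd A + t * snd B).

Definition convex_hull (S : plane -> Prop) (P : plane) : Prop :=
  forall K : plane -> Prop, convex K -> (forall A, S A -> K A) -> K P.

Definition homothet (r : R) (K : plane -> Prop) (P : plane) : Prop :=
  exists A, K A /\ P = (r * fst A, r * snd A).

(* [Rgeom.xr], [Rgeom.yr] rotate clockwise by [theta]; here the angle is always
   quantified over all of R, so the orientation is immaterial. *)
Definition motion (theta tx ty : R) (A : plane) : plane :=
  (xt (xr (fst A) (snd A) theta) tx, yt (yr (fst A) (snd A) theta) ty).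

Definition contains_congruent_copy (K A : plane -> Prop) : Prop :=
  exists theta tx ty, forall P, A P -> K (motion theta tx ty P).

Definition dist (A B : plane) : R := dist_euc (fst A) (snd A) (fst B) (snd B).

(* Lengths of the inscribed polygonal lines of [gamma] on [0,1], over the
   subdivisions 0 = u 0 <= u 1 <= ... <= u (n+1) = 1; [sum_f_R0 _ n] has n+1
   terms. *)
Definition inscribed_length (gamma : R -> plane) (l : R) : Prop :=
  exists (n : nat) (u : nat -> R),
    u 0%nat = 0 /\ u (S n) = 1 /\
    (forall i, (i <= n)%nat -> u i <= u (S i)) /\
    l = sum_f_R0 (fun i => dist (gamma (u i)) (gamma (u (S i)))) n.

(* A continuous path on [0,1], not required to be injective, whose length is
   finite and equal to [L]. Values outside [0,1] are irrelevant. *)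
Definition rectifiable_arc (gamma : R -> plane) (L : R) : Prop :=
  continuous_on (fun t => 0 <= t <= 1) gamma /\
  is_lub (inscribed_length gamma) L.

Definition trace (gamma : R -> plane) (P : plane) : Prop :=
  exists t, 0 <= t <= 1 /\ P = gamma t.

Definition covers_unit_arcs (K : plane -> Prop) : Prop :=
  forall gamma, rectifiable_arc gamma 1 ->
    contains_congruent_copy K (trace gamma).

Definition beta : R := PI / 5.
Definition s : R := sin beta.
Definition c : R := cos beta.

Definition gnomon : plane -> Prop :=
  convex_hull (fun P => P = (- c, 0) \/ P = (c, 0) \/ P = (0, s)).

Definition Qpoly (t : R) : R :=
  (7 + 30 * c) * (t ^ 4 + 1) + (94 + 300 * c) * (t ^ 3 + t)
  + (134 + 428 * c) * t ^ 2
  - 4 * s * c * (t ^ 2 - 1) * (t ^ 2 - 4 * t + 1).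

Definition Npoly (t : R) : R :=
  4 * c * t ^ 2 * s + 4 * c * t ^ 2 + 24 * c * t * s + 4 * c * s - 4 * c
  + 2 * t ^ 2 * s - t ^ 2 + 4 * t * s + 2 * s + 1.

Definition Dpoly (t : R) : R :=
  12 * c * t ^ 2 * s + 12 * c * t ^ 2 + 24 * c * t + 20 * c * s + 12 * c
  + 6 * t ^ 2 * s + 3 * t ^ 2 + 10 * t + 2 * s + 3.

(* [iota P] is the unique element satisfying [P] (see [iota_correct]). *)
Definition p_root : R :=
  iota (fun t : R => - (1 / 8) <= t <= - (1 / 9) /\ Qpoly t = 0).

Definition q_val : R := Npoly p_root / Dpoly p_root.
Definition a_angle : R := 2 * atan p_root.
Definition b_angle : R := 2 * atan q_val.

Definition lambda : R :=
  1 / s * (sin a_angle + 1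
           + (sin (a_angle + beta) - sin (b_angle + beta)) / (2 * c)).

Definition C_gnomon : R :=
  2 * s * c * ((b_angle - a_angle) / c + lambda).

(* Main.v *)
(* Let h(t) be the support function of the arc in the direction (sin t, - cos t). A copy of rG whose
   base has this outer normal can be translated so as to contain the arc exactly when
   F(t) = 2c h(t) + h(t + 4 beta) + h(t - 4 beta) <= 2sc r, so one has to show T min F <= 1 for arcs of
   length 1, where T = (b - a)/c + lambda and C = 2sc T.

   Take a fine grid of directions and the contact points of the arc with the supporting lines in
   these directions, pushed outwards a little so that they are in strictly convex position. The arc
   is at least as long as a shortest path through the points. Exchanging two edges shortens a path
   that crosses itself, so the directions visited by an initial part of the shortest path form a
   circular interval. For weights mu >= 0 on the bases t, summation by parts writes the sum of
   mu(t) F(t) as a sum over the edges of the path of the scalar product of the edge with a vector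
   V(S) that depends only on mu and on the set S of directions visited so far. If |V(S)| <= 1 for
   every S, the length is at least the total mass of mu times min F. After normalizing the order
   by symmetries, either the measure mu with an atom lambda at the base and density 1/(2c) on two arcs,
   of total mass T, has this property (its equality cases are the equations defining a and b), or the
   path zigzags and three or four atoms with total mass at least 1.36 > T do.

   For sharpness, an explicit arc of length T (segment, circular arc of radius 1/(2c), segment, and
   their mirror images) has F = 1 on an interval of directions and F >= 1 elsewhere; inscribed
   polygons have F >= 1 - eta. *)
From Stdlib Require Import Reals Rgeom ZArith Lra Lia Psatz ClassicalEpsilon.
From Coquelicot Require Import Coquelicot.
From mathcomp Require Import all_boot zify.
Require Import Defs.
Set Implicit Arguments.
Unset Strict Implicit.
Open Scope R_scope.

(** * The constants *)

(** The certificate for the caliper order describes a motion of [- (fieldx, fieldy)] inside the unit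
    disc during the first half of the visit. Direction [0] takes it to [(0, lambda * c)]. Companions
    of the right-hand family carry it to the point [(- cos start_angle, sin start_angle)] of the
    unit circle. The left-hand bases have density 1/(2c), which the side length 2c turns into unit
    speed, so the vector follows the circle up to [end_angle]. The remaining companions and the atom
    lead it through the disc to [(1, 0)]; the second half is the mirror image. Landing exactly on
    these two points gives the equations for a, b and lambda; they hold by the definition of
    [lambda] and because [Qpoly] vanishes at p. The optimal arc is the dual object: its edges (lead,
    circular arc, tail, top edge) point along the vector at the moments when the vector has length
    1, so no length is wasted. On the grid all this holds up to a multiple of the step, which
    [delta] absorbs. *)

Lemma c_quad : 4 * c ^ 2 = 2 * c + 1.
Proof.
have h3 : cos (3 * beta) = 4 * c ^ 3 - 3 * c.
  rewrite (_ : 3 * beta = 2 * beta + beta); last by ring.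
  rewrite cos_plus cos_2a_cos sin_2a -/c.
  have := sin2_cos2 beta; rewrite /Rsqr -/c => h.
  have -> : 2 * sin beta * c * sin beta = 2 * c * (1 - c * c) by rewrite -h; ring.
  ring.
have h2 : cos (3 * beta) = - cos (2 * beta).
  rewrite -Rtrigo_facts.cos_pi_minus; congr cos; rewrite /beta; field.
have hc : 0 < c by apply: cos_gt_0; rewrite /beta; have := PI_RGT_0; lra.
rewrite h3 cos_2a_cos -/c in h2.
have : (c + 1) * (4 * c ^ 2 - 2 * c - 1) = 0 by lra.
by case/Rmult_integral; lra.
Qed.

Lemma s_sq : s ^ 2 = 1 - c ^ 2.
Proof. by have := sin2_cos2 beta; rewrite /Rsqr -/c -/s => h; lra. Qed.

Lemma c_bounds : 0.80901699437494 < c < 0.80901699437495.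
Proof.
have hc : 0 < c by apply: cos_gt_0; rewrite /beta; have := PI_RGT_0; lra.
have := c_quad; split; nra.
Qed.

Lemma s_bounds : 0.58778525229247 < s < 0.58778525229248.
Proof.
have hs : 0 < s by apply: sin_gt_0; rewrite /beta; have := PI_RGT_0; lra.
have := s_sq; have := c_quad; have := c_bounds; split; nra.
Qed.

Lemma sc_bounds : 0.4755282581475 < s * c < 0.4755282581476.
Proof. have := s_bounds; have := c_bounds; split; nra. Qed.

(** In the difference quotient the term with [94 + 300 * c] (about 337) outweighs the negative
    contributions, which stay below about 130. This gives uniqueness of the zero and, later, the
    numerical bracket for it. *)
Lemma Qpoly_incr x y : - (1 / 8) <= x -> x < y -> y <= - (1 / 9) -> Qpoly x < Qpoly y.
Proof.
move=> hx hxy hy.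
have hc := c_bounds; have hsc := sc_bounds.
have -> : Qpoly y = Qpoly x + (y - x) *
  ((7 + 30 * c) * ((x + y) * (x ^ 2 + y ^ 2))
   + (94 + 300 * c) * (x ^ 2 + x * y + y ^ 2 + 1)
   + (134 + 428 * c) * (x + y)
   - 4 * (s * c) * ((x + y) * (x ^ 2 + y ^ 2) - 4 * (x ^ 2 + x * y + y ^ 2) + 4)).
  by rewrite /Qpoly; ring.
have h1 : 0 <= x ^ 2 <= 1 / 64 by nra.
have h2 : 0 <= y ^ 2 <= 1 / 64 by nra.
have h3 : 0 <= x * y <= 1 / 64 by nra.
have h4 : - (1 / 128) <= (x + y) * (x ^ 2 + y ^ 2) <= 0 by nra.
have h5 : - (1 / 4) <= x + y <= 0 by lra.
set u := (x + y) * _ in h4 *.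
have k1 : (7 + 30 * c) * u >= - 1 by nra.
have k2 : (94 + 300 * c) * (x ^ 2 + x * y + y ^ 2 + 1) >= 94 + 300 * c by nra.
have k3 : (134 + 428 * c) * (x + y) >= - (134 + 428 * c) / 4 by nra.
have k4 : 4 * (s * c) * (u - 4 * (x ^ 2 + x * y + y ^ 2) + 4) <= 8 by nra.
nra.
Qed.

Lemma p_root_spec : - (1 / 8) <= p_root <= - (1 / 9) /\ Qpoly p_root = 0.
Proof.
apply: (iota_correct (fun t => - (1 / 8) <= t <= - (1 / 9) /\ Qpoly t = 0)).
have hc := c_bounds; have hsc := sc_bounds.
have [z [hz1 hz2]] : {z : R | - (1 / 8) <= z <= - (1 / 9) /\ Qpoly z = 0}.
  apply: IVT; rewrite /Qpoly; [reg | lra | lra | lra].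
exists z; split=> // y [hy1 hy2].
case: (Rtotal_order z y) => [h|[//|h]].
- by have := @Qpoly_incr z y; lra.
- by have := @Qpoly_incr y z; lra.
Qed.

Lemma mul_bounds a1 a2 b1 b2 x y : 0 <= a1 -> 0 <= b1 ->
  a1 <= x <= a2 -> b1 <= y <= b2 -> a1 * b1 <= x * y <= a2 * b2.
Proof. by move=> *; split; apply: Rmult_le_compat; lra. Qed.

Lemma c_tight : 0.80901699437494742409 <= c <= 0.80901699437494742412.
Proof. by have := c_bounds; have := c_quad; split; nra. Qed.

Lemma s_tight : 0.58778525229247312915 <= s <= 0.58778525229247312918.
Proof. by have := s_bounds; have := s_sq; have := c_quad; have := c_tight; split; nra. Qed.

Lemma sc_tight : 0.4755282581475767857 <= s * c <= 0.4755282581475767863.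
Proof.
have := @mul_bounds _ _ _ _ _ _ _ _ s_tight c_tight; lra.
Qed.

Lemma p_tight : -0.120034464352806754 <= p_root <= -0.120034464352806751.
Proof.
have [[h1 h2] h0] := p_root_spec.
have hc := c_tight; have hsc := sc_tight.
split; apply: Rnot_lt_le => h.
- have := @Qpoly_incr p_root (-0.120034464352806754) h1 h; rewrite h0 /Qpoly; lra.
- have := @Qpoly_incr (-0.120034464352806751) p_root _ h h2; rewrite h0 /Qpoly; lra.
Qed.

Lemma Npoly_Dpoly_tight :
  -0.733955125486372 <= Npoly p_root <= -0.733955125486369 /\
  20.17949241614565 <= Dpoly p_root <= 20.17949241614568.
Proof.
have hp := p_tight; have hc := c_tight; have hs := s_tight; have hsc := sc_tight.
(* [mul_bounds] needs nonnegative factors, whereas [p_root] is negative. *)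
set x := - p_root.
have hx : 0.120034464352806751 <= x <= 0.120034464352806754 by rewrite /x; lra.
have hxx := @mul_bounds _ _ _ _ _ _ _ _ hx hx.
have hcx := @mul_bounds _ _ _ _ _ _ _ _ hc hx.
have hsx := @mul_bounds _ _ _ _ _ _ _ _ hs hx.
have hscx := @mul_bounds _ _ _ _ _ _ _ _ hsc hx.
have hcxx : 0.80901699437494742409 * 0.014408272632465233 <= c * (x * x)
   <= 0.80901699437494742412 * 0.014408272632465237 by apply: mul_bounds; lra.
have hsxx : 0.58778525229247312915 * 0.014408272632465233 <= s * (x * x)
   <= 0.58778525229247312918 * 0.014408272632465237 by apply: mul_bounds; lra.
have hscxx : 0.4755282581475767857 * 0.014408272632465233 <= (s * c) * (x * x)
   <= 0.4755282581475767863 * 0.014408272632465237 by apply: mul_bounds; lra.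
have -> : p_root = - x by rewrite /x; ring.
have -> : Npoly (- x) = 4 * (s * c * (x * x)) + 4 * (c * (x * x)) - 24 * (s * c * x)
  + 4 * (s * c) - 4 * c + 2 * (s * (x * x)) - x * x - 4 * (s * x) + 2 * s + 1.
  by rewrite /Npoly; ring.
have -> : Dpoly (- x) = 12 * (s * c * (x * x)) + 12 * (c * (x * x)) - 24 * (c * x)
  + 20 * (s * c) + 12 * c + 6 * (s * (x * x)) + 3 * (x * x) - 10 * x + 2 * s + 3.
  by rewrite /Dpoly; ring.
by lra.
Qed.

Lemma q_tight : -0.0363713373136747 <= q_val <= -0.0363713373136744.
Proof.
have [hN hD] := Npoly_Dpoly_tight.
have e : q_val * Dpoly p_root = Npoly p_root by rewrite /q_val; field; lra.
by split; nra.
Qed.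

Lemma sin_2atan x : sin (2 * atan x) = 2 * x / (1 + x ^ 2).
Proof.
have h : 0 < 1 + x ^ 2 by nra.
rewrite sin_2a sin_atan cos_atan /Rsqr.
have := sqrt_sqrt (1 + x * x); have := sqrt_lt_R0 (1 + x * x).
set r := sqrt _ => h1 h2.
have {}h1 : 0 < r by apply: h1; nra.
have {}h2 : r * r = 1 + x * x by apply: h2; nra.
have -> : 1 + x ^ 2 = r * r by rewrite h2; ring.
by field; lra.
Qed.

Lemma cos_2atan x : cos (2 * atan x) = (1 - x ^ 2) / (1 + x ^ 2).
Proof.
have h : 0 < 1 + x ^ 2 by nra.
rewrite cos_2a_cos cos_atan /Rsqr.
have := sqrt_sqrt (1 + x * x); have := sqrt_lt_R0 (1 + x * x).
set r := sqrt _ => h1 h2.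
have {}h1 : 0 < r by apply: h1; nra.
have {}h2 : r * r = 1 + x * x by apply: h2; nra.
have -> : 1 - x ^ 2 = 2 - r * r by rewrite h2; ring.
have -> : 1 + x ^ 2 = r * r by rewrite h2; ring.
by field; lra.
Qed.

(** The optimality equations of the dual measure. Since p and q = N/D are the tangents of a/2 and
    b/2, everything is rational in p, s and c; after clearing denominators each difference is a
    multiple of [Qpoly p_root] modulo the quadratic relations for s and c. *)
Lemma tight_identities :
  sin (beta - a_angle) - sin (beta - b_angle) = - (2 * c * sin b_angle) /\
  c * lambda = cos b_angle + (cos (beta - a_angle) - cos (beta - b_angle)) / (2 * c).
Proof.
have [_ hQ] := p_root_spec.
have [hN hD] := Npoly_Dpoly_tight.
have hs := s_bounds; have hc := c_bounds.
(* The doubled constants (g is the golden ratio) satisfy monic relations with integer coefficients,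
   which [field] can use as rewriting rules. *)
have [g ec] : exists g, c = g / 2 by exists (2 * c); field.
have [S es] : exists S, s = S / 2 by exists (2 * s); field.
have hg : g * g = g + 1 by have := c_quad; rewrite ec; lra.
have hS : S * S = 3 - g by have := s_sq; have := c_quad; rewrite es ec; lra.
have h1 : 0 < 1 + p_root ^ 2 by nra.
have h2 : 0 < Dpoly p_root ^ 2 + Npoly p_root ^ 2 by nra.
have eSb : sin b_angle = 2 * Npoly p_root * Dpoly p_root / (Dpoly p_root ^ 2 + Npoly p_root ^ 2).
  rewrite /b_angle sin_2atan /q_val; field; repeat split; nra.
have eCb : cos b_angle = (Dpoly p_root ^ 2 - Npoly p_root ^ 2) / (Dpoly p_root ^ 2 + Npoly p_root ^ 2).
  rewrite /b_angle cos_2atan /q_val; field; repeat split; nra.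
have eSa : sin a_angle = 2 * p_root / (1 + p_root ^ 2) by rewrite /a_angle sin_2atan.
have eCa : cos a_angle = (1 - p_root ^ 2) / (1 + p_root ^ 2) by rewrite /a_angle cos_2atan.
rewrite /lambda sin_plus (sin_plus b_angle) !sin_minus !cos_minus -/s -/c.
set t := p_root in hQ h1 h2 eSb eCb eSa eCa *.
set N := Npoly t in h2 eSb eCb *; set D := Dpoly t in h2 eSb eCb *.
have P1 : (s * (1 - t ^ 2) - 2 * c * t) * (D ^ 2 + N ^ 2)
    - (s * (D ^ 2 - N ^ 2) - 2 * c * N * D) * (1 + t ^ 2) + 4 * c * N * D * (1 + t ^ 2)
    = (16 * c * s - 8 * s - 4 * t) * Qpoly t.
  rewrite /N /D /Npoly /Dpoly /Qpoly ec es; field [hS hg].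
have P2 : 2 * c * c * (2 * t + 1 + t ^ 2) * (D ^ 2 + N ^ 2)
    + c * ((2 * t * c + (1 - t ^ 2) * s) * (D ^ 2 + N ^ 2)
           - (2 * N * D * c + (D ^ 2 - N ^ 2) * s) * (1 + t ^ 2))
    - 2 * c * s * (D ^ 2 - N ^ 2) * (1 + t ^ 2)
    - s * ((c * (1 - t ^ 2) + s * (2 * t)) * (D ^ 2 + N ^ 2)
           - (c * (D ^ 2 - N ^ 2) + s * (2 * N * D)) * (1 + t ^ 2))
    = (4 * c * t ^ 2 + 4 * c + 4 * s * t ^ 2 + 4 * s + 8 * t) * Qpoly t.
  rewrite /N /D /Npoly /Dpoly /Qpoly ec es; field [hS hg].
rewrite hQ Rmult_0_r in P1; rewrite hQ Rmult_0_r in P2.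
(* The zero is written over the common denominator so that rewriting with [-P1] turns it into the
   numerator and [field] can conclude. *)
have I1 : s * cos a_angle - c * sin a_angle - (s * cos b_angle - c * sin b_angle)
   + 2 * c * sin b_angle = 0 / ((1 + t ^ 2) * (D ^ 2 + N ^ 2)).
  by rewrite -P1 eSa eCa eSb eCb; field; lra.
have I2 : 2 * c * c * (sin a_angle + 1) + c * (sin a_angle * c + cos a_angle * s - sin b_angle * c - cos b_angle * s)
   - 2 * c * s * cos b_angle - s * (c * cos a_angle + s * sin a_angle - c * cos b_angle - s * sin b_angle)
   = 0 / ((1 + t ^ 2) * (D ^ 2 + N ^ 2)).
  by rewrite -P2 eSa eCa eSb eCb; field; lra.
rewrite /Rdiv Rmult_0_l in I1; rewrite /Rdiv Rmult_0_l in I2.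
split; first by lra.
apply: (Rmult_eq_reg_l (2 * c * s)); last by nra.
have -> : 2 * c * s * (c * (1 / s * (sin a_angle + 1 + (sin a_angle * c + cos a_angle * s
    - (sin b_angle * c + cos b_angle * s)) / (2 * c)))) =
    2 * c * c * (sin a_angle + 1) + c * (sin a_angle * c + cos a_angle * s - sin b_angle * c - cos b_angle * s).
  by field; lra.
have -> : 2 * c * s * (cos b_angle + (c * cos a_angle + s * sin a_angle
    - (c * cos b_angle + s * sin b_angle)) / (2 * c)) = 2 * c * s * cos b_angle
    + s * (c * cos a_angle + s * sin a_angle - c * cos b_angle - s * sin b_angle).
  by field; lra.
lra.
Qed.

(** * Numerical enclosures of the angles, [lambda] and the constant C *)

Lemma le_of_deriv_ge0 (f f' : R -> R) x : 0 <= x ->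
  (forall t, is_derive f t (f' t)) -> (forall t, 0 <= t -> 0 <= f' t) -> f 0 <= f x.
Proof.
move=> hx hd h.
have [t [ht e]] := @MVT_gen f 0 x f' (fun t _ => hd t)
  (fun t _ => proj2 (continuity_pt_filterlim _ _) (ex_derive_continuous _ _ (ex_intro _ _ (hd t)))).
rewrite Rmin_left // Rmax_right // in ht.
have := h t (proj1 ht); nra.
Qed.

(* Horner form keeps the rationals small when [lra] evaluates the polynomial. *)
Definition atan_poly x := let z := x * x in
  x * (1 - z * (1 / 3 - z * (1 / 5 - z * (1 / 7 - z * (1 / 9 - z * (1 / 11 - z * (1 / 13 - z / 15))))))).

(** The errors have as derivatives the remainders of a geometric series, [t ^ 16 / (1 + t ^ 2)] for
    the lower bound and [t ^ 18 / (1 + t ^ 2)] for the upper one. *)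
Lemma atan_poly_bounds x : 0 <= x -> atan_poly x <= atan x <= atan_poly x + x ^ 17 / 17.
Proof.
move=> hx; split.
- have := @le_of_deriv_ge0 (fun t => atan t - atan_poly t) (fun t => t ^ 16 / (1 + t ^ 2)) x hx.
  rewrite atan_0 /atan_poly => h.
  suff : 0 <= atan x - atan_poly x by rewrite /atan_poly; lra.
  apply: Rle_trans (h _ _); first by lra.
  + move=> t; auto_derive => //; field; nra.
  + by move=> t ht; apply: Rdiv_le_0_compat; [apply: pow_le | nra].
- have := @le_of_deriv_ge0 (fun t => atan_poly t + t ^ 17 / 17 - atan t) (fun t => t ^ 18 / (1 + t ^ 2)) x hx.
  rewrite atan_0 /atan_poly => h.
  suff : 0 <= atan_poly x + x ^ 17 / 17 - atan x by rewrite /atan_poly; lra.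
  apply: Rle_trans (h _ _); first by lra.
  + move=> t; auto_derive => //; field; nra.
  + by move=> t ht; apply: Rdiv_le_0_compat; [apply: pow_le | nra].
Qed.

(** The constant T: total mass of the optimal dual measure and length of the optimal arc of minimal
    width 1. *)
Definition caliper_length : R := (b_angle - a_angle) / c + lambda.

Lemma atan_incr_le x y : x <= y -> atan x <= atan y.
Proof. by case=> [h|->]; [left; apply: atan_increasing | lra]. Qed.

Lemma a_angle_bounds : -0.23892580198204 <= a_angle <= -0.23892580198201.
Proof.
have hp := p_tight.
have h1 := proj2 (@atan_poly_bounds 0.12003446435281 ltac:(lra)).
have h2 := proj1 (@atan_poly_bounds 0.12003446435280 ltac:(lra)).
have h3 := @atan_incr_le (-0.12003446435281) p_root ltac:(lra).
have h4 := @atan_incr_le p_root (-0.12003446435280) ltac:(lra).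
rewrite (_ : -0.12003446435281 = Ropp 0.12003446435281) in h3; last by lra.
rewrite (_ : -0.12003446435280 = Ropp 0.12003446435280) in h4; last by lra.
rewrite atan_opp in h3; rewrite atan_opp in h4.
rewrite /atan_poly in h1 h2; rewrite /a_angle; lra.
Qed.

Lemma b_angle_bounds : -0.07271062359458 <= b_angle <= -0.07271062359455.
Proof.
have hp := q_tight.
have h1 := proj2 (@atan_poly_bounds 0.03637133731368 ltac:(lra)).
have h2 := proj1 (@atan_poly_bounds 0.03637133731367 ltac:(lra)).
have h3 := @atan_incr_le (-0.03637133731368) q_val ltac:(lra).
have h4 := @atan_incr_le q_val (-0.03637133731367) ltac:(lra).
rewrite (_ : -0.03637133731368 = Ropp 0.03637133731368) in h3; last by lra.
rewrite (_ : -0.03637133731367 = Ropp 0.03637133731367) in h4; last by lra.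
rewrite atan_opp in h3; rewrite atan_opp in h4.
rewrite /atan_poly in h1 h2; rewrite /b_angle; lra.
Qed.

Lemma div_bounds lo hi x y : 0 < y -> lo * y <= x <= hi * y -> lo <= x / y <= hi.
Proof.
by move=> hy [h1 h2]; split; apply: (Rmult_le_reg_r y) => //; rewrite /Rdiv Rmult_assoc Rinv_l; lra.
Qed.

Lemma sin_cos_ab_bounds :
  (-0.2366590801577530 <= sin a_angle <= -0.2366590801577510 /\
   0.9715927540790350 <= cos a_angle <= 0.9715927540790370) /\
  (-0.0726465723526655 <= sin b_angle <= -0.0726465723526635 /\
   0.9973577470122780 <= cos b_angle <= 0.9973577470122800).
Proof.
have hp := p_tight; have hq := q_tight.
have hpp : 0.120034464352806751 * 0.120034464352806751 <= (- p_root) * (- p_root)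
   <= 0.120034464352806754 * 0.120034464352806754 by apply: mul_bounds; lra.
have hqq : 0.0363713373136744 * 0.0363713373136744 <= (- q_val) * (- q_val)
   <= 0.0363713373136747 * 0.0363713373136747 by apply: mul_bounds; lra.
rewrite /a_angle /b_angle !sin_2atan !cos_2atan.
have e1 : 0 < 1 + p_root ^ 2 by nra.
have e2 : 0 < 1 + q_val ^ 2 by nra.
by split; split; apply: div_bounds; lra.
Qed.

Lemma lambda_bounds : 1.14323212732708 <= lambda <= 1.14323212732713.
Proof.
have [[h1 h2] [h3 h4]] := sin_cos_ab_bounds.
have [_ e] := tight_identities.
have hc := c_tight; have hs := s_tight.
rewrite !cos_minus -/s -/c in e.
have e' : 2 * (c * c) * lambda = 2 * (c * cos b_angle) + (s * sin a_angle - s * sin b_angle)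
   + c * (cos a_angle - cos b_angle).
  rewrite (_ : 2 * (c * c) * lambda = 2 * c * (c * lambda)); last by ring.
  by rewrite e; field; lra.
have k1 : 0.58778525229247312915 * 0.2366590801577510 <= s * (- sin a_angle)
   <= 0.58778525229247312918 * 0.2366590801577530 by apply: mul_bounds; lra.
have k2 : 0.58778525229247312915 * 0.0726465723526635 <= s * (- sin b_angle)
   <= 0.58778525229247312918 * 0.0726465723526655 by apply: mul_bounds; lra.
have k3 : 0.80901699437494742409 * 0.9715927540790350 <= c * cos a_angle
   <= 0.80901699437494742412 * 0.9715927540790370 by apply: mul_bounds; lra.
have k4 : 0.80901699437494742409 * 0.9973577470122780 <= c * cos b_angle
   <= 0.80901699437494742412 * 0.9973577470122800 by apply: mul_bounds; lra.
have ec : c * c = (2 * c + 1) / 4 by have := c_quad; lra.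
have -> : lambda = (2 * (c * cos b_angle) + (s * sin a_angle - s * sin b_angle)
   + c * (cos a_angle - cos b_angle)) / (c + 1 / 2).
  by rewrite -e' ec; field; lra.
by apply: div_bounds; lra.
Qed.

Lemma caliper_length_bounds : 1.3486853867061 <= caliper_length <= 1.3486853867065.
Proof.
have h := lambda_bounds; have h1 := a_angle_bounds; have h2 := b_angle_bounds; have hc := c_tight.
have e : (b_angle - a_angle) / c * c = b_angle - a_angle by field; lra.
rewrite /caliper_length; split; nra.
Qed.

Lemma C_gnomon_eq : C_gnomon = 2 * s * c * caliper_length.
Proof. by []. Qed.

Lemma inv_C_gnomon_bounds : 0.779620091240 <= / C_gnomon < 0.779620091241.
Proof.
have h := caliper_length_bounds; have hsc := sc_tight.
have k : 0.4755282581475767857 * 1.3486853867061 <= (s * c) * caliper_length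
   <= 0.4755282581475767863 * 1.3486853867065 by apply: mul_bounds; lra.
have C0 : 0 < C_gnomon by rewrite C_gnomon_eq; lra.
have e : / C_gnomon * C_gnomon = 1 by apply: Rinv_l; lra.
have e2 : C_gnomon = 2 * (s * c * caliper_length) by rewrite C_gnomon_eq; ring.
set x := / _ in e *; rewrite e2 in e.
split; nra.
Qed.

Lemma inv_2c_bounds : 0.618 <= / (2 * c) <= 0.61804.
Proof.
have hc := c_bounds; have e : / (2 * c) * (2 * c) = 1 by field; lra.
by split; nra.
Qed.

(** * Dual certificates on a grid of directions *)

Definition sumR (A : Type) (f : A -> R) (l : list A) : R := foldr (fun x acc => f x + acc) 0 l.

Lemma sumR_cat (A : Type) (f : A -> R) l1 l2 : sumR f (l1 ++ l2) = sumR f l1 + sumR f l2.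
Proof. elim: l1 => /= [|x l ->]; ring. Qed.

Lemma sumR_map (A B : Type) (g : A -> B) (f : B -> R) l : sumR f (map g l) = sumR (fun x => f (g x)) l.
Proof. by elim: l => //= x l ->. Qed.

Lemma sumR_ext (A : Type) (f g : A -> R) l : (forall x, f x = g x) -> sumR f l = sumR g l.
Proof. by move=> h; elim: l => //= x l ->; rewrite h. Qed.

Lemma sumR_lin (A : Type) a b (f g : A -> R) l :
  sumR (fun x => a * f x + b * g x) l = a * sumR f l + b * sumR g l.
Proof. elim: l => /= [|x l ->]; ring. Qed.

Definition ind (b : bool) : R := if b then 1 else 0.

(* The 10 M directions [dirx, diry] are the unit vectors at angle [i * grid_step M - PI / 2], indexed
   periodically by [Z]; the rotation by 4 beta between two normals of the gnomon is a shift by 4 M. *)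
Definition grid_step (M : Z) : R := PI / (5 * IZR M).
Definition dirx (M i : Z) : R := sin (IZR i * grid_step M).
Definition diry (M i : Z) : R := - cos (IZR i * grid_step M).

(* For a height function [H], the triangular width functional of the gnomon based at direction [u]:
   the outer normals are [u], [u + 4 M], [u - 4 M], weighted by the side lengths 2 c, 1, 1. *)
Definition triple (M : Z) (H : Z -> R) (u : Z) : R :=
  2 * c * H u + H (u + 4 * M)%Z + H (u - 4 * M)%Z.

Definition wsum (M : Z) (mu : list (Z * R)) (H : Z -> R) : R :=
  sumR (fun uw => uw.2 * triple M H uw.1) mu.

(* [- (fieldx, fieldy)] is the force transmitted through an edge of the path when [S] is the set of
   directions already visited; see [wsum_height_le]. *)
Definition fieldx M mu (S : Z -> bool) := wsum M mu (fun i => ind (S i) * dirx M i).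
Definition fieldy M mu (S : Z -> bool) := wsum M mu (fun i => ind (S i) * diry M i).
Definition field_sq M mu S := fieldx M mu S ^ 2 + fieldy M mu S ^ 2.

Definition before (t : Z -> Z) (tau i : Z) : bool := (t i <? tau)%Z.

(* [t i] is the rank of direction [i] in the order of visits. *)
Definition certified (M : Z) (delta : R) (t : Z -> Z) : Prop :=
  exists mu : list (Z * R), List.Forall (fun uw => 0 <= uw.2) mu /\
    caliper_length - delta <= sumR snd mu /\
    forall tau, field_sq M mu (before t tau) <= (1 + delta) ^ 2.

(** Four directions in cyclic order cannot alternate between visited and not visited: every prefix
    of the visit is a circular interval. *)
Definition noncrossing (M : Z) (t : Z -> Z) : Prop :=
  forall tau i j k l, (i < j < k)%Z -> (k < l < i + 10 * M)%Z ->
    ~ [/\ (t i < tau)%Z, (tau <= t j)%Z, (t k < tau)%Z & (tau <= t l)%Z].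

(** Normalization by a rotation. The cut between the two half circles lies between [0] and [1],
    which is why the reflection used later is [1 - i] and atoms come in pairs such as [0], [1]. *)
Definition halved (M : Z) (t : Z -> Z) : Prop :=
  (forall i, (- 5 * M < i <= 0)%Z -> (t i < 5 * M)%Z) /\
  (forall i, (0 < i <= 5 * M)%Z -> (5 * M <= t i)%Z).

Definition periodic (M : Z) (t : Z -> Z) : Prop := forall i, t (i + 10 * M)%Z = t i.

Definition good M t := [/\ periodic M t, noncrossing M t & halved M t].

(** * Symmetries of the field and of the visiting order *)

Section Geometry.
Variable M : Z.
Hypothesis M_pos : (0 < M)%Z.

Lemma grid_step_pos : 0 < grid_step M.
Proof.
have := IZR_lt _ _ M_pos; have := PI_RGT_0 => h1 h2.
by apply: Rdiv_lt_0_compat; lra.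
Qed.

Lemma grid_step_M : IZR M * grid_step M = beta.
Proof. have := IZR_lt _ _ M_pos => h; rewrite /grid_step /beta; field; lra. Qed.

Lemma dirx_add i j : dirx M (i + j) = dirx M i * cos (IZR j * grid_step M) - diry M i * sin (IZR j * grid_step M).
Proof. by rewrite /dirx /diry plus_IZR Rmult_plus_distr_r sin_plus; ring. Qed.

Lemma diry_add i j : diry M (i + j) = diry M i * cos (IZR j * grid_step M) + dirx M i * sin (IZR j * grid_step M).
Proof. by rewrite /dirx /diry plus_IZR Rmult_plus_distr_r cos_plus; ring. Qed.

Lemma dirx_opp i : dirx M (- i) = - dirx M i.
Proof. by rewrite /dirx opp_IZR -Ropp_mult_distr_l sin_neg. Qed.

Lemma diry_opp i : diry M (- i) = diry M i.
Proof. by rewrite /diry opp_IZR -Ropp_mult_distr_l cos_neg. Qed.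

Lemma cos_4beta : cos (4 * beta) = - c.
Proof. rewrite -Rtrigo_facts.cos_pi_minus; congr cos; rewrite /beta; field. Qed.

Lemma sin_4beta : sin (4 * beta) = s.
Proof. rewrite -Rtrigo_facts.sin_pi_minus; congr sin; rewrite /beta; field. Qed.

Lemma cos_4M : cos (IZR (4 * M) * grid_step M) = - c.
Proof. by rewrite mult_IZR Rmult_assoc grid_step_M cos_4beta. Qed.

Lemma sin_4M : sin (IZR (4 * M) * grid_step M) = s.
Proof. by rewrite mult_IZR Rmult_assoc grid_step_M sin_4beta. Qed.

(** The outer normals of a triangle weighted by its side lengths sum to zero. This is the
    translation invariance of the width, and it makes the field of the full circle vanish. *)
Lemma triple_dirx u : triple M (dirx M) u = 0.
Proof.
rewrite /triple -Z.add_opp_r !dirx_add opp_IZR -Ropp_mult_distr_l cos_neg sin_neg cos_4M sin_4M; ring.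
Qed.

Lemma triple_diry u : triple M (diry M) u = 0.
Proof.
rewrite /triple -Z.add_opp_r !diry_add opp_IZR -Ropp_mult_distr_l cos_neg sin_neg cos_4M sin_4M; ring.
Qed.

Lemma wsum_ext mu H K : (forall i, H i = K i) -> wsum M mu H = wsum M mu K.
Proof. by move=> h; apply: sumR_ext => x; rewrite /triple !h. Qed.

Lemma wsum_cat mu1 mu2 H : wsum M (mu1 ++ mu2) H = wsum M mu1 H + wsum M mu2 H.
Proof. exact: sumR_cat. Qed.

Lemma wsum_lin mu a b H K :
  wsum M mu (fun i => a * H i + b * K i) = a * wsum M mu H + b * wsum M mu K.
Proof. by rewrite /wsum -sumR_lin; apply: sumR_ext => x; rewrite /triple; ring. Qed.

Lemma wsum_scal mu a H : wsum M mu (fun i => a * H i) = a * wsum M mu H.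
Proof.
rewrite -[RHS]Rplus_0_r -(Rmult_0_l (wsum M mu H)) -wsum_lin.
by apply: wsum_ext => i; ring.
Qed.

Lemma sumR_eq0 (A : Type) (f : A -> R) l : (forall x, f x = 0) -> sumR f l = 0.
Proof. by move=> h; elim: l => //= x l ->; rewrite h; ring. Qed.

Lemma wsum_dirx mu : wsum M mu (dirx M) = 0.
Proof. by apply: sumR_eq0 => x; rewrite triple_dirx; ring. Qed.

Lemma wsum_diry mu : wsum M mu (diry M) = 0.
Proof. by apply: sumR_eq0 => x; rewrite triple_diry; ring. Qed.

(** The full circle has zero field, so complementary sets have opposite fields. *)
Lemma field_sq_compl mu S S' : (forall i, S' i = ~~ S i) -> field_sq M mu S' = field_sq M mu S.
Proof.
move=> h.
have hx : fieldx M mu S' = - fieldx M mu S.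
  rewrite /fieldx (_ : - wsum _ _ _ = 1 * wsum M mu (dirx M)
     + (-1) * wsum M mu (fun i => ind (S i) * dirx M i)); last by rewrite wsum_dirx; ring.
  rewrite -wsum_lin; apply: wsum_ext => i; rewrite h; case: (S i) => /=; ring.
have hy : fieldy M mu S' = - fieldy M mu S.
  rewrite /fieldy (_ : - wsum _ _ _ = 1 * wsum M mu (diry M)
     + (-1) * wsum M mu (fun i => ind (S i) * diry M i)); last by rewrite wsum_diry; ring.
  rewrite -wsum_lin; apply: wsum_ext => i; rewrite h; case: (S i) => /=; ring.
by rewrite /field_sq hx hy; ring.
Qed.

Lemma field_sq_ext mu S S' : (forall i, S' i = S i) -> field_sq M mu S' = field_sq M mu S.
Proof. by move=> h; rewrite /field_sq; congr (_ ^ 2 + _ ^ 2); apply: wsum_ext => i; rewrite h. Qed.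

Definition move_bases (g : Z -> Z) (mu : list (Z * R)) := [seq (g uw.1, uw.2) | uw <- mu].

Lemma wsum_shift r mu H :
  wsum M (move_bases (fun u => u + r)%Z mu) H = wsum M mu (fun i => H (i + r)%Z).
Proof.
rewrite /wsum /move_bases sumR_map; apply: sumR_ext => -[u w] /=; rewrite /triple.
by congr (_ * (_ + H _ + H _)); lia.
Qed.

Lemma wsum_refl mu H : wsum M (move_bases Z.opp mu) H = wsum M mu (fun i => H (- i)%Z).
Proof.
rewrite /wsum /move_bases sumR_map; apply: sumR_ext => -[u w] /=; rewrite /triple.
have -> : (- u + 4 * M = - (u - 4 * M))%Z by lia.
have -> : (- u - 4 * M = - (u + 4 * M))%Z by lia.
by ring.
Qed.

Lemma field_sq_shift r mu S :
  field_sq M (move_bases (fun u => u + r)%Z mu) S = field_sq M mu (fun i => S (i + r)%Z).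
Proof.
rewrite /field_sq /fieldx /fieldy !wsum_shift.
set C := cos (IZR r * grid_step M); set D := sin (IZR r * grid_step M).
set A := wsum M mu (fun i => ind (S (i + r)%Z) * dirx M i).
set B := wsum M mu (fun i => ind (S (i + r)%Z) * diry M i).
have -> : wsum M mu (fun i => ind (S (i + r)%Z) * dirx M (i + r)) = C * A + (- D) * B.
  rewrite -wsum_lin; apply: wsum_ext => i; rewrite dirx_add -/C -/D; ring.
have -> : wsum M mu (fun i => ind (S (i + r)%Z) * diry M (i + r)) = C * B + D * A.
  rewrite -wsum_lin; apply: wsum_ext => i; rewrite diry_add -/C -/D; ring.
have := sin2_cos2 (IZR r * grid_step M); rewrite /Rsqr -/C -/D => e.
by transitivity ((D * D + C * C) * (A ^ 2 + B ^ 2)); [ring | rewrite e; ring].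
Qed.

Lemma field_sq_refl mu S :
  field_sq M (move_bases Z.opp mu) S = field_sq M mu (fun i => S (- i)%Z).
Proof.
rewrite /field_sq /fieldx /fieldy !wsum_refl.
set A := wsum M mu (fun i => ind (S (- i)%Z) * dirx M i).
have -> : wsum M mu (fun i => ind (S (- i)%Z) * dirx M (- i)) = (-1) * A.
  rewrite -wsum_scal; apply: wsum_ext => i; rewrite dirx_opp; ring.
have -> : wsum M mu (fun i => ind (S (- i)%Z) * diry M (- i)) = wsum M mu (fun i => ind (S (- i)%Z) * diry M i).
  by apply: wsum_ext => i; rewrite diry_opp.
by ring.
Qed.

Lemma Forall_move g mu : List.Forall (fun uw : Z * R => 0 <= uw.2) mu ->
  List.Forall (fun uw : Z * R => 0 <= uw.2) (move_bases g mu).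
Proof. by elim: mu => [|x l IH] h /=; inversion h; constructor => //; apply: IH. Qed.

Lemma total_move g mu : sumR snd (move_bases g mu) = sumR snd mu.
Proof. by rewrite /move_bases sumR_map. Qed.

Lemma certified_shift r delta t : certified M delta (fun i => t (i + r)%Z) -> certified M delta t.
Proof.
move=> [mu [h1 [h2 h3]]]; exists (move_bases (fun u => u + r)%Z mu); split; first exact: Forall_move.
by rewrite total_move; split=> // tau; rewrite field_sq_shift; apply: h3.
Qed.

Lemma certified_refl delta t : certified M delta (fun i => t (- i)%Z) -> certified M delta t.
Proof.
move=> [mu [h1 [h2 h3]]]; exists (move_bases Z.opp mu); split; first exact: Forall_move.
by rewrite total_move; split=> // tau; rewrite field_sq_refl; apply: h3.
Qed.

Lemma certified_rev K delta t : certified M delta (fun i => K - t i)%Z -> certified M delta t.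
Proof.
move=> [mu [h1 [h2 h3]]]; exists mu; split => //; split=> // tau.
rewrite -(@field_sq_compl _ (before t tau) (before (fun i => K - t i)%Z (K - tau + 1))) //.
by move=> i; rewrite /before; lia.
Qed.

(** The maps [1 - i] and [i + 5 * M] exchange the two half circles; time is reversed as well so that
    [halved] is preserved. *)
Definition mirror (t : Z -> Z) (i : Z) : Z := (10 * M - 1 - t (1 - i))%Z.
Definition flip (t : Z -> Z) (i : Z) : Z := (10 * M - 1 - t (i + 5 * M))%Z.

Lemma certified_mirror delta t : certified M delta (mirror t) -> certified M delta t.
Proof.
move=> h; apply: (@certified_rev (10 * M - 1)); apply: certified_refl.
apply: (@certified_shift (-1)); move: h; rewrite /certified => -[mu [h1 [h2 h3]]].
exists mu; split => //; split=> // tau; rewrite (@field_sq_ext _ (before (mirror t) tau)) //.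
by move=> i; rewrite /before /mirror; do 3 f_equal; lia.
Qed.

Lemma certified_flip delta t : certified M delta (flip t) -> certified M delta t.
Proof.
by move=> h; apply: (@certified_rev (10 * M - 1)); apply: (@certified_shift (5 * M)).
Qed.

Lemma good_mirror t : good M t -> good M (mirror t).
Proof.
move=> [hp hn [hl hr]]; split.
- move=> i; rewrite /mirror -(hp (1 - (i + 10 * M))%Z); do 2 f_equal; lia.
- move=> tau i j k l h1 h2 [a1 a2 a3 a4]; rewrite /mirror in a1 a2 a3 a4.
  apply: (hn (10 * M - tau)%Z (1 - l)%Z (1 - k)%Z (1 - j)%Z (1 - i)%Z); try lia.
  by split; lia.
- split=> i hi; rewrite /mirror.
  + by have := hr (1 - i)%Z; lia.
  + by have := hl (1 - i)%Z; lia.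
Qed.

Lemma good_flip t : good M t -> good M (flip t).
Proof.
move=> [hp hn [hl hr]]; split.
- move=> i; rewrite /flip -(hp (i + 5 * M)%Z); do 2 f_equal; lia.
- move=> tau i j k l h1 h2 [a1 a2 a3 a4]; rewrite /flip in a1 a2 a3 a4.
  apply: (hn (10 * M - tau)%Z (j + 5 * M)%Z (k + 5 * M)%Z (l + 5 * M)%Z (i + 10 * M + 5 * M)%Z); try lia.
  have := hp (i + 5 * M)%Z; rewrite (_ : i + 5 * M + 10 * M = i + 10 * M + 5 * M)%Z; last by lia.
  by split; lia.
- split=> i hi; rewrite /flip.
  + by have := hr (i + 5 * M)%Z; lia.
  + by have := hl (i - 5 * M)%Z; have := hp (i - 5 * M)%Z;
      rewrite (_ : i - 5 * M + 10 * M = i + 5 * M)%Z; lia.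
Qed.

(* The shape of a set of directions visited during the first half of the path. *)
Definition left_interval (S : Z -> bool) : Prop :=
  [/\ forall i, S (i + 10 * M)%Z = S i,
      forall i, (0 < i <= 5 * M)%Z -> S i = false &
      forall p q r, (0 <= p < q)%Z -> (q < r < 5 * M)%Z -> S (- p)%Z -> S (- r)%Z -> S (- q)%Z].

(** A gap at [- q] would alternate with direction [1], which belongs to the second half and so lies
    outside the prefix. *)
Lemma left_interval_before t tau : good M t -> (tau <= 5 * M)%Z -> left_interval (before t tau).
Proof.
move=> [hp hn [hl hr]] ht; rewrite /before; split.
- by move=> i; rewrite hp.
- by move=> i hi; have := hr i hi; lia.
- move=> p q r h1 h2 a1 a2; apply/negPn/negP => a3.
  apply: (hn tau (- r)%Z (- q)%Z (- p)%Z 1%Z); try lia.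
  by have := hr 1%Z; split; lia.
Qed.

Definition mirror_base (u : Z) : Z := (1 - u)%Z.

(* Later prefixes are complements of early prefixes of the mirrored reversed order. *)
Lemma field_sq_halves (kappa : R) mu t : good M t ->
  (forall tau, (tau <= 5 * M)%Z -> field_sq M mu (before t tau) <= kappa) ->
  (forall tau, (tau <= 5 * M)%Z -> field_sq M (move_bases mirror_base mu) (before (mirror t) tau) <= kappa) ->
  forall tau, field_sq M mu (before t tau) <= kappa.
Proof.
move=> hg h1 h2 tau; case: (Z_le_gt_dec tau (5 * M)) => ht; first exact: h1.
have := h2 (10 * M - tau)%Z ltac:(lia).
have -> : move_bases mirror_base mu = move_bases (fun u => u + 1)%Z (move_bases Z.opp mu).
  rewrite /move_bases -map_comp; apply: eq_map => -[u w] /=; congr pair; rewrite /mirror_base; lia.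
rewrite field_sq_shift field_sq_refl.
move=> h; apply: Rle_trans h; right; apply: field_sq_compl => i.
by rewrite /before /mirror (_ : 1 - (- i + 1) = i)%Z; lia.
Qed.

End Geometry.

(** * Certificates for zigzagging orders *)

Lemma sin_lipschitz x y : Rabs (sin x - sin y) <= Rabs (x - y).
Proof.
have [t [_ e]] := @MVT_gen sin y x cos (fun t _ => is_derive_sin t)
  (fun t _ => continuity_sin t).
rewrite e Rabs_mult -[X in _ <= X]Rmult_1_l; apply: Rmult_le_compat_r; first exact: Rabs_pos.
by apply: Rabs_le; have := COS_bound t; lra.
Qed.

Lemma cos_lipschitz x y : Rabs (cos x - cos y) <= Rabs (x - y).
Proof.
have := sin_lipschitz (x + PI / 2) (y + PI / 2).
rewrite (_ : x + PI / 2 - (y + PI / 2) = x - y); last by ring.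
by rewrite !(Rplus_comm _ (PI / 2)) -!cos_sin.
Qed.

(** The first-order error is at most 2 * 0.004 * 1.41, which fits into the room of 0.02 left by
    0.98. *)
Lemma near_unit_disc x y x0 y0 : Rabs (x - x0) <= 0.004 -> Rabs (y - y0) <= 0.004 ->
  -1 <= x0 <= 1 -> -1 <= y0 <= 1 -> x0 ^ 2 + y0 ^ 2 <= 0.98 -> x ^ 2 + y ^ 2 <= 1.
Proof.
move=> /Rabs_le_between h1 /Rabs_le_between h2 h3 h4 h5.
have [e1 | e1] := Rle_or_lt (Rabs x0 + Rabs y0) 1.41; last first.
  have := pow2_ge_0 (Rabs x0 - Rabs y0); rewrite -(pow2_abs x0) -(pow2_abs y0) in h5; nra.
have k1 : x0 * (x - x0) <= 0.004 * Rabs x0 by rewrite /Rabs; case: Rcase_abs => *; nra.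
have k2 : y0 * (y - y0) <= 0.004 * Rabs y0 by rewrite /Rabs; case: Rcase_abs => *; nra.
have k3 : (x - x0) ^ 2 <= 0.000016 by nra.
have k4 : (y - y0) ^ 2 <= 0.000016 by nra.
have -> : x ^ 2 + y ^ 2 = x0 ^ 2 + y0 ^ 2 + 2 * (x0 * (x - x0)) + 2 * (y0 * (y - y0))
   + (x - x0) ^ 2 + (y - y0) ^ 2 by ring.
lra.
Qed.

Lemma wsum_cons M u w mu H : wsum M ((u, w) :: mu) H = w * triple M H u + wsum M mu H.
Proof. by []. Qed.

Lemma wsum_nil M H : wsum M [::] H = 0.
Proof. by []. Qed.

Section Atoms.
Variable M : Z.
Hypothesis M_gt1 : (1 < M)%Z.
Hypothesis step_small : grid_step M <= 0.001.
Let M_pos : (0 < M)%Z. Proof. lia. Qed.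

Lemma dirx_succ i : Rabs (dirx M (1 + i) - dirx M i) <= 0.001.
Proof.
apply: Rle_trans (sin_lipschitz _ _) _.
have := grid_step_pos M_pos; rewrite plus_IZR => h.
rewrite (_ : (1 + IZR i) * grid_step M - IZR i * grid_step M = grid_step M); last by ring.
by rewrite Rabs_pos_eq; lra.
Qed.

Lemma diry_succ i : Rabs (diry M (1 + i) - diry M i) <= 0.001.
Proof.
rewrite /diry (_ : - _ - - _ = - (cos (IZR (1 + i) * grid_step M) - cos (IZR i * grid_step M))); last by ring.
rewrite Rabs_Ropp; apply: Rle_trans (cos_lipschitz _ _) _.
have := grid_step_pos M_pos; rewrite plus_IZR => h.
rewrite (_ : (1 + IZR i) * grid_step M - IZR i * grid_step M = grid_step M); last by ring.
by rewrite Rabs_pos_eq; lra.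
Qed.

Lemma dir_period i : dirx M (i + 10 * M) = dirx M i /\ diry M (i + 10 * M) = diry M i.
Proof.
have e : IZR (10 * M) * grid_step M = 2 * PI.
  by rewrite mult_IZR Rmult_assoc grid_step_M // /beta; field.
by rewrite dirx_add diry_add e sin_2PI cos_2PI; split; ring.
Qed.

Lemma dir_values :
  [/\ dirx M 0 = 0 /\ diry M 0 = -1,
      dirx M (- (4 * M)) = - s /\ diry M (- (4 * M)) = c,
      dirx M (- (5 * M)) = 0 /\ diry M (- (5 * M)) = 1 &
      dirx M (- M) = - s /\ diry M (- M) = - c].
Proof.
have e5 : IZR (5 * M) * grid_step M = PI.
  by rewrite mult_IZR Rmult_assoc grid_step_M // /beta; field.
rewrite !dirx_opp !diry_opp /dirx /diry sin_4M // cos_4M // e5 grid_step_M // Rmult_0_l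
  sin_0 cos_0 sin_PI cos_PI -/s -/c.
by split; split; ring.
Qed.

Lemma dir_approx :
  [/\ Rabs (dirx M (1 - 4 * M) - - 0.588) <= 0.0015 /\ Rabs (diry M (1 - 4 * M) - 0.809) <= 0.0015,
      Rabs (dirx M (- (4 * M)) - - 0.588) <= 0.0015 /\ Rabs (diry M (- (4 * M)) - 0.809) <= 0.0015,
      Rabs (dirx M (1 - 5 * M) - 0) <= 0.0015 /\ Rabs (diry M (1 - 5 * M) - 1) <= 0.0015,
      Rabs (dirx M (1 - M) - - 0.588) <= 0.0015 /\ Rabs (diry M (1 - M) - - 0.809) <= 0.0015 &
      Rabs (dirx M (- M) - - 0.588) <= 0.0015 /\ Rabs (diry M (- M) - - 0.809) <= 0.0015].
Proof.
have [_ [e1 e2] [e3 e4] [e5 e6]] := dir_values.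
have hs := s_bounds; have hc := c_bounds.
have k1 := dirx_succ (- (4 * M)); have k2 := diry_succ (- (4 * M)).
have k3 := dirx_succ (- (5 * M)); have k4 := diry_succ (- (5 * M)).
have k5 := dirx_succ (- M); have k6 := diry_succ (- M).
rewrite !Z.add_opp_r ?e1 ?e2 ?e3 ?e4 ?e5 ?e6 in k1 k2 k3 k4 k5 k6 *.
move: k1 k2 k3 k4 k5 k6 => /Rabs_le_between k1 /Rabs_le_between k2 /Rabs_le_between k3
  /Rabs_le_between k4 /Rabs_le_between k5 /Rabs_le_between k6.
by split; split; apply: Rabs_le; lra.
Qed.

(** The bases [0], [1], [1 - 5 * M], [5 * M] meet twelve directions. Six of them lie in the
    unvisited half circle [(0, 5 * M]]; only the other six can contribute to the field. *)
Lemma left_interval_values S : left_interval M S ->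
  [/\ [/\ S (0 + 4 * M)%Z = false, S 1%Z = false, S (1 + 4 * M)%Z = false, S (5 * M)%Z = false &
         S (5 * M - 4 * M)%Z = false],
      S (1 - 5 * M - 4 * M)%Z = false,
      S (0 - 4 * M)%Z = S (- (4 * M))%Z,
      S (5 * M + 4 * M)%Z = S (- M)%Z & S (1 - 5 * M + 4 * M)%Z = S (1 - M)%Z].
Proof.
move=> [hp hr _].
have e1 : S (1 - 5 * M - 4 * M)%Z = false.
  by rewrite -hp hr //; lia.
have e2 : S (5 * M + 4 * M)%Z = S (- M)%Z by rewrite -(hp (- M)%Z); congr S; lia.
split => //; last by congr S; lia.
by split; apply: hr; lia.
Qed.

(* What being an interval says about the membership of the six directions met by the atoms. *)
Definition chain (a e e' d d' b : bool) : bool :=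
  [&& a && e' ==> e, a && d ==> e', a && d' ==> d, e && d ==> e', e && d' ==> d &
   [&& e && b ==> d', a && b ==> d', e' && d' ==> d & d && b ==> d']].

Lemma left_interval_chain S : left_interval M S ->
  chain (S 0%Z) (S (1 - M)%Z) (S (- M)%Z) (S (1 - 4 * M)%Z) (S (- (4 * M))%Z) (S (1 - 5 * M)%Z).
Proof.
move=> [_ _ h].
have k p q r : (0 <= p < q)%Z -> (q < r < 5 * M)%Z -> forall x y z, x = (- p)%Z -> y = (- r)%Z ->
    z = (- q)%Z -> S x && S y ==> S z.
  by move=> h1 h2 x y z -> -> ->; apply/implyP => /andP[]; apply: h h1 h2.
rewrite /chain; repeat (apply/andP; split).
- apply: (k 0 (M - 1) M)%Z; lia.
- apply: (k 0 M (4 * M - 1))%Z; lia.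
- apply: (k 0 (4 * M - 1) (4 * M))%Z; lia.
- apply: (k (M - 1) M (4 * M - 1))%Z; lia.
- apply: (k (M - 1) (4 * M - 1) (4 * M))%Z; lia.
- apply: (k (M - 1) (4 * M) (5 * M - 1))%Z; lia.
- apply: (k 0 (4 * M) (5 * M - 1))%Z; lia.
- apply: (k M (4 * M - 1) (4 * M))%Z; lia.
- apply: (k (4 * M - 1) (4 * M) (5 * M - 1))%Z; lia.
Qed.

Lemma top_products :
  -0.002 <= c * dirx M (1 - 5 * M) <= 0.002 /\ 0.8075 <= c * diry M (1 - 5 * M) <= 0.8105.
Proof.
have [_ _ [/Rabs_le_between k1 /Rabs_le_between k2] _ _] := dir_approx.
by have hc := c_bounds; split; split; nra.
Qed.

(** The field of the four atoms with s and c rounded to 0.588 and 0.809 and offsets by one grid step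
    ignored; the disc condition becomes a finite check over the 64 membership patterns of six
    directions. *)
Definition approx_x (b1 b2 b3 b4 : R) (S : Z -> bool) :=
  - 0.588 * (b1 * ind (S (1 - M)%Z) + b2 * ind (S (- M)%Z)
    + b3 * ind (S (1 - 4 * M)%Z) + b4 * ind (S (- (4 * M))%Z)).
Definition approx_y (a t b1 b2 b3 b4 : R) (S : Z -> bool) :=
  1.618 * (t * ind (S (1 - 5 * M)%Z) - a * ind (S 0%Z))
  + 0.809 * (b3 * ind (S (1 - 4 * M)%Z) + b4 * ind (S (- (4 * M))%Z)
     - b1 * ind (S (1 - M)%Z) - b2 * ind (S (- M)%Z)).

Lemma atoms_le1 (w0 w1 wt wt' : R) S : left_interval M S ->
  0 <= w0 <= 0.6 -> 0 <= w1 <= 0.6 -> 0 <= wt <= 0.42 -> 0 <= wt' <= 0.42 ->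
  w0 + w1 + wt + wt' <= 1.3600001 ->
  (let x := approx_x wt wt' w1 w0 S in let y := approx_y w0 wt wt wt' w1 w0 S in
   -1 <= x <= 1 /\ -1 <= y <= 1 /\ x ^ 2 + y ^ 2 <= 0.98) ->
  field_sq M [:: (0%Z, w0); (1%Z, w1); ((1 - 5 * M)%Z, wt); ((5 * M)%Z, wt')] S <= 1.
Proof.
move=> hS h0 h1 ht ht' hw [hx [hy hxy]].
have z0 : (0 - 4 * M = - (4 * M))%Z by [].
have z1 : (5 * M + 4 * M = - M + 10 * M)%Z by lia.
have z2 : (1 - 5 * M + 4 * M = 1 - M)%Z by lia.
have [[f1 f2 f3 f4 f5] f6 f7 f8 f9] := left_interval_values hS.
have [[e1 e2] _ _ _] := dir_values.
have [[/Rabs_le_between k1 /Rabs_le_between k2] [/Rabs_le_between k3 /Rabs_le_between k4]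
     [/Rabs_le_between k5 /Rabs_le_between k6] [/Rabs_le_between k7 /Rabs_le_between k8]
     [/Rabs_le_between k9 /Rabs_le_between k10]] := dir_approx.
have hc := c_bounds.
have [k11 k12] := top_products.
rewrite /field_sq /fieldx /fieldy !wsum_cons !wsum_nil /triple.
rewrite f1 f2 f3 f4 f5 f6 f8 f9 z0 e1 e2 z1 z2 (proj1 (dir_period _)) (proj2 (dir_period _)).
have e a b x x0 : 0 <= a -> - (0.0015) <= x - x0 <= 0.0015 ->
   - 0.0015 * a <= a * (ind b * x) - x0 * (a * ind b) <= 0.0015 * a.
  by move=> ha hxx; case: b; rewrite /ind; nra.
have e' a b x x0 tol : 0 <= a -> - tol <= c * x - x0 <= tol ->
   - (2 * tol * a) <= a * (2 * c * (ind b * x)) - (2 * x0) * (a * ind b) <= 2 * tol * a.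
  by move=> ha hxx; case: b; rewrite /ind; nra.
have E1 := e w1 (S (1 - 4 * M)%Z) _ _ (proj1 h1) k1.
have E2 := e w1 (S (1 - 4 * M)%Z) _ _ (proj1 h1) k2.
have E3 := e w0 (S (- (4 * M))%Z) _ _ (proj1 h0) k3.
have E4 := e w0 (S (- (4 * M))%Z) _ _ (proj1 h0) k4.
have E7 := e wt (S (1 - M)%Z) _ _ (proj1 ht) k7.
have E8 := e wt (S (1 - M)%Z) _ _ (proj1 ht) k8.
have E9 := e wt' (S (- M)%Z) _ _ (proj1 ht') k9.
have E10 := e wt' (S (- M)%Z) _ _ (proj1 ht') k10.
have E5 := @e' wt (S (1 - 5 * M)%Z) (dirx M (1 - 5 * M)) 0 0.002 (proj1 ht) ltac:(lra).
have E6 := @e' wt (S (1 - 5 * M)%Z) (diry M (1 - 5 * M)) 0.809 0.0015 (proj1 ht) ltac:(lra).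
have E0 := @e' w0 (S 0%Z) (-1) (- 0.809) 0.00002 (proj1 h0) ltac:(lra).
clear - h0 h1 ht ht' hw hx hy hxy E0 E1 E2 E3 E4 E5 E6 E7 E8 E9 E10.
apply: (near_unit_disc (x0 := approx_x wt wt' w1 w0 S)
  (y0 := approx_y w0 wt wt wt' w1 w0 S)) => //; apply: Rabs_le;
  rewrite /approx_x /approx_y (_ : ind false = 0) //; lra.
Qed.

(** The weights have total 1.36 > T. The hypothesis excludes patterns such as [- (4 * M)],
    [1 - 4 * M], [1 - 5 * M] visited without [0], for which the field would be too long. *)
Lemma zigzag_left_short S : left_interval M S -> (S (- (4 * M))%Z -> S 0%Z) ->
  field_sq M [:: (0%Z, 0.36); (1%Z, 0.59); ((1 - 5 * M)%Z, 0.41); ((5 * M)%Z, 0)] S <= 1.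
Proof.
move=> hS hA; apply: atoms_le1 => //; try lra.
have := left_interval_chain hS; rewrite /approx_x /approx_y; move/implyP: hA.
move: (S 0%Z) (S (1 - M)%Z) (S (- M)%Z) (S (1 - 4 * M)%Z) (S (- (4 * M))%Z) (S (1 - 5 * M)%Z).
by (do 6 case); move=> //= _ _; rewrite /ind; lra.
Qed.

(** The weights are those of [zigzag_left_short] reflected by [1 - i]: this treats the second half
    of the same order, where the zigzag occurs. *)
Lemma zigzag_right_short S : left_interval M S -> (S 0%Z -> S (- (4 * M))%Z) ->
  field_sq M [:: (0%Z, 0.59); (1%Z, 0.36); ((1 - 5 * M)%Z, 0); ((5 * M)%Z, 0.41)] S <= 1.
Proof.
move=> hS hA; apply: atoms_le1 => //; try lra.
have := left_interval_chain hS; rewrite /approx_x /approx_y; move/implyP: hA.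
move: (S 0%Z) (S (1 - M)%Z) (S (- M)%Z) (S (1 - 4 * M)%Z) (S (- (4 * M))%Z) (S (1 - 5 * M)%Z).
by (do 6 case); move=> //= _ _; rewrite /ind; lra.
Qed.

(** Equal weights, again of total 1.36, on a set of bases invariant under both the reflection and
    the half turn: this is for orders that zigzag at both ends and for both pairs of opposite
    bases. *)
Lemma double_zigzag_short S : left_interval M S -> (S 0%Z -> S (- (4 * M))%Z) ->
  (S (1 - 5 * M)%Z -> S (1 - M)%Z) ->
  field_sq M [:: (0%Z, 0.34); (1%Z, 0.34); ((1 - 5 * M)%Z, 0.34); ((5 * M)%Z, 0.34)] S <= 1.
Proof.
move=> hS hA hB; apply: atoms_le1 => //; try lra.
have := left_interval_chain hS; rewrite /approx_x /approx_y; move/implyP: hA; move/implyP: hB.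
move: (S 0%Z) (S (1 - M)%Z) (S (- M)%Z) (S (1 - 4 * M)%Z) (S (- (4 * M))%Z) (S (1 - 5 * M)%Z).
by (do 6 case); move=> //= _ _ _; rewrite /ind; lra.
Qed.

End Atoms.

(** * The certificate for the optimal order *)

Definition sumN (n : nat) (F : nat -> R) : R := sumR F (iota 0 n).

Lemma sumN_S n F : sumN n.+1 F = sumN n F + F n.
Proof. by rewrite /sumN -addn1 iotaD sumR_cat /= add0n Rplus_0_r. Qed.

Lemma sumN_0 F : sumN 0 F = 0.
Proof. by []. Qed.

Lemma sumN_ext n F G : (forall k, (k < n)%N -> F k = G k) -> sumN n F = sumN n G.
Proof.
elim: n => [//|n IH] h; rewrite !sumN_S h // IH // => k hk; apply: h; exact: ltnW.
Qed.

Lemma sumN_bounds n F lo hi : (forall k, (k < n)%N -> lo <= F k <= hi) ->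
  INR n * lo <= sumN n F <= INR n * hi.
Proof.
elim: n => [|n IH] h; first by rewrite sumN_0 /=; lra.
rewrite sumN_S S_INR; have := h n (ltnSn n).
by have := IH (fun k hk => h k (ltnW hk)); lra.
Qed.

Lemma sumN_lin n a b F G : sumN n (fun k => a * F k + b * G k) = a * sumN n F + b * sumN n G.
Proof. exact: sumR_lin. Qed.

Lemma sumN_prefix n m F : (m <= n)%N -> sumN n (fun k => ind (k < m)%N * F k) = sumN m F.
Proof.
elim: n => [|n IH] h; first by have -> : m = 0%N by lia.
rewrite sumN_S; case: (ltnP n m) => hm; rewrite /ind.
- have -> : m = n.+1 by lia.
  rewrite sumN_S; congr (_ + _); last by ring.
  by apply: sumN_ext => k hk; rewrite (_ : (k < n.+1)%N); [ring | lia].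
- by rewrite IH //; ring.
Qed.

(** By telescoping, the weight [2 * sin (h / 2)] makes the sum equal to the integral of the sine
    over the cells of length h centred at the nodes. The discretized measure uses this weight, so a
    full or initial sum has no quadrature error. *)
Lemma sumN_sin n h x : sumN n (fun k => 2 * sin (h / 2) * sin (x + INR k * h)) =
  cos (x - h / 2) - cos (x + INR n * h - h / 2).
Proof.
elim: n => [|n IH]; first by rewrite sumN_0 /= Rmult_0_l Rplus_0_r; ring.
rewrite sumN_S IH S_INR.
set z := cos (x - h / 2); set y := x + INR n * h.
have -> : x + (INR n + 1) * h - h / 2 = y + h / 2 by rewrite /y; field.
by rewrite cos_minus cos_plus; ring.
Qed.

Lemma sumN_cos n h x : sumN n (fun k => 2 * sin (h / 2) * cos (x + INR k * h)) =
  sin (x + INR n * h - h / 2) - sin (x - h / 2).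
Proof.
elim: n => [|n IH]; first by rewrite sumN_0 /= Rmult_0_l Rplus_0_r; ring.
rewrite sumN_S IH S_INR.
set z := sin (x - h / 2); set y := x + INR n * h.
have -> : x + (INR n + 1) * h - h / 2 = y + h / 2 by rewrite /y; field.
by rewrite sin_minus sin_plus; ring.
Qed.

Lemma sumN_sin_rev n h X x : sumN n (fun k => 2 * sin (h / 2) * sin (X - (x + INR k * h))) =
  cos (X - (x + INR n * h - h / 2)) - cos (X - (x - h / 2)).
Proof.
elim: n => [|n IH]; first by rewrite sumN_0 /= Rmult_0_l Rplus_0_r; ring.
rewrite sumN_S IH S_INR; set y := x + INR n * h; set z := _ (X - (x - h / 2)).
have -> : X - (y - h / 2) = (X - y) + h / 2 by field.
have -> : X - (x + (INR n + 1) * h - h / 2) = (X - y) - h / 2 by rewrite /y; field.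
by rewrite cos_minus cos_plus; ring.
Qed.

Lemma sumN_cos_rev n h X x : sumN n (fun k => 2 * sin (h / 2) * cos (X - (x + INR k * h))) =
  sin (X - (x - h / 2)) - sin (X - (x + INR n * h - h / 2)).
Proof.
elim: n => [|n IH]; first by rewrite sumN_0 /= Rmult_0_l Rplus_0_r; ring.
rewrite sumN_S IH S_INR; set y := x + INR n * h; set z := _ (X - (x - h / 2)).
have -> : X - (y - h / 2) = (X - y) + h / 2 by field.
have -> : X - (x + (INR n + 1) * h - h / 2) = (X - y) - h / 2 by rewrite /y; field.
by rewrite sin_minus sin_plus; ring.
Qed.

Lemma monotone_prefix n (b : nat -> bool) :
  (forall j k, (j < k < n)%N -> b k -> b j) ->
  exists2 m, (m <= n)%N & forall k, (k < n)%N -> b k = (k < m)%N.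
Proof.
elim: n => [|n IH] h; first by exists 0%N.
have [m hm e] : exists2 m, (m <= n)%N & forall k, (k < n)%N -> b k = (k < m)%N.
  by apply: IH => j k hjk; apply: h; lia.
case E : (b n).
- exists n.+1 => // k hk; rewrite hk; case: (ltngtP k n) => hkn; [|lia|by rewrite hkn].
  by apply: (h k n) => //; lia.
- exists m; first by lia.
  move=> k hk; case: (ltngtP k n) => hkn; [exact: e|lia|by rewrite hkn E; lia].
Qed.

Lemma wsum_family M g nu n H :
  wsum M [seq (g k, nu) | k <- iota 0 n] H = nu * sumN n (fun k => triple M H (g k)).
Proof. by rewrite /wsum /sumN sumR_map; elim: (iota 0 n) => /= [|k l ->]; ring. Qed.

(** The densities occupy bases at angles from [start_angle] to [end_angle] (about 94 to 104 degrees)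
    on either side of the atom. *)
Definition start_angle : R := PI / 2 - b_angle.
Definition end_angle : R := PI / 2 - a_angle.

Lemma half_PI_beta : PI / 2 = 5 / 2 * beta.
Proof. by rewrite /beta; field. Qed.

(** Continuous limit of the moment when the right-hand family has contributed its first companions:
    the vector reaches the unit circle at [start_angle]. *)
Lemma ideal_after_R :
  (cos (4 * beta - end_angle) - cos (4 * beta - start_angle)) / (2 * c) = cos start_angle * -1 /\
  c * lambda + (sin (4 * beta - start_angle) - sin (4 * beta - end_angle)) / (2 * c) = sin start_angle.
Proof.
have [e1 e2] := tight_identities; have hc := c_bounds.
rewrite /start_angle /end_angle.
have k x : 4 * beta - (PI / 2 - x) = PI / 2 - (beta - x) by rewrite half_PI_beta; field.
rewrite !k !cos_shift !sin_shift; split.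
- by rewrite e1; field; lra.
- by rewrite e2; field; lra.
Qed.

(** Continuous limit of the moment when all left directions in play have been visited: the vector is
    [(1, 0)]. The first equation is the definition of [lambda]. *)
Lemma ideal_after_S :
  - cos end_angle + (cos (6 * beta - end_angle) - cos (6 * beta - start_angle)) / (2 * c) + s * lambda = 1 /\
  sin end_angle + (sin (6 * beta - start_angle) - sin (6 * beta - end_angle)) / (2 * c) - c * lambda = 0.
Proof.
have [e1 e2] := tight_identities; have hc := c_bounds; have hs := s_bounds.
rewrite /start_angle /end_angle.
have k x : 6 * beta - (PI / 2 - x) = PI / 2 + (x + beta) by rewrite half_PI_beta; field.
rewrite !k !cos_shift !sin_shift -!cos_sin; split.
- have k2 x : cos (PI / 2 + x) = - sin x by rewrite (sin_cos x); ring.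
  by rewrite !k2 /lambda; field; lra.
- rewrite e2 !cos_minus !cos_plus -/c -/s; field; lra.
Qed.

Lemma sumN_weighted n (b : nat -> bool) w F lo hi : 0 <= w ->
  (forall k, (k < n)%N -> lo <= F k <= hi) ->
  lo * sumN n (fun k => ind (b k) * w) <= sumN n (fun k => ind (b k) * (w * F k))
    <= hi * sumN n (fun k => ind (b k) * w).
Proof.
move=> hw; elim: n => [|n IH] h; first by rewrite !sumN_0; lra.
rewrite !sumN_S; have := h n (ltnSn n); have := IH (fun k hk => h k (ltnW hk)).
by case: (b n); rewrite /ind => h1 h2; nra.
Qed.

Lemma sumN_split n (b : nat -> bool) F :
  sumN n F = sumN n (fun k => ind (b k) * F k) + sumN n (fun k => ind (~~ b k) * F k).
Proof. by elim: n => [|n IH]; rewrite ?sumN_0 ?sumN_S ?IH; [ring | case: (b n) => /=; ring]. Qed.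

Lemma near_unit_circle x y x0 y0 e : Rabs (x - x0) <= e -> Rabs (y - y0) <= e ->
  x0 ^ 2 + y0 ^ 2 = 1 -> e <= 0.5 -> x ^ 2 + y ^ 2 <= 1 + 4 * e.
Proof.
move=> h1 h2 h5 he.
have he0 : 0 <= e by apply: Rle_trans h1; exact: Rabs_pos.
have e1 : Rabs x0 + Rabs y0 <= 1.42.
  have := pow2_ge_0 (Rabs x0 - Rabs y0); rewrite -(pow2_abs x0) -(pow2_abs y0) in h5.
  have := Rabs_pos x0; have := Rabs_pos y0; nra.
move: h1 h2 => /Rabs_le_between h1 /Rabs_le_between h2.
have k1 : x0 * (x - x0) <= e * Rabs x0 by rewrite /Rabs; case: Rcase_abs => *; nra.
have k2 : y0 * (y - y0) <= e * Rabs y0 by rewrite /Rabs; case: Rcase_abs => *; nra.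
have k3 : (x - x0) ^ 2 <= e * e by nra.
have k4 : (y - y0) ^ 2 <= e * e by nra.
have -> : x ^ 2 + y ^ 2 = x0 ^ 2 + y0 ^ 2 + 2 * (x0 * (x - x0)) + 2 * (y0 * (y - y0))
   + (x - x0) ^ 2 + (y - y0) ^ 2 by ring.
nra.
Qed.

Lemma beta_bounds : 0.587 <= beta <= 0.8.
Proof.
have h : 0 < beta by rewrite /beta; have := PI_RGT_0; lra.
have := sin_lt_x beta h; rewrite -/s; have := s_bounds => h1 h2.
by split; [lra | rewrite /beta; have := PI_4; lra].
Qed.

Lemma sin_cos_window phi : a_angle <= phi <= b_angle ->
  -0.2367 <= sin phi <= -0.0726 /\ 0.97 <= cos phi <= 1.
Proof.
move=> h; have ha := a_angle_bounds; have hb := b_angle_bounds.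
have [[h1 h2] [h3 h4]] := sin_cos_ab_bounds.
have hpi : 1 <= PI / 2 by have := PI2_3_2; lra.
have k1 := @sin_incr_1 a_angle phi; have k2 := @sin_incr_1 phi b_angle.
have k3 : 0 <= cos phi by apply: cos_ge_0; lra.
have := sin2_cos2 phi; rewrite /Rsqr => e; have := COS_bound phi => k5.
have k4 : -0.2367 <= sin phi <= -0.0726 by split; lra.
split=> //; set u := sin phi in k4 e; set v := cos phi in k3 k5 e *.
clear - k3 k4 k5 e; have : u * u <= 0.2367 * 0.2367 by nra.
by split; [nra | lra].
Qed.

(** * Field of the discretized optimal measure *)

Section Main.
Variables (M j1 : Z) (n : nat).
Hypothesis M_gt1 : (1 < M)%Z.
Let h := grid_step M.
Let x0 := IZR j1 * h.
Hypothesis step_small : h <= 0.0005.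
Hypothesis j1_spec : start_angle <= x0 < start_angle + h.
Hypothesis n_spec : x0 + INR n * h - h <= end_angle < x0 + INR n * h.
Let M_pos : (0 < M)%Z. Proof. lia. Qed.
Let h_pos : 0 < h. Proof. exact: grid_step_pos. Qed.
(** The right-hand family is based at [1 + j] instead of [j], so its companions, seen as [- p], sit
    one step short of the ideal angles. *)
Let X := 4 * beta - h.
Let X' := 6 * beta - h.
Let w := 2 * sin (h / 2).
Let y k := x0 + INR k * h.

Lemma w_bounds : 0 < w <= h.
Proof.
rewrite /w; have := sin_lt_x (h / 2); have := sin_gt_0 (h / 2); have := PI2_3_2.
by move=> *; split; lra.
Qed.

Lemma window k : (k < n)%N -> a_angle <= PI / 2 - y k <= b_angle.
Proof.
move=> hk; have : INR k + 1 <= INR n by rewrite -S_INR; apply: le_INR; lia.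
move: j1_spec n_spec; rewrite /start_angle /end_angle /y => h1 h2 h3.
by have := pos_INR k; split; nra.
Qed.

(** The angles lie strictly between [2 * beta] and [3 * beta]. Hence the companions at
    [4 * M - 1 - j], the bases at [j] and the companions at [6 * M - 1 - j] occupy disjoint, ordered
    ranges between [M] and [4 * M]. *)
Lemma index_range k : (k < n)%N -> (2 * M < j1 + Z.of_nat k < 3 * M - 1)%Z.
Proof.
move=> hk; have := window hk; rewrite /y /x0 half_PI_beta INR_IZR_INZ.
have := grid_step_M M_pos; rewrite -/h => e1 e2.
have := a_angle_bounds; have := b_angle_bounds; have := beta_bounds => b1 b2 b3.
split; apply: lt_IZR; apply: (Rmult_lt_reg_r h) => //.
- rewrite plus_IZR mult_IZR; lra.
- rewrite plus_IZR minus_IZR mult_IZR; lra.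
Qed.

Lemma window_shifted k : (k < n)%N ->
  let psi := PI / 2 - y k - h in -0.2405 <= sin psi <= -0.07 /\ 0.969 <= cos psi <= 1.
Proof.
move=> hk psi; have [h1 h2] := sin_cos_window (window hk).
have k1 := sin_lipschitz psi (PI / 2 - y k); have k2 := cos_lipschitz psi (PI / 2 - y k).
rewrite (_ : psi - (PI / 2 - y k) = - h) ?Rabs_Ropp ?(Rabs_pos_eq h) in k1 k2; [|lra|rewrite /psi; ring].
move: k1 k2 => /Rabs_le_between k1 /Rabs_le_between k2.
by have := COS_bound psi; split; split; lra.
Qed.

Lemma U_bounds k : (k < n)%N -> 0.97 <= sin (y k) <= 1 /\ -0.2367 <= cos (y k) <= -0.0726.
Proof.
move=> hk; have := sin_cos_window (window hk).
by rewrite cos_shift sin_shift => -[].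
Qed.

Lemma R_bounds k : (k < n)%N -> 0.6 <= sin (X - y k) <= 0.8 /\ 0.6 <= cos (X - y k) <= 0.8.
Proof.
move=> hk; have [h1 h2] := window_shifted hk.
have -> : X - y k = PI / 2 - (beta - (PI / 2 - y k - h)) by rewrite /X half_PI_beta; field.
rewrite sin_shift cos_shift; move: (PI / 2 - y k - h) h1 h2 => psi h1 h2.
rewrite cos_minus sin_minus -/c -/s.
set u := sin psi in h1 *; set v := cos psi in h2 *.
have hc := c_bounds; have hs := s_bounds.
have p1 : 0.809 * v <= c * v <= 0.8091 * v by split; apply: Rmult_le_compat_r; lra.
have p2 : 0.5877 * v <= s * v <= 0.5878 * v by split; apply: Rmult_le_compat_r; lra.
have p3 : 0.809 * (- u) <= c * (- u) <= 0.8091 * (- u) by split; apply: Rmult_le_compat_r; lra.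
have p4 : 0.5877 * (- u) <= s * (- u) <= 0.5878 * (- u) by split; apply: Rmult_le_compat_r; lra.
by clear - h1 h2 p1 p2 p3 p4; split; split; lra.
Qed.

Lemma S_bounds k : (k < n)%N ->
  0.8 <= sin (X' - y k) <= 0.97 /\ -0.55 <= cos (X' - y k) <= -0.36.
Proof.
move=> hk; have [h1 h2] := window_shifted hk.
have -> : X' - y k = PI / 2 + (beta + (PI / 2 - y k - h)) by rewrite /X' half_PI_beta; field.
have k2 x : cos (PI / 2 + x) = - sin x by rewrite (sin_cos x); ring.
rewrite -cos_sin k2; move: (PI / 2 - y k - h) h1 h2 => psi h1 h2.
rewrite cos_plus sin_plus -/c -/s.
set u := sin psi in h1 *; set v := cos psi in h2 *.
have hc := c_bounds; have hs := s_bounds.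
have p1 : 0.809 * v <= c * v <= 0.8091 * v by split; apply: Rmult_le_compat_r; lra.
have p2 : 0.5877 * v <= s * v <= 0.5878 * v by split; apply: Rmult_le_compat_r; lra.
have p3 : 0.809 * (- u) <= c * (- u) <= 0.8091 * (- u) by split; apply: Rmult_le_compat_r; lra.
have p4 : 0.5877 * (- u) <= s * (- u) <= 0.5878 * (- u) by split; apply: Rmult_le_compat_r; lra.
by clear - h1 h2 p1 p2 p3 p4; split; split; lra.
Qed.

(* Discretization of the optimal dual measure: an atom [lambda] at the base of the gnomon and two
   mirror-image families of density 1 / (2 c) over an arc of bases. *)
Definition caliper_measure : list (Z * R) :=
  [:: (0%Z, lambda / 2); (1%Z, lambda / 2)]
  ++ [seq ((- (j1 + Z.of_nat k))%Z, w / (2 * c)) | k <- iota 0 n]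
  ++ [seq ((1 + (j1 + Z.of_nat k))%Z, w / (2 * c)) | k <- iota 0 n].

Section Bound.
Variable S : Z -> bool.
Hypothesis hS : left_interval M S.

(** U stands for the bases of the left family, R and S for the two companions of the right family, A
    for direction [0], D for [- (4 * M)]. Going away from [0] the order is A, R, U, S, [1 - 4 * M],
    D, so a left interval that contains A fills them in this order. *)
Let bU k := S (- (j1 + Z.of_nat k))%Z.
Let bR k := S (- (4 * M - 1 - (j1 + Z.of_nat k)))%Z.
Let bS k := S (- (6 * M - 1 - (j1 + Z.of_nat k)))%Z.

Definition gx := lambda / 2 * (ind (S (- (4 * M))%Z) * s + ind (S (1 - 4 * M)%Z) * sin X)
  + sumN n (fun k => ind (bU k) * (w * sin (y k)))
  + / (2 * c) * sumN n (fun k => ind (bR k) * (w * sin (X - y k)))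
  + / (2 * c) * sumN n (fun k => ind (bS k) * (w * sin (X' - y k))).

Definition gy := lambda * c * ind (S 0%Z)
  + lambda / 2 * (ind (S (- (4 * M))%Z) * - c + ind (S (1 - 4 * M)%Z) * cos X)
  + sumN n (fun k => ind (bU k) * (w * cos (y k)))
  + / (2 * c) * sumN n (fun k => ind (bR k) * (w * cos (X - y k)))
  + / (2 * c) * sumN n (fun k => ind (bS k) * (w * cos (X' - y k))).

Lemma dir_opp_angle p : dirx M (- p) = - sin (IZR p * h) /\ diry M (- p) = - cos (IZR p * h).
Proof. by rewrite dirx_opp diry_opp. Qed.

Lemma angle_R k : IZR (4 * M - 1 - (j1 + Z.of_nat k)) * h = X - y k.
Proof.
rewrite !minus_IZR plus_IZR mult_IZR -INR_IZR_INZ /X /y /x0 -(grid_step_M M_pos) -/h; ring.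
Qed.

Lemma angle_S k : IZR (6 * M - 1 - (j1 + Z.of_nat k)) * h = X' - y k.
Proof.
rewrite !minus_IZR plus_IZR mult_IZR -INR_IZR_INZ /X' /y /x0 -(grid_step_M M_pos) -/h; ring.
Qed.

Lemma angle_U k : IZR (j1 + Z.of_nat k) * h = y k.
Proof. rewrite plus_IZR -INR_IZR_INZ /y /x0; ring. Qed.

Lemma left_family_triple (H : Z -> R) k : (k < n)%N ->
  triple M (fun i => ind (S i) * H i) (- (j1 + Z.of_nat k)) =
  2 * c * (ind (bU k) * H (- (j1 + Z.of_nat k))%Z).
Proof.
move=> hk; have hj := index_range hk; have [hp hr _] := hS; rewrite /triple /bU.
set j := (j1 + Z.of_nat k)%Z in hj *.
have e1 : S (- j + 4 * M)%Z = false by apply: hr; lia.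
have e2 : S (- j - 4 * M)%Z = false by rewrite -hp; apply: hr; lia.
by rewrite e1 e2 /ind; ring.
Qed.

Lemma right_family_triple (H : Z -> R) k : (k < n)%N -> (forall i, H (i + 10 * M)%Z = H i) ->
  triple M (fun i => ind (S i) * H i) (1 + (j1 + Z.of_nat k)) =
  ind (bR k) * H (- (4 * M - 1 - (j1 + Z.of_nat k)))%Z
  + ind (bS k) * H (- (6 * M - 1 - (j1 + Z.of_nat k)))%Z.
Proof.
move=> hk hH; have hj := index_range hk; have [hp hr _] := hS; rewrite /triple /bR /bS.
set j := (j1 + Z.of_nat k)%Z in hj *.
have e1 : S (1 + j)%Z = false by apply: hr; lia.
have e2 : (1 + j - 4 * M = - (4 * M - 1 - j))%Z by lia.
have e3 : (1 + j + 4 * M = - (6 * M - 1 - j) + 10 * M)%Z by lia.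
by rewrite e1 e2 e3 hp hH /ind; ring.
Qed.

Lemma sumN_ind_scal (b : nat -> bool) (F : nat -> R) :
  sumN n (fun k => ind (b k) * (w * F k)) = w * sumN n (fun k => ind (b k) * F k).
Proof.
rewrite (sumN_ext (G := fun k => w * (ind (b k) * F k) + 0 * 0)); last by move=> k _; ring.
by rewrite sumN_lin; ring.
Qed.

Lemma field_caliper : field_sq M caliper_measure S = gx ^ 2 + gy ^ 2.
Proof.
have [[f1 f2 f3 _ _] _ _ _ _] := left_interval_values M_gt1 hS.
have [[e1 e2] [e3 e4] _ _] := dir_values M_gt1.
have hc := c_bounds.
have z0 : (0 - 4 * M = - (4 * M))%Z by [].
have z1 : (1 - 4 * M = - (4 * M - 1))%Z by lia.
have aX : IZR (4 * M - 1) * h = X.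
  by rewrite minus_IZR mult_IZR /X -(grid_step_M M_pos) -/h; ring.
have hx : fieldx M caliper_measure S = - gx.
  have E1 : sumN n (fun k => triple M (fun i => ind (S i) * dirx M i) (- (j1 + Z.of_nat k))) =
      - (2 * c) * sumN n (fun k => ind (bU k) * sin (y k)).
    rewrite -[RHS]Rplus_0_r -[X in _ + X](Rmult_0_l (sumN n (fun=> 0))) -sumN_lin.
    by apply: sumN_ext => k hk; rewrite left_family_triple // (proj1 (dir_opp_angle _)) angle_U; ring.
  have E2 : sumN n (fun k => triple M (fun i => ind (S i) * dirx M i) (1 + (j1 + Z.of_nat k))) =
      (-1) * sumN n (fun k => ind (bR k) * sin (X - y k)) + (-1) * sumN n (fun k => ind (bS k) * sin (X' - y k)).
    rewrite -sumN_lin; apply: sumN_ext => k hk.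
    rewrite right_family_triple //; last by move=> i; case: (dir_period M_gt1 i).
    by rewrite !(proj1 (dir_opp_angle _)) angle_R angle_S; ring.
  rewrite /fieldx /caliper_measure !wsum_cat !wsum_cons wsum_nil !wsum_family E1 E2.
  rewrite /triple f1 f2 f3 z0 e1 e3 [dirx M (1 - _)](congr1 (dirx M) z1) (proj1 (dir_opp_angle _)) aX
    /gx !sumN_ind_scal (_ : ind false = 0) //.
  by field; lra.
have hy : fieldy M caliper_measure S = - gy.
  have E1 : sumN n (fun k => triple M (fun i => ind (S i) * diry M i) (- (j1 + Z.of_nat k))) =
      - (2 * c) * sumN n (fun k => ind (bU k) * cos (y k)).
    rewrite -[RHS]Rplus_0_r -[X in _ + X](Rmult_0_l (sumN n (fun=> 0))) -sumN_lin.
    by apply: sumN_ext => k hk; rewrite left_family_triple // (proj2 (dir_opp_angle _)) angle_U; ring.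
  have E2 : sumN n (fun k => triple M (fun i => ind (S i) * diry M i) (1 + (j1 + Z.of_nat k))) =
      (-1) * sumN n (fun k => ind (bR k) * cos (X - y k)) + (-1) * sumN n (fun k => ind (bS k) * cos (X' - y k)).
    rewrite -sumN_lin; apply: sumN_ext => k hk.
    rewrite right_family_triple //; last by move=> i; case: (dir_period M_gt1 i).
    by rewrite !(proj2 (dir_opp_angle _)) angle_R angle_S; ring.
  rewrite /fieldy /caliper_measure !wsum_cat !wsum_cons wsum_nil !wsum_family E1 E2.
  rewrite /triple f1 f2 f3 z0 e2 e4 [diry M (1 - _)](congr1 (diry M) z1) (proj2 (dir_opp_angle _)) aX
    /gy !sumN_ind_scal (_ : ind false = 0) //.
  by field; lra.
by rewrite /field_sq hx hy; ring.
Qed.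

Let lo := x0 - h / 2.
Let hi := x0 + INR n * h - h / 2.
Let mass (b : nat -> bool) := sumN n (fun k => ind (b k) * w).

Lemma mass_bounds b : 0 <= mass b <= 0.167.
Proof.
have hw := w_bounds; have ha := a_angle_bounds; have hb := b_angle_bounds.
have h1 : 0 <= mass b <= INR n * w.
  have -> : 0 = INR n * 0 by ring.
  by apply: sumN_bounds => k _; case: (b k); rewrite /ind; lra.
move: j1_spec n_spec; rewrite /start_angle /end_angle => k1 k2.
by have := pos_INR n; split; [lra | nra].
Qed.

Lemma X_bounds : Rabs (sin X - s) <= h /\ Rabs (cos X - - c) <= h.
Proof.
rewrite -sin_4beta -cos_4beta; have e : Rabs (X - 4 * beta) = h.
  by rewrite /X (_ : _ - _ = - h) ?Rabs_Ropp ?Rabs_pos_eq; [|lra|ring].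
by rewrite -e; split; [apply: sin_lipschitz | apply: cos_lipschitz].
Qed.

Lemma lo_near : Rabs (lo - start_angle) <= h / 2.
Proof. by apply: Rabs_le; rewrite /lo; lra. Qed.

Lemma hi_near : Rabs (hi - end_angle) <= h / 2.
Proof. by apply: Rabs_le; rewrite /hi; lra. Qed.

Lemma shifted_near K u v : Rabs (u - v) <= h / 2 ->
  Rabs (sin (K - h - u) - sin (K - v)) <= 1.5 * h /\ Rabs (cos (K - h - u) - cos (K - v)) <= 1.5 * h.
Proof.
move=> /Rabs_le_between huv; have e : Rabs (K - h - u - (K - v)) <= 1.5 * h by apply: Rabs_le; lra.
by split; apply: Rle_trans e; [apply: sin_lipschitz | apply: cos_lipschitz].
Qed.

Definition full_Rx := / (2 * c) * (cos (X - hi) - cos (X - lo)).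
Definition full_Ry := / (2 * c) * (sin (X - lo) - sin (X - hi)).
Definition full_Sx := / (2 * c) * (cos (X' - hi) - cos (X' - lo)).
Definition full_Sy := / (2 * c) * (sin (X' - lo) - sin (X' - hi)).

Lemma full_R_near :
  Rabs (full_Rx - - cos start_angle) <= 2 * h /\ Rabs (lambda * c + full_Ry - sin start_angle) <= 2 * h.
Proof.
have [/Rabs_le_between h1 /Rabs_le_between h2] := shifted_near (4 * beta) lo_near.
have [/Rabs_le_between h3 /Rabs_le_between h4] := shifted_near (4 * beta) hi_near.
have [e1 e2] := ideal_after_R; have hi2c := inv_2c_bounds; rewrite /Rdiv in e1 e2.
rewrite /full_Rx /full_Ry -/X in h1 h2 h3 h4 *.
split; apply: Rabs_le; nra.
Qed.

Lemma full_S_near :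
  Rabs (- cos end_angle + full_Sx + s * lambda - 1) <= 2 * h /\
  Rabs (sin end_angle + full_Sy - c * lambda) <= 2 * h.
Proof.
have [/Rabs_le_between h1 /Rabs_le_between h2] := shifted_near (6 * beta) lo_near.
have [/Rabs_le_between h3 /Rabs_le_between h4] := shifted_near (6 * beta) hi_near.
have [e1 e2] := ideal_after_S; have hi2c := inv_2c_bounds; rewrite /Rdiv in e1 e2.
rewrite /full_Sx /full_Sy -/X' in h1 h2 h3 h4 *.
split; apply: Rabs_le; nra.
Qed.

Lemma sumN_full (b : nat -> bool) F : (forall k, (k < n)%N -> b k) ->
  sumN n (fun k => ind (b k) * F k) = sumN n F.
Proof. by move=> hb; apply: sumN_ext => k hk; rewrite hb // /ind; ring. Qed.

Lemma sumN_empty (b : nat -> bool) F : (forall k, (k < n)%N -> b k = false) ->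
  sumN n (fun k => ind (b k) * F k) = 0.
Proof.
move=> hb; rewrite (sumN_ext (G := fun k => 0 * 0 + 0 * 0)) ?sumN_lin; first by ring.
by move=> k hk; rewrite hb // /ind; ring.
Qed.

Lemma left_down p q : (0 <= p <= q)%Z -> (q < 5 * M)%Z -> S 0%Z -> S (- q)%Z -> S (- p)%Z.
Proof.
move=> h1 h2 h3 h4; case: (Z.eq_dec p 0) => [->|hp0] //; case: (Z.eq_dec p q) => [->|hpq] //.
by have [_ _ hc] := hS; apply: (hc 0 p q)%Z => //; lia.
Qed.

Hypothesis D_after_A : S (- (4 * M))%Z -> S 0%Z.

(** Then D is missing too. Three families of mass at most 0.167 and one half of the atom, seen in
    [1 - 4 * M], remain, and crude bounds keep the vector well inside the disc. *)
Lemma field_without_A : ~~ S 0%Z -> gx ^ 2 + gy ^ 2 <= 1.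
Proof.
move=> nA; have nD : S (- (4 * M))%Z = false by apply/negP => /D_after_A; rewrite (negbTE nA).
have hw := w_bounds; have hl := lambda_bounds; have hi2c := inv_2c_bounds.
have [/Rabs_le_between k1 /Rabs_le_between k2] := X_bounds; have hc := c_bounds; have hs := s_bounds.
rewrite /gx /gy (negbTE nA) nD.
have U1 := sumN_weighted bU (Rlt_le _ _ (proj1 hw)) (fun k hk => proj1 (U_bounds hk)).
have U2 := sumN_weighted bU (Rlt_le _ _ (proj1 hw)) (fun k hk => proj2 (U_bounds hk)).
have R1 := sumN_weighted bR (Rlt_le _ _ (proj1 hw)) (fun k hk => proj1 (R_bounds hk)).
have R2 := sumN_weighted bR (Rlt_le _ _ (proj1 hw)) (fun k hk => proj2 (R_bounds hk)).
have S1 := sumN_weighted bS (Rlt_le _ _ (proj1 hw)) (fun k hk => proj1 (S_bounds hk)).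
have S2 := sumN_weighted bS (Rlt_le _ _ (proj1 hw)) (fun k hk => proj2 (S_bounds hk)).
have mU := mass_bounds bU; have mR := mass_bounds bR; have mS := mass_bounds bS.
rewrite -/(mass bU) -/(mass bR) -/(mass bS) in U1 U2 R1 R2 S1 S2.
set Ux := sumN _ _ in U1 *; set Uy := sumN n (fun k => _ * (w * cos (y k))) in U2 *.
set Rx := sumN n (fun k => ind (bR k) * (w * sin _)) in R1 *.
set Ry := sumN n (fun k => ind (bR k) * (w * cos _)) in R2 *.
set Sx := sumN n (fun k => ind (bS k) * (w * sin _)) in S1 *.
set Sy := sumN n (fun k => ind (bS k) * (w * cos _)) in S2 *.
have q1 : 0 <= / (2 * c) * Rx <= 0.0827 by clear - R1 mR hi2c; nra.
have q2 : 0 <= / (2 * c) * Ry <= 0.0827 by clear - R2 mR hi2c; nra.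
have q3 : 0 <= / (2 * c) * Sx <= 0.1002 by clear - S1 mS hi2c; nra.
have q4 : -0.0569 <= / (2 * c) * Sy <= 0 by clear - S2 mS hi2c; nra.
have q5 : 0 <= lambda / 2 * (ind false * s + ind (S (1 - 4 * M)%Z) * sin X) <= 0.337.
  by case: (S _); rewrite /ind; clear - hl k1 hs step_small; nra.
have q6 : -0.4635 <= lambda / 2 * (ind false * - c + ind (S (1 - 4 * M)%Z) * cos X) <= 0.
  by case: (S _); rewrite /ind; clear - hl k2 hc step_small; nra.
set Z1 := lambda / 2 * _ in q5 *; set Z2 := lambda / 2 * _ in q6 *.
set gx' := (Z1 + _ + _ + _); set gy' := (_ + _ + _ + _).
have w1 : 0 <= gx' <= 0.7 by rewrite /gx'; lra.
have w2 : -0.57 <= gy' <= 0.1 by rewrite /gy' (_ : ind false = 0) //; lra.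
by clear - w1 w2; nra.
Qed.

Lemma sum_U_prefix m :
  sumN m (fun k => w * sin (y k)) = cos lo - cos (x0 + INR m * h - h / 2) /\
  sumN m (fun k => w * cos (y k)) = sin (x0 + INR m * h - h / 2) - sin lo.
Proof. by rewrite sumN_sin sumN_cos. Qed.

Lemma sum_R_full :
  / (2 * c) * sumN n (fun k => w * sin (X - y k)) = full_Rx /\
  / (2 * c) * sumN n (fun k => w * cos (X - y k)) = full_Ry.
Proof. by rewrite sumN_sin_rev sumN_cos_rev. Qed.

Lemma sum_S_full :
  / (2 * c) * sumN n (fun k => w * sin (X' - y k)) = full_Sx /\
  / (2 * c) * sumN n (fun k => w * cos (X' - y k)) = full_Sy.
Proof. by rewrite sumN_sin_rev sumN_cos_rev. Qed.

Lemma lo_lipschitz : Rabs (cos lo - cos start_angle) <= h / 2 /\ Rabs (sin lo - sin start_angle) <= h / 2.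
Proof. by split; apply: Rle_trans lo_near; [apply: cos_lipschitz | apply: sin_lipschitz]. Qed.

Lemma hi_lipschitz : Rabs (cos hi - cos end_angle) <= h / 2 /\ Rabs (sin hi - sin end_angle) <= h / 2.
Proof. by split; apply: Rle_trans hi_near; [apply: cos_lipschitz | apply: sin_lipschitz]. Qed.

(** A and D are the extreme members of the chain, so everything between them is visited and the
    vector is [(1, 0)] up to [10 * h]. *)
Lemma field_with_D : S 0%Z -> S (- (4 * M))%Z -> gx ^ 2 + gy ^ 2 <= 1 + 40 * h.
Proof.
move=> hA hD; have hd := fun p => @left_down p (4 * M).
have aU k : (k < n)%N -> bU k by move=> hk; have hj := index_range hk; apply: hd; lia.
have aR k : (k < n)%N -> bR k by move=> hk; have hj := index_range hk; apply: hd; lia.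
have aS k : (k < n)%N -> bS k by move=> hk; have hj := index_range hk; apply: hd; lia.
have a3 : S (1 - 4 * M)%Z by rewrite (_ : 1 - 4 * M = - (4 * M - 1))%Z; [apply: hd | ]; lia.
rewrite /gx /gy hA hD a3 !sumN_full // (proj1 (sum_U_prefix n)) (proj2 (sum_U_prefix n)).
rewrite (proj1 sum_R_full) (proj2 sum_R_full) (proj1 sum_S_full) (proj2 sum_S_full) -/hi.
have [/Rabs_le_between k1 /Rabs_le_between k2] := X_bounds.
have [/Rabs_le_between k3 /Rabs_le_between k4] := full_R_near.
have [/Rabs_le_between k5 /Rabs_le_between k6] := full_S_near.
have [/Rabs_le_between k7 /Rabs_le_between k8] := lo_lipschitz.
have [/Rabs_le_between k9 /Rabs_le_between k10] := hi_lipschitz.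
have hl := lambda_bounds.
have -> : 1 + 40 * h = 1 + 4 * (10 * h) by ring.
have q1 : - h <= lambda / 2 * (sin X - s) <= h by clear - k1 hl h_pos; nra.
have q2 : - h <= lambda / 2 * (cos X - - c) <= h by clear - k2 hl h_pos; nra.
apply: (near_unit_circle (x0 := 1) (y0 := 0)); rewrite /ind; last by lra.
- by apply: Rabs_le; lra.
- by apply: Rabs_le; lra.
- by ring.
Qed.

(** The three phases after A: R drives the vector out to the circle, U moves it along the circle, S
    turns it back into the disc. *)
Lemma field_before_D : S 0%Z -> ~~ S (- (4 * M))%Z -> gx ^ 2 + gy ^ 2 <= 1 + 40 * h.
Proof.
move=> hA /negbTE hD; have hd := fun p q => @left_down p q.
have hw := w_bounds; have hl := lambda_bounds; have hi2c := inv_2c_bounds.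
have [/Rabs_le_between k1 /Rabs_le_between k2] := X_bounds; have hc := c_bounds; have hs := s_bounds.
have [/Rabs_le_between k3 /Rabs_le_between k4] := full_R_near.
have [/Rabs_le_between k7 /Rabs_le_between k8] := lo_lipschitz.
have [/Rabs_le_between k9 /Rabs_le_between k10] := hi_lipschitz.
have [[ea1 ea2] [eb1 eb2]] := sin_cos_ab_bounds.
have es1 : cos start_angle = sin b_angle by rewrite /start_angle cos_shift.
have es2 : sin start_angle = cos b_angle by rewrite /start_angle sin_shift.
have es3 : cos end_angle = sin a_angle by rewrite /end_angle cos_shift.
have es4 : sin end_angle = cos a_angle by rewrite /end_angle sin_shift.
rewrite /gx /gy hA hD.
(* R is incomplete, so nothing beyond R is visited. The missing part [(px, py)] has nonnegative
   coordinates, and so has the present vector; completing R therefore only increases the norm, up to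
   about 1. *)
case aR : (all bR (iota 0 n)); last first.
  have /allPn [k0] := negbT aR; rewrite mem_iota add0n => /andP [_ hk0] nR.
  have hj0 := index_range hk0.
  have aU k : (k < n)%N -> bU k = false.
    move=> hk; have hj := index_range hk; apply/negP => hb; move/negP: nR; apply.
    by apply: hd hb => //; lia.
  have aS k : (k < n)%N -> bS k = false.
    move=> hk; have hj := index_range hk; apply/negP => hb; move/negP: nR; apply.
    by apply: hd hb => //; lia.
  have a3 : S (1 - 4 * M)%Z = false.
    apply/negP; rewrite (_ : 1 - 4 * M = - (4 * M - 1))%Z; last by lia.
    by move=> hb; move/negP: nR; apply; apply: hd hb => //; lia.
  rewrite a3 !(sumN_empty _ aU) !(sumN_empty _ aS) (_ : ind false = 0) // (_ : ind true = 1) //.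
  have R1 := sumN_weighted (fun k => ~~ bR k) (Rlt_le _ _ (proj1 hw)) (fun k hk => proj1 (R_bounds hk)).
  have R2 := sumN_weighted (fun k => ~~ bR k) (Rlt_le _ _ (proj1 hw)) (fun k hk => proj2 (R_bounds hk)).
  have mR := mass_bounds (fun k => ~~ bR k).
  rewrite -/(mass _) in R1 R2.
  have F1 := proj1 sum_R_full; have F2 := proj2 sum_R_full.
  rewrite (sumN_split _ bR) Rmult_plus_distr_l in F1.
  rewrite (sumN_split _ bR) Rmult_plus_distr_l in F2.
  set Px := sumN n (fun k => ind (~~ bR k) * (w * sin (X - y k))) in R1 F1.
  set Py := sumN n (fun k => ind (~~ bR k) * (w * cos (X - y k))) in R2 F2.
  set A := / (2 * c) * sumN _ _ in F1 *.
  set B := / (2 * c) * sumN n (fun k => ind (bR k) * (w * cos _)) in F2 *.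
  set m := mass _ in R1 R2 mR.
  have q1 : 0.6 * (/ (2 * c) * m) <= / (2 * c) * Px <= 0.8 * (/ (2 * c) * m) by clear - R1 hi2c; nra.
  have q2 : 0.6 * (/ (2 * c) * m) <= / (2 * c) * Py <= 0.8 * (/ (2 * c) * m) by clear - R2 hi2c; nra.
  have q3 : 0 <= / (2 * c) * m <= 0.11 by clear - mR hi2c; nra.
  set m' := / (2 * c) * m in q1 q2 q3; set px := / (2 * c) * Px in F1 q1; set py := / (2 * c) * Py in F2 q2.
  have G := @near_unit_circle full_Rx (lambda * c + full_Ry) (- cos start_angle) (sin start_angle) (2 * h)
     (proj1 full_R_near) (proj2 full_R_near).
  have {}G : full_Rx ^ 2 + (lambda * c + full_Ry) ^ 2 <= 1 + 4 * (2 * h).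
    by apply: G; [rewrite -(sin2_cos2 start_angle) /Rsqr; ring | lra].
  have b1 : 0 <= full_Rx by rewrite es1 in k3; lra.
  have b2 : 0.98 <= lambda * c + full_Ry by rewrite es2 in k4; lra.
  rewrite -F1 in G b1; rewrite -F2 -Rplus_assoc in G b2.
  set L := lambda * c in G b2 *.
  have -> : lambda / 2 * (0 * s + 0 * sin X) + 0 + A + / (2 * c) * 0 = A by ring.
  have -> : L * 1 + lambda / 2 * (0 * - c + 0 * cos X) + 0 + B + / (2 * c) * 0 = L + B by ring.
  have : A ^ 2 + (L + B) ^ 2 <= (A + px) ^ 2 + (L + B + py) ^ 2.
    by clear - q1 q2 q3 b1 b2; nra.
  by lra.
have aR' k : (k < n)%N -> bR k.
  by move=> hk; move/allP: aR; apply; rewrite mem_iota.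
rewrite !(sumN_full _ aR') (proj1 sum_R_full) (proj2 sum_R_full).
have [m hm eU] : exists2 m, (m <= n)%N & forall k, (k < n)%N -> bU k = (k < m)%N.
  apply: monotone_prefix => j k hjk; have hk := @index_range k; have hj := @index_range j.
  by apply: hd; lia.
have U1 : sumN n (fun k => ind (bU k) * (w * sin (y k))) = cos lo - cos (x0 + INR m * h - h / 2).
  by rewrite -(proj1 (sum_U_prefix m)) -(sumN_prefix _ hm); apply: sumN_ext => k hk; rewrite eU.
have U2 : sumN n (fun k => ind (bU k) * (w * cos (y k))) = sin (x0 + INR m * h - h / 2) - sin lo.
  by rewrite -(proj2 (sum_U_prefix m)) -(sumN_prefix _ hm); apply: sumN_ext => k hk; rewrite eU.
rewrite U1 U2; clear U1 U2.
(* If U is incomplete, S is still untouched and the vector is within a multiple of [h] of the unit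
   vector [(- cos mid, sin mid)]. *)
case: (ltngtP m n) => hmn; [ | lia | ].
  have nU : ~~ bU m by rewrite eU // ltnn.
  have hjm := index_range hmn.
  have aS k : (k < n)%N -> bS k = false.
    move=> hk; have hj := index_range hk; apply/negP => hb; move/negP: nU; apply.
    by apply: hd hb => //; lia.
  have a3 : S (1 - 4 * M)%Z = false.
    apply/negP; rewrite (_ : 1 - 4 * M = - (4 * M - 1))%Z; last by lia.
    by move=> hb; move/negP: nU; apply; apply: hd hb => //; lia.
  rewrite a3 !(sumN_empty _ aS) (_ : ind false = 0) // (_ : ind true = 1) //.
  set mid := x0 + _ - _.
  have -> : 1 + 40 * h = 1 + 4 * (10 * h) by ring.
  apply: (near_unit_circle (x0 := - cos mid) (y0 := sin mid)); last by lra.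
  - by apply: Rabs_le; lra.
  - by apply: Rabs_le; lra.
  - by rewrite -(sin2_cos2 mid) /Rsqr; ring.
(* U is complete. The directions added by S make an obtuse angle with the radius at [end_angle], so
   the norm decreases; once [1 - 4 * M] is visited as well, crude bounds suffice. *)
rewrite hmn -/hi.
have S1 := sumN_weighted bS (Rlt_le _ _ (proj1 hw)) (fun k hk => proj1 (S_bounds hk)).
have S2 := sumN_weighted bS (Rlt_le _ _ (proj1 hw)) (fun k hk => proj2 (S_bounds hk)).
have mS := mass_bounds bS.
rewrite -/(mass _) in S1 S2.
set Px := sumN n (fun k => ind (bS k) * (w * sin _)) in S1 *.
set Py := sumN n (fun k => ind (bS k) * (w * cos _)) in S2 *.
set m1 := mass _ in S1 S2 mS.
have q1 : 0.8 * (/ (2 * c) * m1) <= / (2 * c) * Px <= 0.97 * (/ (2 * c) * m1) by clear - S1 hi2c; nra.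
have q2 : - 0.55 * (/ (2 * c) * m1) <= / (2 * c) * Py <= - 0.36 * (/ (2 * c) * m1) by clear - S2 hi2c; nra.
have q3 : 0 <= / (2 * c) * m1 <= 0.11 by clear - mS hi2c; nra.
set m' := / (2 * c) * m1 in q1 q2 q3; set px := / (2 * c) * Px in q1 *; set py := / (2 * c) * Py in q2 *.
set gx0 := cos lo - cos hi + full_Rx.
set gy0 := lambda * c + (sin hi - sin lo) + full_Ry.
have G : gx0 ^ 2 + gy0 ^ 2 <= 1 + 4 * (3 * h).
  apply: (near_unit_circle (x0 := - cos end_angle) (y0 := sin end_angle)); last by lra.
  - by apply: Rabs_le; rewrite /gx0; lra.
  - by apply: Rabs_le; rewrite /gy0; lra.
  - by rewrite -(sin2_cos2 end_angle) /Rsqr; ring.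
have b1 : 0.23 <= gx0 <= 0.25.
  by rewrite /gx0; rewrite es1 in k3 k7; rewrite es3 in k9; lra.
have b2 : 0.96 <= gy0 <= 0.98.
  by rewrite /gy0; rewrite es2 in k4 k8; rewrite es4 in k10; lra.
case a3 : (S (1 - 4 * M)%Z); rewrite (_ : ind false = 0) // (_ : ind true = 1) //.
- have r1 : 0.33 <= lambda / 2 * sin X <= 0.34 by clear - hl k1 hs step_small; nra.
  have r2 : -0.47 <= lambda / 2 * cos X <= -0.46 by clear - hl k2 hc step_small; nra.
  set x := (X in X ^ 2 + _); set z := (X in _ + X ^ 2).
  have -> : x = gx0 + px + lambda / 2 * sin X by rewrite /x /gx0; ring.
  have -> : z = gy0 + py + lambda / 2 * cos X by rewrite /z /gy0; ring.
  set u := lambda / 2 * sin X in r1 *; set v := lambda / 2 * cos X in r2 *.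
  have t1 : 0 <= gx0 + px + u <= 0.71 by lra.
  have t2 : 0 <= gy0 + py + v <= 0.6 by lra.
  by clear - t1 t2 h_pos; nra.
- set x := (X in X ^ 2 + _); set z := (X in _ + X ^ 2).
  have -> : x = gx0 + px by rewrite /x /gx0; ring.
  have -> : z = gy0 + py by rewrite /z /gy0; ring.
  have : (gx0 + px) ^ 2 + (gy0 + py) ^ 2 <= gx0 ^ 2 + gy0 ^ 2.
    by clear - q1 q2 q3 b1 b2; nra.
  by lra.
Qed.

Lemma field_caliper_bound : field_sq M caliper_measure S <= 1 + 40 * h.
Proof.
rewrite field_caliper; case hA : (S 0%Z); last first.
  by have := field_without_A (negbT hA); lra.
by case hD : (S (- (4 * M))%Z); [apply: field_with_D | apply: field_before_D; rewrite ?hD].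
Qed.

End Bound.
End Main.

Lemma sin_ge_lin x : 0 <= x -> x * (1 - x) <= sin x.
Proof.
move=> hx; have [t [ht e]] := @MVT_gen sin 0 x cos (fun t _ => is_derive_sin t)
  (fun t _ => continuity_sin t).
rewrite Rmin_left // Rmax_right // in ht; rewrite sin_0 !Rminus_0_r in e.
have := cos_lipschitz t 0; rewrite cos_0 Rminus_0_r (Rabs_pos_eq t); last by lra.
by move=> /Rabs_le_between k; rewrite e; nra.
Qed.

Lemma Forall_cat (A : Type) (P : A -> Prop) (l1 l2 : list A) :
  List.Forall P l1 -> List.Forall P l2 -> List.Forall P (l1 ++ l2).
Proof. by move=> h1 h2; elim: h1 => //= x l hx _ IH; constructor. Qed.

(** * A certificate for every good order *)

Section Certificate.
Variables (M : Z) (delta : R).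
Hypothesis M_gt1 : (1 < M)%Z.
Hypothesis delta_pos : 0 < delta.
Hypothesis step_small : grid_step M <= 0.0005.
Hypothesis step_delta : 20 * grid_step M <= delta.
Let M_pos : (0 < M)%Z. Proof. lia. Qed.
Let step_pos : 0 < grid_step M. Proof. exact: grid_step_pos. Qed.
Let step_small' : grid_step M <= 0.001. Proof. lra. Qed.

Lemma caliper_grid : exists j1 n,
  start_angle <= IZR j1 * grid_step M < start_angle + grid_step M /\
  IZR j1 * grid_step M + INR n * grid_step M - grid_step M <= end_angle
    < IZR j1 * grid_step M + INR n * grid_step M.
Proof.
have hp := step_pos; have hp2 := step_small; set h := grid_step M in hp hp2 *.
have e x : x / h * h = x by field; lra.
(* [1 - up (- r)] is the ceiling of r: the grid starts at the first node not before
   [start_angle]. *)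
have [a1 a2] := archimed (- (start_angle / h)).
set u := up _ in a1 a2.
have [b1 b2] := archimed ((end_angle - IZR (1 - u) * h) / h).
set z := up _ in b1 b2.
have k1 := e start_angle; have k2 := e (end_angle - IZR (1 - u) * h).
set p := start_angle / h in a1 a2 k1; set q := _ / h in b1 b2 k2.
have j_spec : start_angle <= IZR (1 - u) * h < start_angle + h.
  by rewrite minus_IZR; split; nra.
have hz : (0 <= z)%Z.
  apply: le_IZR; have : 0 <= q * h; last by nra.
  rewrite k2; have ha := a_angle_bounds; have hb := b_angle_bounds.
  by move: j_spec; rewrite /start_angle /end_angle; lra.
exists (1 - u)%Z, (Z.to_nat z); split=> //.
by rewrite INR_IZR_INZ Z2Nat.id //; split; nra.
Qed.

Lemma before_le t tau i j : (t i <= t j)%Z -> before t tau j -> before t tau i.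
Proof. by rewrite /before; lia. Qed.

Lemma sq_slack x : x <= 1 + 40 * grid_step M -> x <= (1 + delta) ^ 2.
Proof. by move=> h; nra. Qed.

(* The hypotheses say that, from either end of the path, the base side [0] or [1] is touched before
   its companion [- 4 M] or [1 + 4 M]. When one fails the path zigzags, and then three or four atoms
   already have a total mass larger than [caliper_length]. *)
Lemma certified_caliper t : good M t -> (t 0 <= t (- (4 * M)))%Z ->
  (t (1 + 4 * M) <= t 1)%Z -> certified M delta t.
Proof.
move=> hg x1 x2; have [j1 [n [hj hn]]] := caliper_grid.
have hw : 0 < 2 * sin (grid_step M / 2) <= grid_step M by exact: (w_bounds step_small hj hn).
have hl := lambda_bounds; have hc := c_bounds.
exists (caliper_measure M j1 n); split; last split.
- rewrite /caliper_measure; apply: Forall_cat.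
    by do 2 (constructor => /=; first lra); constructor.
  have hw' : 0 <= 2 * sin (grid_step M / 2) / (2 * c) by apply: Rdiv_le_0_compat; lra.
  by apply: Forall_cat; elim: (iota 0 n) => //= k l IH; constructor.
- have e (g : nat -> Z) v : sumR snd [seq (g k, v) | k <- iota 0 n] = INR n * v.
    rewrite sumR_map /= -[X in iota X _]/0%N; elim: (n) (0%N) => [|n' IH] m; first by rewrite /=; ring.
    by rewrite S_INR /= IH; ring.
  rewrite /caliper_measure !sumR_cat !e /=.
  have hs := sin_ge_lin (x := grid_step M / 2) ltac:(lra).
  rewrite /caliper_length; move: hj hn; rewrite /start_angle /end_angle.
  have hp := step_pos; have hp2 := step_small; have hp3 := step_delta.
  set h := grid_step M in hp hp2 hp3 hw hs *; move=> hj hn.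
  set v := 2 * _ / _.
  have ev : INR n * v = INR n * (2 * sin (h / 2)) / (2 * c) by rewrite /v; field; lra.
  have hn0 := pos_INR n; have ha := a_angle_bounds; have hb := b_angle_bounds.
  have k1 : b_angle - a_angle - h <= INR n * h by lra.
  have k2 : h * (1 - h / 2) <= 2 * sin (h / 2) by lra.
  have k3 : (b_angle - a_angle - h) * (1 - h / 2) <= INR n * (2 * sin (h / 2)).
    apply: Rle_trans (_ : INR n * (h * (1 - h / 2)) <= _); last by apply: Rmult_le_compat_l.
    by rewrite -Rmult_assoc; apply: Rmult_le_compat_r; lra.
  have k4 : b_angle - a_angle - 2 * h <= INR n * (2 * sin (h / 2)) by clear - k3 ha hb hp hp2; nra.
  have k5 : (b_angle - a_angle - 2 * h) / (2 * c) <= INR n * (2 * sin (h / 2)) / (2 * c).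
    by apply: Rmult_le_compat_r => //; left; apply: Rinv_0_lt_compat; lra.
  have k6 : (b_angle - a_angle - 2 * h) / (2 * c) = (b_angle - a_angle) / c / 2 - h / c by field; lra.
  have k7 : h / c <= 2 * h.
    by apply: (Rmult_le_reg_r c); [lra | rewrite /Rdiv Rmult_assoc Rinv_l; clear - hc hp; nra].
  by rewrite ev; lra.
- have B t' : good M t' -> (t' 0 <= t' (- (4 * M)))%Z -> forall tau, (tau <= 5 * M)%Z ->
     field_sq M (caliper_measure M j1 n) (before t' tau) <= (1 + delta) ^ 2.
    move=> hg' x1' tau htau; apply: sq_slack; apply: field_caliper_bound => //.
    + exact: left_interval_before.
    + exact: before_le.
  have eqm S : field_sq M (move_bases mirror_base (caliper_measure M j1 n)) S
     = field_sq M (caliper_measure M j1 n) S.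
    suff k H : wsum M (move_bases mirror_base (caliper_measure M j1 n)) H = wsum M (caliper_measure M j1 n) H.
      by rewrite /field_sq /fieldx /fieldy !k.
    have -> : move_bases mirror_base (caliper_measure M j1 n) = [:: (1%Z, lambda / 2); (0%Z, lambda / 2)]
      ++ [seq ((1 + (j1 + Z.of_nat k))%Z, 2 * sin (grid_step M / 2) / (2 * c)) | k <- iota 0 n]
      ++ [seq ((- (j1 + Z.of_nat k))%Z, 2 * sin (grid_step M / 2) / (2 * c)) | k <- iota 0 n].
      rewrite /move_bases /caliper_measure !map_cat -!map_comp; congr (_ ++ (_ ++ _)).
      - apply: eq_map => k; apply: (f_equal2 pair) => //.
        change (1 - - (j1 + Z.of_nat k) = 1 + (j1 + Z.of_nat k))%Z; lia.
      - apply: eq_map => k; apply: (f_equal2 pair) => //.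
        change (1 - (1 + (j1 + Z.of_nat k)) = - (j1 + Z.of_nat k))%Z; lia.
    by rewrite /caliper_measure !wsum_cat !wsum_cons wsum_nil; ring.
  apply: field_sq_halves => //; first exact: B.
  move=> tau htau; rewrite eqm; apply: B => //; first exact: good_mirror.
  by rewrite /mirror Z.sub_0_r (_ : 1 - - (4 * M) = 1 + 4 * M)%Z; lia.
Qed.

Lemma move_bases_cons g u w mu : move_bases g ((u, w) :: mu) = (g u, w) :: move_bases g mu.
Proof. by []. Qed.

Lemma mirror_top : mirror_base (1 - 5 * M) = (5 * M)%Z.
Proof. rewrite /mirror_base; lia. Qed.

Lemma mirror_top' : mirror_base (5 * M) = (1 - 5 * M)%Z.
Proof. by []. Qed.

Lemma mirror_values t : [/\ mirror M t 0 = 10 * M - 1 - t 1, mirror M t (- (4 * M)) = 10 * M - 1 - t (1 + 4 * M),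
  mirror M t (1 - M) = 10 * M - 1 - t M & mirror M t (1 - 5 * M) = 10 * M - 1 - t (5 * M)]%Z.
Proof. by rewrite /mirror; split; do 2 f_equal; lia. Qed.

Lemma certified_zigzag t : good M t -> (t 0 <= t (- (4 * M)))%Z ->
  (t 1 < t (1 + 4 * M))%Z -> certified M delta t.
Proof.
move=> hg x1 x2; have hT := caliper_length_bounds.
exists [:: (0%Z, 0.36); (1%Z, 0.59); ((1 - 5 * M)%Z, 0.41); ((5 * M)%Z, 0)]; split; last split.
- by do 4 (constructor => /=; first lra); constructor.
- by rewrite /sumR /=; lra.
- apply: field_sq_halves => // tau htau; apply: Rle_trans (_ : 1 <= _); try nra.
  + apply: zigzag_left_short => //; first exact: left_interval_before.
    exact: before_le.
  + have -> : field_sq M (move_bases mirror_base [:: (0%Z, 0.36); (1%Z, 0.59); ((1 - 5 * M)%Z, 0.41); ((5 * M)%Z, 0)])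
        (before (mirror M t) tau)
      = field_sq M [:: (0%Z, 0.59); (1%Z, 0.36); ((1 - 5 * M)%Z, 0); ((5 * M)%Z, 0.41)] (before (mirror M t) tau).
      have -> : move_bases mirror_base [:: (0%Z, 0.36); (1%Z, 0.59); ((1 - 5 * M)%Z, 0.41); ((5 * M)%Z, 0)]
        = [:: (1%Z, 0.36); (0%Z, 0.59); ((5 * M)%Z, 0.41); ((1 - 5 * M)%Z, 0)].
        by rewrite !move_bases_cons mirror_top mirror_top'.
      by rewrite /field_sq /fieldx /fieldy !wsum_cons !wsum_nil; ring.
    apply: zigzag_right_short => //.
      by apply: left_interval_before => //; apply: good_mirror.
    by have [e1 e2 _ _] := mirror_values t; apply: before_le; rewrite e1 e2; clear - x2; lia.
Qed.

Lemma certified_double_zigzag t : good M t ->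
  (t (- (4 * M)) < t 0)%Z -> (t 1 < t (1 + 4 * M))%Z ->
  (t (1 - M) < t (1 - 5 * M))%Z -> (t (5 * M) < t M)%Z -> certified M delta t.
Proof.
move=> hg x1 x2 y1 y2; have hT := caliper_length_bounds.
set mu := [:: (0%Z, 0.34); (1%Z, 0.34); ((1 - 5 * M)%Z, 0.34); ((5 * M)%Z, 0.34)].
exists mu; split; last split.
- by do 4 (constructor => /=; first lra); constructor.
- by rewrite /sumR /=; lra.
- apply: field_sq_halves => // tau htau; apply: Rle_trans (_ : 1 <= _); try nra.
  + apply: double_zigzag_short => //; first exact: left_interval_before.
    * by apply: before_le; lia.
    * by apply: before_le; lia.
  + have -> : field_sq M (move_bases mirror_base mu) (before (mirror M t) tau)
      = field_sq M mu (before (mirror M t) tau).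
      have -> : move_bases mirror_base mu = [:: (1%Z, 0.34); (0%Z, 0.34); ((5 * M)%Z, 0.34); ((1 - 5 * M)%Z, 0.34)].
        by rewrite !move_bases_cons mirror_top mirror_top'.
      by rewrite /field_sq /fieldx /fieldy !wsum_cons !wsum_nil; ring.
    apply: double_zigzag_short => //.
    * by apply: left_interval_before => //; apply: good_mirror.
    * by have [e1 e2 _ _] := mirror_values t; apply: before_le; rewrite e1 e2; clear - x2; lia.
    * by have [_ _ e3 e4] := mirror_values t; apply: before_le; rewrite e3 e4; clear - y2; lia.
Qed.

Lemma certified_one_good_end t : good M t ->
  (t 0 <= t (- (4 * M)))%Z \/ (t (1 + 4 * M) <= t 1)%Z -> certified M delta t.
Proof.
move=> hg; case: (Z_le_gt_dec (t 0%Z) (t (- (4 * M))%Z)) => x1; case: (Z_le_gt_dec (t (1 + 4 * M)%Z) (t 1%Z)) => x2 hx.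
- exact: certified_caliper.
- by apply: certified_zigzag => //; lia.
- apply: certified_mirror => //; apply: certified_zigzag; first exact: good_mirror.
  + by have [-> -> _ _] := mirror_values t; lia.
  + by rewrite /mirror Z.sub_diag (_ : 1 - (1 + 4 * M) = - (4 * M))%Z; lia.
- by case: hx; lia.
Qed.

(** When both ends fail at the bases [0], [1], the same tests are made after the half turn [flip],
    where they compare [5 * M] with [M] and [1 - 5 * M] with [1 - M]. If these fail too, exactly the
    four inequalities of the double zigzag are available. *)
Lemma certified_good t : good M t -> certified M delta t.
Proof.
move=> hg; have hgf := good_flip hg; have [hp _ _] := hg.
case: (Z_le_gt_dec (t 0%Z) (t (- (4 * M))%Z)) => x1; first by apply: certified_one_good_end => //; left.
case: (Z_le_gt_dec (t (1 + 4 * M)%Z) (t 1%Z)) => x2; first by apply: certified_one_good_end => //; right.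
have e1 : t (1 + 5 * M)%Z = t (1 - 5 * M)%Z by rewrite -(hp (1 - 5 * M)%Z); congr t; lia.
have e2 : t (1 + 4 * M + 5 * M)%Z = t (1 - M)%Z by rewrite -(hp (1 - M)%Z); congr t; lia.
case: (Z_le_gt_dec (t (1 - 5 * M)%Z) (t (1 - M)%Z)) => y1.
  apply: certified_flip => //; apply: certified_one_good_end => //; right.
  by rewrite /flip e1 e2; lia.
case: (Z_le_gt_dec (t M) (t (5 * M)%Z)) => y2.
  apply: certified_flip => //; apply: certified_one_good_end => //; left.
  by rewrite /flip Z.add_0_l (_ : - (4 * M) + 5 * M = M)%Z; lia.
by apply: certified_double_zigzag => //; lia.
Qed.

End Certificate.

(** * Shortest paths do not cross themselves *)

Definition norm2 (x y : R) : R := sqrt (x ^ 2 + y ^ 2).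

Lemma norm2_ge0 x y : 0 <= norm2 x y.
Proof. exact: sqrt_pos. Qed.

Lemma norm2_sq x y : norm2 x y * norm2 x y = x ^ 2 + y ^ 2.
Proof. by apply: sqrt_sqrt; nra. Qed.

Lemma norm2_scal a x y : 0 <= a -> norm2 (a * x) (a * y) = a * norm2 x y.
Proof.
move=> ha; rewrite /norm2 (_ : _ + _ = a ^ 2 * (x ^ 2 + y ^ 2)); last by ring.
by rewrite sqrt_mult_alt ?sqrt_pow2 //; nra.
Qed.

Lemma norm2_opp x y : norm2 (- x) (- y) = norm2 x y.
Proof. by rewrite /norm2; congr sqrt; ring. Qed.

Lemma dot_le_norm2 a b x y : a * x + b * y <= norm2 a b * norm2 x y.
Proof.
have h1 := norm2_sq a b; have h2 := norm2_sq x y.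
have h3 := norm2_ge0 a b; have h4 := norm2_ge0 x y.
have h5 : 0 <= norm2 a b * norm2 x y by apply: Rmult_le_pos.
case: (Rle_or_lt (a * x + b * y) 0) => h; first by lra.
apply: Rsqr_incr_0_var => //; rewrite /Rsqr.
have -> : norm2 a b * norm2 x y * (norm2 a b * norm2 x y) = (a ^ 2 + b ^ 2) * (x ^ 2 + y ^ 2).
  by rewrite -h1 -h2; ring.
by have := pow2_ge_0 (a * y - b * x); nra.
Qed.

Lemma dot_lt_norm2 a b x y : a * y - b * x <> 0 -> a * x + b * y < norm2 a b * norm2 x y.
Proof.
move=> hx; case: (Rle_lt_or_eq_dec _ _ (dot_le_norm2 a b x y)) => // e.
exfalso; have h1 := norm2_sq a b; have h2 := norm2_sq x y.
have : (a * x + b * y) * (a * x + b * y) = (a ^ 2 + b ^ 2) * (x ^ 2 + y ^ 2).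
  by rewrite -h1 -h2 e; ring.
have : 0 < (a * y - b * x) ^ 2 by apply: pow2_gt_0.
by nra.
Qed.

Lemma norm2_triangle a b x y : norm2 (a + x) (b + y) <= norm2 a b + norm2 x y.
Proof.
apply: Rsqr_incr_0_var; last by have := norm2_ge0 a b; have := norm2_ge0 x y; lra.
rewrite /Rsqr norm2_sq; have := dot_le_norm2 a b x y.
by have := norm2_sq a b; have := norm2_sq x y; nra.
Qed.

Lemma norm2_triangle_lt a b x y : a * y - b * x <> 0 ->
  norm2 (a + x) (b + y) < norm2 a b + norm2 x y.
Proof.
move=> hx; apply: Rsqr_incrst_0; [|exact: norm2_ge0|by have := norm2_ge0 a b; have := norm2_ge0 x y; lra].
rewrite /Rsqr norm2_sq; have := dot_lt_norm2 hx.
by have := norm2_sq a b; have := norm2_sq x y; nra.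
Qed.

Definition pdist (P Q : plane) : R := norm2 (fst Q - fst P) (snd Q - snd P).

Lemma pdist_dist P Q : pdist P Q = dist P Q.
Proof. by rewrite /pdist /dist /dist_euc /norm2 /Rsqr; congr sqrt; ring. Qed.

Lemma pdist_sym P Q : pdist P Q = pdist Q P.
Proof. by rewrite /pdist /norm2; congr sqrt; ring. Qed.

Lemma pdist_triangle P Q T : pdist P T <= pdist P Q + pdist Q T.
Proof.
rewrite /pdist.
have -> : fst T - fst P = (fst Q - fst P) + (fst T - fst Q) by ring.
have -> : snd T - snd P = (snd Q - snd P) + (snd T - snd Q) by ring.
exact: norm2_triangle.
Qed.

Definition cross (x y x' y' : R) : R := x * y' - y * x'.
Definition orient (P Q T : plane) : R :=
  cross (fst Q - fst P) (snd Q - snd P) (fst T - fst P) (snd T - snd P).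

Lemma orient_rot P Q T : orient P Q T = orient Q T P.
Proof. rewrite /orient /cross; ring. Qed.

(** The diagonals meet at the fraction k of PT and l of QU, ratios of triangle areas. Triangle
    inequalities through the meeting point give the claim; the first is strict because the diagonals
    are not parallel. *)
Lemma diagonals_longer P Q T U : 0 < orient P Q T -> 0 < orient Q T U ->
  0 < orient T U P -> 0 < orient U P Q -> pdist P Q + pdist T U < pdist P T + pdist Q U.
Proof.
move=> h1 h2 h3 h4; set a := orient U P Q in h4; set b := orient Q T U in h2.
set d := orient P Q T in h1; set e := orient T U P in h3.
have eab : a + b = d + e by rewrite /a /b /d /e /orient /cross; ring.
set k := a / (a + b); set l := d / (a + b).
have ek : k * (a + b) = a by rewrite /k; field; lra.
have el : l * (a + b) = d by rewrite /l; field; lra.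
have k0 : 0 < k by apply: Rdiv_lt_0_compat; lra.
have l0 : 0 < l by apply: Rdiv_lt_0_compat; lra.
have k1 : k < 1 by nra.
have l1 : l < 1 by nra.
set ux := fst T - fst P; set uy := snd T - snd P; set vx := fst U - fst Q; set vy := snd U - snd Q.
have ecr : ux * vy - uy * vx = a + b by rewrite /a /b /orient /cross /ux /uy /vx /vy; ring.
have ex : fst Q - fst P = k * ux + - (l * vx).
  apply: (Rmult_eq_reg_r (a + b)); last by lra.
  rewrite Rmult_plus_distr_r -Ropp_mult_distr_l (_ : k * ux * (a + b) = k * (a + b) * ux); last by ring.
  rewrite (_ : l * vx * (a + b) = l * (a + b) * vx); last by ring.
  by rewrite ek el /a /b /d /orient /cross /ux /vx; ring.
have ey : snd Q - snd P = k * uy + - (l * vy).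
  apply: (Rmult_eq_reg_r (a + b)); last by lra.
  rewrite Rmult_plus_distr_r -Ropp_mult_distr_l (_ : k * uy * (a + b) = k * (a + b) * uy); last by ring.
  rewrite (_ : l * vy * (a + b) = l * (a + b) * vy); last by ring.
  by rewrite ek el /a /b /d /orient /cross /uy /vy; ring.
have s1 : pdist P Q < k * norm2 ux uy + l * norm2 vx vy.
  have H := @norm2_triangle_lt (k * ux) (k * uy) (- (l * vx)) (- (l * vy)).
  rewrite norm2_opp !norm2_scal in H; [|lra|lra].
  rewrite /pdist ex ey; apply: H.
  have -> : k * ux * - (l * vy) - k * uy * - (l * vx) = - (k * l * (ux * vy - uy * vx)) by ring.
  by rewrite ecr; have : 0 < k * l * (a + b); [apply: Rmult_lt_0_compat; nra | lra].
have s2 : pdist T U <= (1 - k) * norm2 ux uy + (1 - l) * norm2 vx vy.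
  have H := @norm2_triangle (- ((1 - k) * ux)) (- ((1 - k) * uy)) ((1 - l) * vx) ((1 - l) * vy).
  rewrite norm2_opp !norm2_scal in H; [|lra|lra].
  apply: Rle_trans H; right; rewrite /pdist; congr norm2.
  - have -> : fst U - fst T = vx - ux + (fst Q - fst P) by rewrite /vx /ux; ring.
    by rewrite ex; ring.
  - have -> : snd U - snd T = vy - uy + (snd Q - snd P) by rewrite /vy /uy; ring.
    by rewrite ey; ring.
by rewrite /pdist -/ux -/uy -/vx -/vy in s1 s2 *; lra.
Qed.

Section PathLength.
Variable d : nat -> nat -> R.
Hypothesis d_sym : forall i j, d i j = d j i.

Fixpoint plen_from (x : nat) (l : seq nat) : R :=
  if l is y :: l' then d x y + plen_from y l' else 0.
Definition plen (l : seq nat) : R := if l is x :: l' then plen_from x l' else 0.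

Lemma plen_cat p x y l : plen (p ++ x :: y :: l) = plen (rcons p x) + d x y + plen (y :: l).
Proof.
case: p => [|z p] /=; first by ring.
by elim: p z => [|u p IH] z /=; [ring | rewrite IH; ring].
Qed.

Lemma plen_rcons2 p x y : plen (rcons (rcons p x) y) = plen (rcons p x) + d x y.
Proof.
have -> : rcons (rcons p x) y = p ++ [:: x; y] by rewrite -!cats1 -catA.
by rewrite plen_cat /=; ring.
Qed.

Lemma plen_rev l : plen (rev l) = plen l.
Proof.
elim: l => [//|x [//|y l] IH].
by rewrite 2!rev_cons plen_rcons2 -rev_cons IH /= (d_sym y x); ring.
Qed.

(** The stretch between the two exchanged edges is traversed backwards, which does not change its
    length since [d] is symmetric. *)
Lemma plen_2opt p e f z g h r :
  plen (p ++ e :: g :: rev z ++ f :: h :: r) =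
  plen (p ++ e :: f :: z ++ g :: h :: r) - (d e f + d g h) + (d e g + d f h).
Proof.
rewrite 2!plen_cat.
have -> : g :: rev z ++ f :: h :: r = (g :: rev z) ++ f :: h :: r by [].
have -> : f :: z ++ g :: h :: r = (f :: z) ++ g :: h :: r by [].
rewrite 2!plen_cat -(plen_rev (rcons (f :: z) g)) rev_rcons rev_cons /=; ring.
Qed.

Lemma perm_2opt (p : seq nat) e f z g h r :
  perm_eq (p ++ e :: g :: rev z ++ f :: h :: r) (p ++ e :: f :: z ++ g :: h :: r).
Proof. by apply/permP => x; rewrite !count_cat /= !count_cat /= count_rev; lia. Qed.

Lemma min_in_list (T : eqType) (f : T -> R) (l : seq T) : l != [::] ->
  exists2 x, x \in l & forall y, y \in l -> f x <= f y.
Proof.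
elim: l => [//|a l IH] _; case: (eqVneq l [::]) => [->|hl].
  by exists a => [|y]; rewrite ?inE // => /eqP ->; lra.
have [x hx h] := IH hl; case: (Rle_or_lt (f a) (f x)) => hax.
- exists a => [|y]; rewrite inE ?eqxx // => /orP [/eqP ->|hy]; first by lra.
  by have := h y hy; lra.
- exists x => [|y]; rewrite inE ?hx ?orbT // => /orP [/eqP ->|hy]; first by lra.
  exact: h.
Qed.

Lemma shortest_order N : exists2 o, perm_eq o (iota 0 N) &
  forall o', perm_eq o' (iota 0 N) -> plen o <= plen o'.
Proof.
have hne : permutations (iota 0 N) != [::].
  apply/eqP => e; have : iota 0 N \in permutations (iota 0 N) by rewrite mem_permutations.
  by rewrite e.
have [o ho hmin] := min_in_list plen hne.
exists o; first by rewrite -mem_permutations.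
by move=> o' ho'; apply: hmin; rewrite mem_permutations.
Qed.

Lemma switch_point (b : nat -> bool) (l : seq nat) x y : x \in l -> y \in l -> b x -> ~~ b y ->
  exists p u v q, l = p ++ u :: v :: q /\ b u != b v.
Proof.
elim: l x y => [//|a [|a' l] IH] x y.
  by rewrite !inE => /eqP -> /eqP -> ->.
case: (eqVneq (b a) (b a')) => hb; last by move=> *; exists [::], a, a', l.
rewrite inE => /orP hx; rewrite inE => /orP hy bx by_.
have [x' [hx' bx']] : exists x', x' \in a' :: l /\ b x'.
  by case: hx => [/eqP e|?]; [exists a'; rewrite -hb -e inE eqxx | exists x].
have [y' [hy' by']] : exists y', y' \in a' :: l /\ ~~ b y'.
  by case: hy => [/eqP e|?]; [exists a'; rewrite -hb -e inE eqxx | exists y].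
have [p [u [v [q [-> h]]]]] := IH x' y' hx' hy' bx' by'.
by exists (a :: p), u, v, q.
Qed.

Variable N : nat.
Hypothesis uncross : forall i j k l, (i < j < k)%N -> (k < l < N)%N ->
  d i j + d k l < d i k + d j l /\ d i l + d j k < d i k + d j l.

Lemma crossing_ordered a b x z : (a < b)%N -> (b < N)%N -> (z < N)%N -> z != a -> z != b ->
  (a < x)%N -> (x < b)%N -> (z < a)%N \/ (b < z)%N ->
  d a x + d b z < d a b + d x z /\ d a z + d b x < d a b + d x z.
Proof.
move=> h1 h2 h3 h4 h5 h6 h7 [h8|h8].
- have [] := @uncross z a x b; [by rewrite h8 h6|by rewrite h7 h2|].
  by rewrite (d_sym z a) (d_sym x b) (d_sym z b) (d_sym z x); lra.
- have [] := @uncross a x b z; [by rewrite h6 h7|by rewrite h8 h3|].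
  by rewrite (d_sym x b); lra.
Qed.

Lemma crossing_pairs e f g h : (e < N)%N -> (f < N)%N -> (g < N)%N -> (h < N)%N ->
  g != e -> g != f -> h != e -> h != f ->
  (minn e f < g < maxn e f)%N != (minn e f < h < maxn e f)%N ->
  d e g + d f h < d e f + d g h.
Proof.
have main a b x z : (a < b)%N -> (b < N)%N -> (x < N)%N -> (z < N)%N -> x != a -> x != b ->
    z != a -> z != b -> (a < x < b)%N != (a < z < b)%N ->
    d a x + d b z < d a b + d x z /\ d a z + d b x < d a b + d x z.
  move=> h1 h2 hx hz h3 h4 h5 h6.
  case ex : (a < x < b)%N; case ez : (a < z < b)%N => // _.
  - case/andP: ex => x1 x2; apply: crossing_ordered => //.
    by move: ez h5 h6; case: (ltngtP z a) => //; case: (ltngtP z b) => //; auto.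
  - case/andP: ez => z1 z2; rewrite (d_sym x z) and_comm; apply: crossing_ordered => //.
    by move: ex h3 h4; case: (ltngtP x a) => //; case: (ltngtP x b) => //; auto.
move=> he hf hg hh; case: (ltngtP e f) => hef h1 h2 h3 h4 hs.
- exact: (proj1 (main e f g h _ _ _ _ _ _ _ _ _)).
- by rewrite (d_sym e f) Rplus_comm; apply: (proj2 (main f e g h _ _ _ _ _ _ _ _ _)).
- have F x : (f < x < f)%N = false by case: (ltngtP f x).
  by move: hs; rewrite ?hef ?minnn ?maxnn !F.
Qed.

(** If the prefix alternated with the rest, some edge [e f] of [l1] would separate i from k, and
    then some edge [g h] of [l2] would have its ends on different sides of [e f]. These edges cross,
    and the 2-opt move shortens the path. *)
Lemma shortest_noncrossing o : perm_eq o (iota 0 N) ->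
  (forall o', perm_eq o' (iota 0 N) -> plen o <= plen o') ->
  forall l1 l2, o = l1 ++ l2 -> forall i j k l,
  j \in l1 -> l \in l1 -> i \in l2 -> k \in l2 -> (i < j < k)%N -> (k < l < N)%N \/ (l < i)%N -> False.
Proof.
move=> hperm hmin l1 l2 eo i j k l hj hl hi hk hijk hkl.
have uo : uniq o by rewrite (perm_uniq hperm) iota_uniq.
have bo x : x \in o -> (x < N)%N by rewrite (perm_mem hperm) mem_iota.
have disj x y : x \in l1 -> y \in l2 -> x != y.
  move=> hx hy; apply/eqP => exy; move: uo; rewrite eo cat_uniq => /and3P [_ /hasPn /(_ y hy) /=].
  by rewrite -exy hx.
have [p [e [f [q [e1 hef]]]]] := @switch_point (fun x => i < x < k)%N l1 j l hj hl hijk ltac:(lia).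
have he : e \in l1 by rewrite e1 mem_cat !inE eqxx orbT.
have hf : f \in l1 by rewrite e1 mem_cat !inE eqxx !orbT.
have [d1 d2 d3 d4] : [/\ e != i, e != k, f != i & f != k].
  by split; apply: disj.
have [q2 [g [h [r [e2 hgh]]]]] : exists p u v q, l2 = p ++ u :: v :: q /\
   (minn e f < u < maxn e f)%N != (minn e f < v < maxn e f)%N.
  case hbi : (minn e f < i < maxn e f)%N.
  - by apply: (@switch_point (fun x => minn e f < x < maxn e f)%N l2 i k) => //; clear - hbi hef d1 d2 d3 d4 hijk; lia.
  - by apply: (@switch_point (fun x => minn e f < x < maxn e f)%N l2 k i) => //; clear - hbi hef d1 d2 d3 d4 hijk; lia.
have hg : g \in l2 by rewrite e2 mem_cat !inE eqxx orbT.
have hh : h \in l2 by rewrite e2 mem_cat !inE eqxx !orbT.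
have [d5 d6 d7 d8] : [/\ g != e, g != f, h != e & h != f].
  by split; rewrite eq_sym; apply: disj.
have [be bf bg bh] : [/\ e < N, f < N, g < N & h < N]%N.
  by split; apply: bo; rewrite eo mem_cat ?he ?hf ?hg ?hh ?orbT.
have eo' : o = p ++ e :: f :: (q ++ q2) ++ g :: h :: r.
  by rewrite eo e1 e2 -!catA.
have := hmin (p ++ e :: g :: rev (q ++ q2) ++ f :: h :: r).
rewrite plen_2opt -eo' => H; have {}H := H (perm_trans (perm_2opt _ _ _ _ _ _ _) _).
rewrite -eo' in H; have {}H := H hperm.
suff : d e g + d f h < d e f + d g h by lra.
exact: (crossing_pairs be bf bg bh).
Qed.

End PathLength.

(** * Strictly supported points are in convex position *)

Definition dotp (x y : R) (P : plane) : R := x * fst P + y * snd P.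

(** The orientation times the cross product of two consecutive normals expands into products of
    support differences. The sign of the second normal on T - P decides which pair of normals shows
    positivity. *)
Lemma orient_pos_of_support x1 y1 x2 y2 x3 y3 P Q T :
  0 < cross x1 y1 x2 y2 -> 0 < cross x2 y2 x3 y3 ->
  dotp x1 y1 Q < dotp x1 y1 P -> dotp x1 y1 T < dotp x1 y1 P ->
  dotp x2 y2 P < dotp x2 y2 Q -> dotp x2 y2 T < dotp x2 y2 Q ->
  dotp x3 y3 P < dotp x3 y3 T -> dotp x3 y3 Q < dotp x3 y3 T -> 0 < orient P Q T.
Proof.
rewrite /dotp => h12 h23 a1 a2 b1 b2 c1 c2.
set px := fst Q - fst P; set py := snd Q - snd P; set qx := fst T - fst P; set qy := snd T - snd P.
have p1 : x1 * px + y1 * py < 0 by rewrite /px /py; lra.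
have q1 : x1 * qx + y1 * qy < 0 by rewrite /qx /qy; lra.
have p2 : 0 < x2 * px + y2 * py by rewrite /px /py; lra.
have pq2 : x2 * qx + y2 * qy < x2 * px + y2 * py by rewrite /px /py /qx /qy; lra.
have q3 : 0 < x3 * qx + y3 * qy by rewrite /qx /qy; lra.
have pq3 : x3 * px + y3 * py < x3 * qx + y3 * qy by rewrite /px /py /qx /qy; lra.
rewrite /orient -/px -/py -/qx -/qy.
have e1 : cross px py qx qy * cross x1 y1 x2 y2 =
  (x1 * px + y1 * py) * (x2 * qx + y2 * qy) - (x2 * px + y2 * py) * (x1 * qx + y1 * qy).
  by rewrite /cross; ring.
have e2 : cross px py qx qy * cross x2 y2 x3 y3 =
  (x2 * px + y2 * py) * (x3 * qx + y3 * qy) - (x3 * px + y3 * py) * (x2 * qx + y2 * qy).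
  by rewrite /cross; ring.
set u2 := x2 * qx + y2 * qy in pq2 e1 e2; set v3 := x3 * px + y3 * py in pq3 e2.
case: (Rle_or_lt u2 0) => hu.
- apply: (Rmult_lt_reg_r (cross x1 y1 x2 y2)) => //; rewrite Rmult_0_l e1.
  clear - hu p1 q1 p2; nra.
- apply: (Rmult_lt_reg_r (cross x2 y2 x3 y3)) => //; rewrite Rmult_0_l e2.
  case: (Rle_or_lt v3 0) => hv; clear - hu hv p2 q3 pq2 pq3; nra.
Qed.

Lemma five_M_step M : (0 < M)%Z -> IZR (5 * M) * grid_step M = PI.
Proof. by move=> hM; rewrite mult_IZR Rmult_assoc grid_step_M // /beta; field. Qed.

Section Support.
Variables (M : Z) (N : nat) (Y : nat -> plane).
Hypothesis M_gt1 : (1 < M)%Z.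
Hypothesis N_spec : Z.of_nat N = (10 * M)%Z.
Hypothesis strict_support : forall i j, (i < N)%N -> (j < N)%N -> i != j ->
  dotp (dirx M (Z.of_nat i)) (diry M (Z.of_nat i)) (Y j) <
  dotp (dirx M (Z.of_nat i)) (diry M (Z.of_nat i)) (Y i).
Let M_pos : (0 < M)%Z. Proof. lia. Qed.
Let h := grid_step M.
Let h_pos : 0 < h. Proof. exact: grid_step_pos. Qed.

Lemma cross_dir i j : cross (dirx M i) (diry M i) (dirx M j) (diry M j) = sin (IZR (j - i) * h).
Proof. by rewrite /cross /dirx /diry -/h minus_IZR Rmult_minus_distr_r sin_minus; ring. Qed.

Lemma cross_dir_pos i j : (0 < j - i < 5 * M)%Z -> 0 < cross (dirx M i) (diry M i) (dirx M j) (diry M j).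
Proof.
move=> [h1 h2]; rewrite cross_dir; have := five_M_step M_pos; rewrite -/h; move: (IZR_lt _ _ h1) (IZR_lt _ _ h2) => k1 k2 e.
by apply: sin_gt_0; nra.
Qed.

Lemma cross_dir_pos_wrap i j : (5 * M < i - j < 10 * M)%Z -> 0 < cross (dirx M i) (diry M i) (dirx M j) (diry M j).
Proof.
move=> hij; have [<- <-] := dir_period M_gt1 j; apply: cross_dir_pos; lia.
Qed.

(** At most one of the three cyclic gaps reaches a half turn; the triangle is rotated so that this
    gap is not one of the two used. *)
Lemma support_orient i j k : (i < j)%N -> (j < k)%N -> (k < N)%N -> 0 < orient (Y i) (Y j) (Y k).
Proof.
move=> h1 h2 h3.
have [n1 n2 n3] : [/\ i != j, i != k & j != k] by split; lia.
have [n1' n2' n3'] : [/\ j != i, k != i & k != j] by split; lia.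
have hi : (i < N)%N by lia.
have hj : (j < N)%N by lia.
case: (Z_lt_ge_dec (Z.of_nat j - Z.of_nat i) (5 * M)) => hji; last first.
  rewrite orient_rot; apply: (orient_pos_of_support (x1 := dirx M (Z.of_nat j)) (y1 := diry M (Z.of_nat j))
    (x2 := dirx M (Z.of_nat k)) (y2 := diry M (Z.of_nat k))
    (x3 := dirx M (Z.of_nat i)) (y3 := diry M (Z.of_nat i))); try exact: strict_support.
  - by apply: cross_dir_pos; lia.
  - by apply: cross_dir_pos_wrap; lia.
case: (Z_lt_ge_dec (Z.of_nat k - Z.of_nat j) (5 * M)) => hkj; last first.
  rewrite -orient_rot; apply: (orient_pos_of_support (x1 := dirx M (Z.of_nat k)) (y1 := diry M (Z.of_nat k))
    (x2 := dirx M (Z.of_nat i)) (y2 := diry M (Z.of_nat i))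
    (x3 := dirx M (Z.of_nat j)) (y3 := diry M (Z.of_nat j))); try exact: strict_support.
  - by apply: cross_dir_pos_wrap; lia.
  - by apply: cross_dir_pos; lia.
apply: (orient_pos_of_support (x1 := dirx M (Z.of_nat i)) (y1 := diry M (Z.of_nat i))
    (x2 := dirx M (Z.of_nat j)) (y2 := diry M (Z.of_nat j))
    (x3 := dirx M (Z.of_nat k)) (y3 := diry M (Z.of_nat k))); try exact: strict_support.
- by apply: cross_dir_pos; lia.
- by apply: cross_dir_pos; lia.
Qed.

Let d i j := pdist (Y i) (Y j).

Lemma d_sym i j : d i j = d j i.
Proof. exact: pdist_sym. Qed.

Lemma support_uncross i j k l : (i < j < k)%N -> (k < l < N)%N ->
  d i j + d k l < d i k + d j l /\ d i l + d j k < d i k + d j l.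
Proof.
move=> /andP [h1 h2] /andP [h3 h4].
have o1 := support_orient h1 h2 (ltn_trans h3 h4).
have o2 := support_orient h2 h3 h4.
have o3 := support_orient (ltn_trans h1 h2) h3 h4.
have o4 := support_orient h1 (ltn_trans h2 h3) h4.
have o3' : 0 < orient (Y k) (Y l) (Y i) by rewrite -(orient_rot (Y i)).
have o4' : 0 < orient (Y l) (Y i) (Y j) by rewrite (orient_rot (Y l)).
split; first exact: diagonals_longer.
have := diagonals_longer o2 o3' o4' o1.
by rewrite -/(d j k) -/(d l i) -/(d j l) -/(d k i) (d_sym l i) (d_sym k i); lra.
Qed.

End Support.

Lemma mod_window n i x : (0 < n)%Z -> (i <= x < i + n)%Z ->
  (x mod n = i mod n + (x - i) \/ x mod n = i mod n + (x - i) - n)%Z.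
Proof.
move=> hn hx; have e := Z.div_mod i n ltac:(lia); have b := Z.mod_pos_bound i n hn.
case: (Z_lt_ge_dec (i mod n + (x - i)) n) => h.
- by left; symmetry; apply: (Z.mod_unique_pos _ _ (i / n)%Z); lia.
- by right; symmetry; apply: (Z.mod_unique_pos _ _ (i / n + 1)%Z); lia.
Qed.

(** * From a shortest order to a good visiting order *)

Section Order.
Variables (M : Z) (N : nat) (o : seq nat).
Hypothesis M_gt1 : (1 < M)%Z.
Hypothesis N_spec : Z.of_nat N = (10 * M)%Z.
Hypothesis o_perm : perm_eq o (iota 0 N).

Definition residue (i : Z) : nat := Z.to_nat (i mod (10 * M)).
Definition visit_time (i : Z) : Z := Z.of_nat (index (residue i) o).

Lemma residue_lt i : (residue i < N)%N.
Proof. by rewrite /residue; have := Z.mod_pos_bound i (10 * M); lia. Qed.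

Lemma residue_in i : residue i \in o.
Proof. by rewrite (perm_mem o_perm) mem_iota add0n residue_lt. Qed.

Lemma size_o : size o = N.
Proof. by rewrite (perm_size o_perm) size_iota. Qed.

Lemma uniq_o : uniq o.
Proof. by rewrite (perm_uniq o_perm) iota_uniq. Qed.

Lemma visit_time_lt i : (0 <= visit_time i < 10 * M)%Z.
Proof. by rewrite /visit_time; have := residue_in i; rewrite -index_mem size_o; lia. Qed.

Lemma residue_period i : residue (i + 10 * M) = residue i.
Proof. by rewrite /residue (_ : i + 10 * M = i + 1 * (10 * M))%Z ?Z_mod_plus_full //; lia. Qed.

Lemma visit_time_period : periodic M visit_time.
Proof. by move=> i; rewrite /visit_time residue_period. Qed.

Lemma mem_take_visit tau i : (residue i \in take tau o) = (visit_time i <? Z.of_nat tau)%Z.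
Proof. by rewrite (in_take _ (residue_in i)) /visit_time; lia. Qed.

Lemma mem_drop_visit tau i : (residue i \in drop tau o) = ~~ (visit_time i <? Z.of_nat tau)%Z.
Proof.
rewrite -mem_take_visit; have := residue_in i; have := uniq_o.
rewrite -{1 2}(cat_take_drop tau o) cat_uniq mem_cat => /and3P [_ /hasPn h _].
by case ht : (residue i \in take tau o) => //= _; apply/negP => /h; rewrite /= ht.
Qed.

Section Noncrossing.
Hypothesis noncrossing_o : forall l1 l2, o = l1 ++ l2 -> forall i j k l,
  j \in l1 -> l \in l1 -> i \in l2 -> k \in l2 -> (i < j < k)%N -> (k < l < N)%N \/ (l < i)%N -> False.

Lemma visit_noncrossing : noncrossing M visit_time.
Proof.
move=> tau i j k l h1 h2 [a1 a2 a3 a4].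
have ht : (0 <= tau)%Z by have := visit_time_lt i; lia.
have S x : (visit_time x < tau)%Z -> residue x \in take (Z.to_nat tau) o.
  by move=> hx; rewrite mem_take_visit; lia.
have nS x : (tau <= visit_time x)%Z -> residue x \in drop (Z.to_nat tau) o.
  by move=> hx; rewrite mem_drop_visit; lia.
have e := esym (cat_take_drop (Z.to_nat tau) o).
have wj := @mod_window (10 * M) i j ltac:(lia) ltac:(lia).
have wk := @mod_window (10 * M) i k ltac:(lia) ltac:(lia).
have wl := @mod_window (10 * M) i l ltac:(lia) ltac:(lia).
have bi := Z.mod_pos_bound i (10 * M) ltac:(lia).
have bj := Z.mod_pos_bound j (10 * M) ltac:(lia).
have bk := Z.mod_pos_bound k (10 * M) ltac:(lia).
have bl := Z.mod_pos_bound l (10 * M) ltac:(lia).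
have si := S i a1; have sj := nS j a2; have sk := S k a3; have sl := nS l a4.
(* Reduction modulo [10 * M] cuts the cyclic sequence i, j, k, l at one of four places; each cut
   yields a linear alternation of residues forbidden by [noncrossing_o]. *)
case: wl => wl; last case: wk => wk; last case: wj => wj.
- by apply: (@noncrossing_o _ _ e _ _ _ _ sk si sj sl); rewrite /residue; lia.
- by apply: (@noncrossing_o _ _ e _ _ _ _ si sk sl sj); rewrite /residue; lia.
- by apply: (@noncrossing_o _ _ e _ _ _ _ si sk sl sj); rewrite /residue; lia.
- by apply: (@noncrossing_o _ _ e _ _ _ _ sk si sj sl); rewrite /residue; lia.
Qed.

Lemma residue_inj a p q : (p < N)%N -> (q < N)%N ->
  residue (a + Z.of_nat p) = residue (a + Z.of_nat q) -> p = q.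
Proof.
move=> hp hq; rewrite /residue => e.
have w1 := @mod_window (10 * M) a (a + Z.of_nat p) ltac:(lia) ltac:(lia).
have w2 := @mod_window (10 * M) a (a + Z.of_nat q) ltac:(lia) ltac:(lia).
have b1 := Z.mod_pos_bound (a + Z.of_nat p) (10 * M) ltac:(lia).
have b2 := Z.mod_pos_bound (a + Z.of_nat q) (10 * M) ltac:(lia).
have b3 := Z.mod_pos_bound a (10 * M) ltac:(lia).
lia.
Qed.

Lemma run_bound (a : Z) (n : nat) (l : seq nat) : (n <= N)%N ->
  (forall q, (q < n)%N -> residue (a + Z.of_nat q) \in l) -> (n <= size l)%N.
Proof.
move=> hn hl; have -> : n = size [seq residue (a + Z.of_nat q) | q <- iota 0 n].
  by rewrite size_map size_iota.
apply: uniq_leq_size.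
- rewrite map_inj_in_uniq ?iota_uniq // => p q; rewrite !mem_iota !add0n => hp hq.
  by apply: residue_inj; lia.
- by move=> x /mapP [q]; rewrite mem_iota add0n => hq ->; apply: hl.
Qed.

(** The first [5 * M] visits form a circular interval, and r is its last element. By noncrossing,
    once the set is re-entered after a gap it is not left again before the turn closes ([mono]);
    counting with [run_bound] then fixes the length of the interval. *)
Lemma visit_good : exists r, good M (fun i => visit_time (i + r)%Z).
Proof.
pose H := Z.to_nat (5 * M); pose S x := (visit_time x <? 5 * M)%Z.
have hS x : (residue x \in take H o) = S x by rewrite mem_take_visit /S /H Z2Nat.id //; lia.
have hnS x : (residue x \in drop H o) = ~~ S x by rewrite mem_drop_visit /S /H Z2Nat.id //; lia.
have sz1 : size (take H o) = H by rewrite size_takel // size_o; lia.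
have sz2 : size (drop H o) = H by rewrite size_drop size_o; lia.
have pS x : S (x + 10 * M)%Z = S x by rewrite /S visit_time_period.
have pSn x (n : nat) : S (x + Z.of_nat n * (10 * M))%Z = S x.
  elim: n => [|n IH]; first by congr S; lia.
  by rewrite -IH -(pS (x + Z.of_nat n * (10 * M))%Z); congr S; lia.
have [r [hr1 hr2]] : exists r, S r /\ ~~ S (r + 1)%Z.
  have [x hx] : exists x, S x.
    case: (boolP (has (fun q => S (Z.of_nat q)) (iota 0 N))) => [/hasP [q _ hq]|/hasPn h].
      by exists (Z.of_nat q).
    have := @run_bound 0 N (drop H o) (leqnn _); rewrite sz2 => k.
    have : (N <= H)%N by apply: k => q hq; rewrite hnS Z.add_0_l; apply: h; rewrite mem_iota.
    by lia.
  have [y hy] : exists y, ~~ S y.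
    case: (boolP (all (fun q => S (Z.of_nat q)) (iota 0 N))) => [/allP h|/allPn [q _ hq]]; last by exists (Z.of_nat q).
    have := @run_bound 0 N (take H o) (leqnn _); rewrite sz1 => k.
    have : (N <= H)%N by apply: k => q hq; rewrite hS Z.add_0_l; apply: h; rewrite mem_iota.
    by lia.
  have [y' [hy' hxy]] : exists y', ~~ S y' /\ (x <= y')%Z.
    exists (y + Z.of_nat (Z.to_nat (Z.abs (x - y))) * (10 * M))%Z; rewrite pSn; split=> //; nia.
  case: (Classical_Prop.classic (exists r, S r /\ ~~ S (r + 1)%Z)) => // hne; exfalso.
  have all_S (n : nat) : S (x + Z.of_nat n)%Z.
    elim: n => [|n IH]; first by rewrite Z.add_0_r.
    rewrite (_ : x + Z.of_nat n.+1 = x + Z.of_nat n + 1)%Z; last by lia.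
    by apply/negPn/negP => hn; apply: hne; exists (x + Z.of_nat n)%Z.
  have e : (x + Z.of_nat (Z.to_nat (y' - x)) = y')%Z by clear - hxy; lia.
  by have := all_S (Z.to_nat (y' - x)); rewrite e (negbTE hy').
have nc := visit_noncrossing.
have mono p q : (1 <= p)%Z -> (p < q)%Z -> (q < 10 * M)%Z -> S (r + p)%Z -> S (r + q)%Z.
  move=> h1 h2 h3 hp; apply/negPn/negP => hq.
  have hp1 : p <> 1%Z by move=> e; move: hr2; rewrite -e hp.
  apply: (nc (5 * M)%Z r (r + 1)%Z (r + p)%Z (r + q)%Z); try lia.
  by move: hr1 hr2 hp hq; rewrite /S => *; split; lia.
exists r; split.
- by move=> i; rewrite -(visit_time_period (i + r)%Z); congr visit_time; lia.
- move=> tau i j k l h1 h2 [a1 a2 a3 a4].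
  by apply: (nc tau (i + r)%Z (j + r)%Z (k + r)%Z (l + r)%Z); try lia; split.
- split=> p hp; suff : S (r + p)%Z = (p <=? 0)%Z by rewrite /S Z.add_comm; lia.
  + case: (Z.eq_dec p 0) => [->|hp0]; first by rewrite Z.add_0_r hr1.
    rewrite (_ : (p <=? 0)%Z = true); last by lia.
    apply/negPn/negP => hn.
    have := @run_bound (r + 1) H.+1 (drop H o) ltac:(lia); rewrite sz2 => k.
    have : (H.+1 <= H)%N; last by lia.
    apply: k => q hq; rewrite hnS; apply/negP => hq2.
    move/negP: hn; apply; rewrite -pS (_ : r + p + 10 * M = r + (p + 10 * M))%Z; last by lia.
    case: (Z.eq_dec (1 + Z.of_nat q) (p + 10 * M)) => hqp; first by rewrite -hqp Z.add_assoc.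
    by apply: (mono (1 + Z.of_nat q)%Z); rewrite ?Z.add_assoc //; lia.
  + rewrite (_ : (p <=? 0)%Z = false); last by lia.
    apply/negP => hn.
    have := @run_bound (r + p) (H.+1) (take H o) ltac:(lia); rewrite sz1 => k.
    have : (H.+1 <= H)%N; last by lia.
    apply: k => q hq; rewrite hS -Z.add_assoc.
    case: (Z.eq_dec (p + Z.of_nat q) (10 * M)) => hq2; first by rewrite hq2 pS.
    case: (Z.eq_dec (Z.of_nat q) 0) => hq0; first by rewrite hq0 Z.add_0_r.
    by apply: (mono p); lia.
Qed.

End Noncrossing.
End Order.

Lemma sumN_front n F : sumN n.+1 F = F 0%N + sumN n (fun k => F k.+1).
Proof. by elim: n => [|n IH]; [rewrite sumN_S !sumN_0 | rewrite sumN_S IH sumN_S]; ring. Qed.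

Lemma sumN_le n F G : (forall k, (k < n)%N -> F k <= G k) -> sumN n F <= sumN n G.
Proof.
elim: n => [|n IH] hFG; first by rewrite !sumN_0; lra.
by rewrite !sumN_S; have := hFG n (ltnSn n); have := IH (fun k hk => hFG k (ltnW hk)); lra.
Qed.

Lemma plen_sumN (d : nat -> nat -> R) (l : seq nat) :
  plen d l = sumN (size l).-1 (fun k => d (nth 0%N l k) (nth 0%N l k.+1)).
Proof.
case: l => [//|x l] /=; elim: l x => [//|y l IH] x /=.
by rewrite sumN_front IH.
Qed.

Lemma sumN_telescope (f : nat -> R) n m : (m <= n)%N ->
  sumN n (fun k => ind (m <= k)%N * (f k.+1 - f k)) = f n - f m.
Proof.
elim: n => [|n IH] hm; first by have -> : m = 0%N; [lia | rewrite sumN_0; ring].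
rewrite sumN_S; case: (leqP m n) => hmn; rewrite /ind; first by rewrite IH //; ring.
have -> : m = n.+1 by lia.
rewrite (sumN_ext (G := fun k => 0 * 0 + 0 * 0)) ?sumN_lin; first by ring.
by move=> k hk; rewrite (_ : (n < k)%N = false); [ring | lia].
Qed.

Lemma wsum_sumN M mu n (F : nat -> Z -> R) :
  wsum M mu (fun i => sumN n (fun k => F k i)) = sumN n (fun k => wsum M mu (F k)).
Proof.
elim: n => [|n IH].
  by rewrite sumN_0; apply: sumR_eq0 => x; rewrite /triple !sumN_0; ring.
rewrite sumN_S -IH -[X in X + _]Rmult_1_l -[X in _ + X]Rmult_1_l -wsum_lin.
by apply: wsum_ext => i; rewrite sumN_S; ring.
Qed.

(** * Summation by parts: the certificate bounds the length of the path *)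

Section PathBound.
Variables (M : Z) (N : nat) (Y : nat -> plane) (o : seq nat).
Hypothesis M_gt1 : (1 < M)%Z.
Hypothesis N_spec : Z.of_nat N = (10 * M)%Z.
Hypothesis o_perm : perm_eq o (iota 0 N).

Definition height (i : Z) : R := dotp (dirx M i) (diry M i) (Y (residue M i)).

(* Summation by parts along the path. *)
Lemma wsum_height_le mu kappa : 0 <= kappa ->
  (forall tau, field_sq M mu (before (visit_time M o) tau) <= kappa ^ 2) ->
  wsum M mu height <= kappa * plen (fun i j => pdist (Y i) (Y j)) o.
Proof.
move=> hk hf.
pose Z' k := Y (nth 0%N o k).
have sz : size o = N by exact: size_o.
have eY i : Y (residue M i) = Z' (index (residue M i) o).
  by rewrite /Z' nth_index //; apply: residue_in N_spec o_perm i.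
pose S k := before (visit_time M o) (Z.of_nat k.+1).
have eS k i : S k i = (index (residue M i) o <= k)%N by rewrite /S /before /visit_time; lia.
have idx i : (index (residue M i) o <= N.-1)%N.
  by have := residue_in M_gt1 N_spec o_perm i; rewrite -index_mem sz; lia.
(* A visited point is the final vertex minus all increments made after its visit. The part of the
   final vertex does not depend on the point and vanishes in [wsum] by translation invariance. *)
have eH i : height i = (fst (Z' N.-1) * dirx M i + snd (Z' N.-1) * diry M i) -
    sumN N.-1 (fun k => (fst (Z' k.+1) - fst (Z' k)) * (ind (S k i) * dirx M i)
                       + (snd (Z' k.+1) - snd (Z' k)) * (ind (S k i) * diry M i)).
  rewrite (sumN_ext (G := fun k => dirx M i * (ind (index (residue M i) o <= k)%N * (fst (Z' k.+1) - fst (Z' k)))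
      + diry M i * (ind (index (residue M i) o <= k)%N * (snd (Z' k.+1) - snd (Z' k))))); last first.
    by move=> k _; rewrite eS; ring.
  rewrite sumN_lin (sumN_telescope (fun k => fst (Z' k))) // (sumN_telescope (fun k => snd (Z' k))) //.
  by rewrite /height /dotp eY; ring.
have -> : wsum M mu height = - sumN N.-1 (fun k => (fst (Z' k.+1) - fst (Z' k)) * fieldx M mu (S k)
     + (snd (Z' k.+1) - snd (Z' k)) * fieldy M mu (S k)).
  rewrite (@wsum_ext _ _ _ (fun i => 1 * (fst (Z' N.-1) * dirx M i + snd (Z' N.-1) * diry M i)
     + (-1) * sumN N.-1 (fun k => (fst (Z' k.+1) - fst (Z' k)) * (ind (S k i) * dirx M i)
                       + (snd (Z' k.+1) - snd (Z' k)) * (ind (S k i) * diry M i)))); last first.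
    by move=> i; rewrite eH; ring.
  rewrite wsum_lin wsum_sumN (@wsum_lin M mu _ _ (dirx M) (diry M)) wsum_dirx; last by lia.
  rewrite wsum_diry; last by lia.
  rewrite (sumN_ext (G := fun k => (fst (Z' k.+1) - fst (Z' k)) * fieldx M mu (S k)
     + (snd (Z' k.+1) - snd (Z' k)) * fieldy M mu (S k))); first by ring.
  by move=> k _; rewrite wsum_lin.
rewrite plen_sumN sz -[X in X <= _]Rmult_1_l -[X in _ <= X]Rplus_0_r.
have -> : 1 * - sumN N.-1 (fun k => (fst (Z' k.+1) - fst (Z' k)) * fieldx M mu (S k)
     + (snd (Z' k.+1) - snd (Z' k)) * fieldy M mu (S k)) =
   sumN N.-1 (fun k => (-1) * ((fst (Z' k.+1) - fst (Z' k)) * fieldx M mu (S k)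
     + (snd (Z' k.+1) - snd (Z' k)) * fieldy M mu (S k)) + 0 * 0).
  by rewrite sumN_lin; ring.
have -> : kappa * sumN N.-1 (fun k => pdist (Y (nth 0%N o k)) (Y (nth 0%N o k.+1))) + 0 =
   sumN N.-1 (fun k => kappa * pdist (Z' k) (Z' k.+1) + 0 * 0).
  by rewrite sumN_lin /Z'; ring.
apply: sumN_le => k _.
have h1 := dot_le_norm2 (- fieldx M mu (S k)) (- fieldy M mu (S k))
  (fst (Z' k.+1) - fst (Z' k)) (snd (Z' k.+1) - snd (Z' k)).
have h2 : norm2 (- fieldx M mu (S k)) (- fieldy M mu (S k)) <= kappa.
  rewrite norm2_opp; apply: Rsqr_incr_0_var => //; rewrite /Rsqr norm2_sq.
  by have := hf (Z.of_nat k.+1); rewrite /field_sq -/(S k); lra.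
have h3 := norm2_ge0 (fst (Z' k.+1) - fst (Z' k)) (snd (Z' k.+1) - snd (Z' k)).
have h4 := Rmult_le_compat_r _ _ _ h3 h2.
by rewrite /pdist; lra.
Qed.

Lemma wsum_ge mu H F0 : List.Forall (fun uw : Z * R => 0 <= uw.2) mu ->
  (forall u, F0 <= triple M H u) -> F0 * sumR snd mu <= wsum M mu H.
Proof.
move=> hmu hF; elim: hmu => [|[u w] l hw _ IH]; first by rewrite /wsum /=; lra.
rewrite /= in hw.
change (F0 * (w + sumR snd l) <= w * triple M H u + wsum M l H).
by have := hF u; nra.
Qed.

End PathBound.

(** Only a shortest order is known to be noncrossing, hence certified; its length bounds that of
    every other order from below. *)
Lemma support_path_bound M N Y delta F0 : (1 < M)%Z -> Z.of_nat N = (10 * M)%Z ->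
  0 < delta -> grid_step M <= 0.0005 -> 20 * grid_step M <= delta -> 0 <= F0 ->
  (forall i j, (i < N)%N -> (j < N)%N -> i != j ->
    dotp (dirx M (Z.of_nat i)) (diry M (Z.of_nat i)) (Y j) <
    dotp (dirx M (Z.of_nat i)) (diry M (Z.of_nat i)) (Y i)) ->
  (forall u, F0 <= triple M (height M Y) u) ->
  forall o, perm_eq o (iota 0 N) ->
  F0 * (caliper_length - delta) <= (1 + delta) * plen (fun i j => pdist (Y i) (Y j)) o.
Proof.
move=> hM hN hd hs1 hs2 hF hY htr o ho.
have [o1 ho1 hmin] := shortest_order (fun i j => pdist (Y i) (Y j)) N.
have hunc := support_uncross hM hN hY.
have nc := shortest_noncrossing (fun i j => pdist_sym (Y i) (Y j)) hunc ho1 hmin.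
have [r hr] := visit_good hM hN ho1 nc.
have [mu [h1 [h2 h3]]] := certified_shift (certified_good hM hd hs1 hs2 hr).
apply: Rle_trans (_ : F0 * sumR snd mu <= _); first by apply: Rmult_le_compat_l.
apply: Rle_trans (wsum_ge h1 htr) _.
have hk : 0 <= 1 + delta by lra.
have hb : wsum M mu (height M Y) <= (1 + delta) * plen (fun i j => pdist (Y i) (Y j)) o1.
  exact: (wsum_height_le Y hM hN ho1 hk h3).
by apply: Rle_trans hb _; apply: Rmult_le_compat_l => //; apply: hmin.
Qed.

(** * Triangular width of an arc *)

Definition dirdot (phi : R) (P : plane) : R := dotp (sin phi) (- cos phi) P.

Lemma gnomon_halfplanes P : gnomon P ->
  [/\ 0 <= snd P, s * fst P + c * snd P <= s * c & - (s * fst P) + c * snd P <= s * c].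
Proof.
have hs := s_bounds; have hc := c_bounds.
move=> hP; apply: (hP (fun A => [/\ 0 <= snd A, s * fst A + c * snd A <= s * c &
  - (s * fst A) + c * snd A <= s * c])).
- by move=> A B t [a1 a2 a3] [b1 b2 b3] [t0 t1] /=; split; nra.
- by move=> A [->|[->|->]] /=; split; nra.
Qed.

Lemma halfplanes_gnomon x y : 0 <= y -> s * x + c * y <= s * c -> - (s * x) + c * y <= s * c ->
  gnomon (x, y).
Proof.
have hs := s_bounds; have hc := c_bounds => h1 h2 h3 K hK hV.
have kA : K (- c, 0) by apply: hV; left.
have kB : K (c, 0) by apply: hV; right; left.
have kC : K (0, s) by apply: hV; right; right.
have hy : y <= s by nra.
case: (Rle_lt_or_eq_dec _ _ hy) => hys; last first.
  have -> : x = 0 by subst y; nra.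
  by rewrite hys.
set m := y / s; have em : m * s = y by rewrite /m; field; lra.
have m0 : 0 <= m by nra.
have m1 : m < 1 by nra.
set x0 := x / (1 - m); have ex : x0 * (1 - m) = x by rewrite /x0; field; lra.
have q : x0 * (s * (1 - m)) = s * x by rewrite -[in RHS]ex; ring.
have sm : 0 < s * (1 - m) by nra.
have hx1 : x0 <= c by apply: (Rmult_le_reg_r (s * (1 - m))) => //; rewrite q; nra.
have hx2 : - c <= x0 by apply: (Rmult_le_reg_r (s * (1 - m))) => //; rewrite q; nra.
set t := (x0 + c) / (2 * c); have et : t * (2 * c) = x0 + c by rewrite /t; field; lra.
have t01 : 0 <= t <= 1 by split; nra.
have kQ := hK _ _ t kA kB t01.
have := hK _ _ m kQ kC (conj m0 (Rlt_le _ _ m1)).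
rewrite /=; suff -> : ((1 - m) * ((1 - t) * - c + t * c) + m * 0, (1 - m) * ((1 - t) * 0 + t * 0) + m * s) = (x, y) by [].
congr pair; last by rewrite -em; ring.
have e2 : (1 - t) * - c + t * c = x0 by transitivity (t * (2 * c) - c); [ring | rewrite et; ring].
by rewrite e2 -[in RHS]ex; ring.
Qed.

Lemma dirdot_rotated phi P :
  [/\ dirdot phi P = - yr (fst P) (snd P) phi,
      dirdot (phi + 4 * beta) P = s * xr (fst P) (snd P) phi + c * yr (fst P) (snd P) phi &
      dirdot (phi - 4 * beta) P = - (s * xr (fst P) (snd P) phi) + c * yr (fst P) (snd P) phi].
Proof.
rewrite /dirdot /dotp /xr /yr sin_plus cos_plus sin_minus cos_minus sin_4beta cos_4beta.
by split; ring.
Qed.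

Lemma fits_of_width (r phi hu hv hw : R) (A : plane -> Prop) : 0 < r ->
  (forall P, A P -> dirdot phi P <= hu) ->
  (forall P, A P -> dirdot (phi + 4 * beta) P <= hv) ->
  (forall P, A P -> dirdot (phi - 4 * beta) P <= hw) ->
  2 * c * hu + hv + hw <= 2 * s * c * r -> contains_congruent_copy (homothet r gnomon) A.
Proof.
move=> hr Hu Hv Hw hsum; have hs := s_bounds; have hc := c_bounds.
(* The vertical shift puts the base line under the rotated set; the horizontal one leaves equal room
   at the two legs. *)
exists phi, ((hw - hv) / (2 * s)), hu => P hP.
have [e1 e2 e3] := dirdot_rotated phi P.
have := Hu P hP; have := Hv P hP; have := Hw P hP; rewrite e1 e2 e3 /motion /xt /yt.
set x := xr _ _ _; set y := yr _ _ _ => k3 k2 k1.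
set tx := _ / _; have etx : s * tx = (hw - hv) / 2 by rewrite /tx; field; lra.
exists ((x + tx) / r, (y + hu) / r); split; last by rewrite /=; congr pair; field; lra.
have hr' : 0 < / r by apply: Rinv_0_lt_compat.
have er : r * / r = 1 by field; lra.
apply: halfplanes_gnomon; rewrite /Rdiv.
- by apply: Rmult_le_pos; lra.
- apply: (Rmult_le_reg_r r) => //.
  rewrite (_ : (s * ((x + tx) * / r) + c * ((y + hu) * / r)) * r = (s * (x + tx) + c * (y + hu)) * (r * / r)); last by ring.
  by rewrite er; lra.
- apply: (Rmult_le_reg_r r) => //.
  rewrite (_ : (- (s * ((x + tx) * / r)) + c * ((y + hu) * / r)) * r = (- (s * (x + tx)) + c * (y + hu)) * (r * / r)); last by ring.
  by rewrite er; lra.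
Qed.

(** The three half-plane inequalities of the triangle, added with the side lengths as weights, make
    the translation cancel. *)
Lemma width_of_fits r (A : plane -> Prop) : 0 < r ->
  contains_congruent_copy (homothet r gnomon) A ->
  exists phi, forall P Q T, A P -> A Q -> A T ->
    2 * c * dirdot phi P + dirdot (phi + 4 * beta) Q + dirdot (phi - 4 * beta) T <= 2 * s * c * r.
Proof.
move=> hr [phi [tx [ty h]]]; exists phi => P Q T hP hQ hT.
have hs := s_bounds; have hc := c_bounds.
have k B : A B -> [/\ 0 <= yr (fst B) (snd B) phi + ty,
    s * (xr (fst B) (snd B) phi + tx) + c * (yr (fst B) (snd B) phi + ty) <= s * c * r &
    - (s * (xr (fst B) (snd B) phi + tx)) + c * (yr (fst B) (snd B) phi + ty) <= s * c * r].
  move=> /h [G [/gnomon_halfplanes [g1 g2 g3] e]]; move: e; rewrite /motion /xt /yt => -[-> ->].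
  by split; nra.
have [p1 _ _] := k P hP; have [_ q1 _] := k Q hQ; have [_ _ t1] := k T hT.
have [-> _ _] := dirdot_rotated phi P; have [_ -> _] := dirdot_rotated phi Q.
have [_ _ ->] := dirdot_rotated phi T.
by nra.
Qed.

Lemma sum_f_R0_sumN f n : sum_f_R0 f n = sumN n.+1 f.
Proof. by elim: n => [|n IH]; [rewrite sumN_S sumN_0 /=; ring | rewrite sumN_S -IH]. Qed.

(** Extends an arc by constants, since the extreme value theorem used here asks for two-sided
    continuity at the end points. *)
Definition clamp (t : R) : R := Rmax 0 (Rmin 1 t).

Lemma clamp_range t : 0 <= clamp t <= 1.
Proof.
rewrite /clamp; split; first exact: Rmax_l.
by apply: Rmax_lub; [lra | apply: Rmin_l].
Qed.

Lemma clamp_id t : 0 <= t <= 1 -> clamp t = t.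
Proof. by move=> ht; rewrite /clamp Rmin_right ?Rmax_right //; lra. Qed.

Lemma clamp_contract x y : Rabs (clamp y - clamp x) <= Rabs (y - x).
Proof.
rewrite /clamp /Rmin; repeat case: Rle_dec => ?; rewrite /Rmax; repeat case: Rle_dec => ?.
all: rewrite /Rabs; repeat case: Rcase_abs => ?; lra.
Qed.

Section Arc.
Variable gamma : R -> plane.
Hypothesis gamma_cont : continuous_on (fun t => 0 <= t <= 1) gamma.

Lemma coord_cont x y t : continuity_pt (fun t => dotp x y (gamma (clamp t))) t.
Proof.
move=> eps heps.
have hk : 0 < Rabs x + Rabs y + 1 by have := Rabs_pos x; have := Rabs_pos y; lra.
have he : 0 < eps / (Rabs x + Rabs y + 1) by apply: Rdiv_lt_0_compat.
have := proj1 (filterlim_locally _ _) (gamma_cont (clamp_range t)) (mkposreal _ he).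
move=> [d hd]; exists d; split; first exact: cond_pos.
move=> u [_ hu]; rewrite /= /R_dist in hu *.
have hb : ball (clamp t) d (clamp u).
  by rewrite /ball /= /AbsRing_ball /abs /minus /plus /opp /=; apply: Rle_lt_trans (clamp_contract _ _) hu.
have [b1 b2] := hd _ hb (clamp_range u).
rewrite /ball /= /AbsRing_ball /abs /minus /plus /opp /= in b1 b2.
rewrite /R_met /= /Rdist /dotp.
have e0 := he; move: b1 b2 e0; set e := eps / _ => b1 b2 e0.
have -> : x * fst (gamma (clamp u)) + y * snd (gamma (clamp u)) - (x * fst (gamma (clamp t)) + y * snd (gamma (clamp t)))
  = x * (fst (gamma (clamp u)) + - fst (gamma (clamp t))) + y * (snd (gamma (clamp u)) + - snd (gamma (clamp t))) by ring.
apply: Rle_lt_trans (Rabs_triang _ _) _; rewrite !Rabs_mult.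
have ee : e * (Rabs x + Rabs y + 1) = eps by rewrite /e; field; lra.
by have := Rabs_pos x; have := Rabs_pos y; nra.
Qed.

Lemma contact_ex phi : exists t, 0 <= t <= 1 /\
  forall u, 0 <= u <= 1 -> dirdot phi (gamma u) <= dirdot phi (gamma t).
Proof.
have [t [ht1 ht2]] := @continuity_ab_maj (fun t => dotp (sin phi) (- cos phi) (gamma (clamp t))) 0 1
  ltac:(lra) (fun t _ => coord_cont _ _ t).
exists t; split=> // u hu; rewrite /dirdot.
by have := ht1 u hu; rewrite !clamp_id.
Qed.

Definition contact phi : R := proj1_sig (constructive_indefinite_description _ (contact_ex phi)).

Lemma contact_range phi : 0 <= contact phi <= 1.
Proof. by rewrite /contact; case: constructive_indefinite_description => t [] . Qed.

Lemma contact_max phi u : 0 <= u <= 1 -> dirdot phi (gamma u) <= dirdot phi (gamma (contact phi)).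
Proof. by rewrite /contact; case: constructive_indefinite_description => t [_ h] /=; apply: h. Qed.

Definition support phi : R := dirdot phi (gamma (contact phi)).
Definition width phi : R := 2 * c * support phi + support (phi + 4 * beta) + support (phi - 4 * beta).

Lemma gamma_bounded : exists B, 0 < B /\ forall t, 0 <= t <= 1 -> Rabs (fst (gamma t)) + Rabs (snd (gamma t)) <= B.
Proof.
have b x y : exists B, forall t, 0 <= t <= 1 -> dotp x y (gamma t) <= B.
  have [t [ht1 ht2]] := @continuity_ab_maj (fun t => dotp x y (gamma (clamp t))) 0 1
    ltac:(lra) (fun t _ => coord_cont _ _ t).
  exists (dotp x y (gamma (clamp t))) => u hu.
  by have := ht1 u hu; rewrite (clamp_id hu).
have [B1 h1] := b 1 1; have [B2 h2] := b 1 (-1); have [B3 h3] := b (-1) 1; have [B4 h4] := b (-1) (-1).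
exists (1 + Rmax (Rmax B1 B2) (Rmax B3 B4)).
have m1 := Rmax_l (Rmax B1 B2) (Rmax B3 B4); have m2 := Rmax_r (Rmax B1 B2) (Rmax B3 B4).
have m3 := Rmax_l B1 B2; have m4 := Rmax_r B1 B2; have m5 := Rmax_l B3 B4; have m6 := Rmax_r B3 B4.
have all t : 0 <= t <= 1 -> Rabs (fst (gamma t)) + Rabs (snd (gamma t)) <= Rmax (Rmax B1 B2) (Rmax B3 B4).
  move=> ht; have := h1 t ht; have := h2 t ht; have := h3 t ht; have := h4 t ht; rewrite /dotp.
  by rewrite /Rabs; do 2 case: Rcase_abs => ?; lra.
split; last by move=> t ht; have := all t ht; lra.
have := all 0 ltac:(lra); have := Rabs_pos (fst (gamma 0)); have := Rabs_pos (snd (gamma 0)); lra.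
Qed.

Lemma dirdot_lipschitz P B phi psi : Rabs (fst P) + Rabs (snd P) <= B ->
  dirdot phi P - dirdot psi P <= B * Rabs (phi - psi).
Proof.
move=> hB; rewrite /dirdot /dotp.
have k1 := sin_lipschitz phi psi; have k2 := cos_lipschitz phi psi.
have -> : sin phi * fst P + - cos phi * snd P - (sin psi * fst P + - cos psi * snd P) =
  (sin phi - sin psi) * fst P + - ((cos phi - cos psi) * snd P) by ring.
apply: Rle_trans (Rle_abs _) _; apply: Rle_trans (Rabs_triang _ _) _.
rewrite Rabs_Ropp !Rabs_mult.
have := Rabs_pos (fst P); have := Rabs_pos (snd P); have := Rabs_pos (phi - psi) => p1 p2 p3.
have q1 : Rabs (sin phi - sin psi) * Rabs (fst P) <= Rabs (phi - psi) * Rabs (fst P) by apply: Rmult_le_compat_r.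
have q2 : Rabs (cos phi - cos psi) * Rabs (snd P) <= Rabs (phi - psi) * Rabs (snd P) by apply: Rmult_le_compat_r.
by nra.
Qed.

Lemma support_lipschitz B phi psi :
  (forall t, 0 <= t <= 1 -> Rabs (fst (gamma t)) + Rabs (snd (gamma t)) <= B) ->
  support phi - support psi <= B * Rabs (phi - psi).
Proof.
move=> hB; have := contact_max psi (contact_range phi); rewrite -/(support psi) => k.
by have := dirdot_lipschitz phi psi (hB _ (contact_range phi)); rewrite /support in k *; lra.
Qed.

Lemma width_cont phi : continuity_pt width phi.
Proof.
have [B [B0 hB]] := gamma_bounded; have hc := c_bounds.
move=> eps heps; exists (eps / (4 * B)); split; first by apply: Rdiv_lt_0_compat; lra.
move=> psi [_]; rewrite /= /Rdist => hpsi.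
have e : eps / (4 * B) * (4 * B) = eps by field; lra.
have k u v : Rabs (u - v) = Rabs (psi - phi) -> Rabs (support u - support v) <= B * Rabs (psi - phi).
  move=> huv; have h1 := support_lipschitz u v hB; have h2 := support_lipschitz v u hB.
  by rewrite (Rabs_minus_sym v u) in h2; rewrite huv in h1 h2; apply: Rabs_le; lra.
have k0 := k psi phi erefl.
have k1 := k (psi + 4 * beta) (phi + 4 * beta); have k2 := k (psi - 4 * beta) (phi - 4 * beta).
rewrite (_ : psi + 4 * beta - (phi + 4 * beta) = psi - phi) in k1; last by ring.
rewrite (_ : psi - 4 * beta - (phi - 4 * beta) = psi - phi) in k2; last by ring.
have {}k1 := k1 erefl; have {}k2 := k2 erefl.
move: k0 k1 k2 => /Rabs_le_between k0 /Rabs_le_between k1 /Rabs_le_between k2.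
have hq : B * Rabs (psi - phi) < eps / 4 by nra.
set q := B * _ in k0 k1 k2 hq.
have q0 : 0 <= q by apply: Rmult_le_pos; [lra | exact: Rabs_pos].
by rewrite /width; apply: Rabs_def1; nra.
Qed.

Lemma width_min : exists phi0, forall phi, 0 <= phi <= 2 * PI -> width phi0 <= width phi.
Proof.
have [phi0 [h _]] := @continuity_ab_min width 0 (2 * PI) ltac:(have := PI_RGT_0; lra)
  (fun phi _ => width_cont phi).
by exists phi0.
Qed.

Lemma inscribed_order_le L (o : seq nat) (T : nat -> R) : is_lub (inscribed_length gamma) L ->
  o != [::] -> (forall i, 0 <= T i <= 1) -> sorted (fun i j => if Rle_dec (T i) (T j) then true else false) o ->
  plen (fun i j => pdist (gamma (T i)) (gamma (T j))) o <= L.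
Proof.
move=> [hub _] ho hT hs; set n := size o.
have hn : (0 < n)%N by rewrite /n; case: (o) ho.
(* Subdivisions must start at 0 and end at 1, so both parameters are added around the visiting
   times; the two extra edges only lengthen the polygon. *)
pose u k := if k is k'.+1 then (if (k' < n)%N then T (nth 0%N o k') else 1) else 0.
have hl : inscribed_length gamma (sum_f_R0 (fun i => dist (gamma (u i)) (gamma (u (S i)))) n).
  exists n, u; split => //; split; first by rewrite /u ltnn.
  split=> // -[|i] /leP hi; rewrite /u.
    by rewrite hn; case: (hT (nth 0%N o 0)).
  case: (ltnP i n) => hi1; last by lia.
  case: (ltnP i.+1 n) => hi2; last by case: (hT (nth 0%N o i)).
  by have := elimT (sortedP 0%N) hs i hi2; case: Rle_dec.
apply: Rle_trans (hub _ hl); rewrite sum_f_R0_sumN plen_sumN sumN_front -/n.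
rewrite -(prednK hn) sumN_S succnK.
have p i j : 0 <= dist (gamma (u i)) (gamma (u j)) by rewrite -pdist_dist; apply: norm2_ge0.
rewrite (sumN_ext (G := fun k => dist (gamma (u k.+1)) (gamma (u k.+2)))).
  by have := p 0%N 1%N; have := p n.-1.+1 n.-1.+2; lra.
move=> k hk; rewrite pdist_dist /u (_ : (k < n)%N); last by lia.
by rewrite (_ : (k.+1 < n)%N) //; lia.
Qed.

End Arc.

Lemma exists_fine_grid eta : 0 < eta -> exists M, (1 < M)%Z /\ grid_step M <= eta.
Proof.
move=> he; have [h1 _] := archimed (1 / eta); set u := up _ in h1.
have h0 : 0 < 1 / eta by apply: Rdiv_lt_0_compat; lra.
have hu : (0 < u)%Z by apply: lt_IZR; lra.
exists (u + 1)%Z; split; first by lia.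
have hM : 1 / eta < IZR (u + 1) by rewrite plus_IZR; lra.
have e : 1 / eta * eta = 1 by field; lra.
rewrite /grid_step; have := PI_4; have := PI_RGT_0 => p1 p2.
apply: (Rmult_le_reg_r (5 * IZR (u + 1))); first by lra.
rewrite /Rdiv Rmult_assoc Rinv_l; last by lra.
by have := Rmult_lt_compat_r _ _ _ he hM; nra.
Qed.

Lemma dir_unit M i : dirx M i ^ 2 + diry M i ^ 2 = 1.
Proof. by rewrite /dirx /diry -(sin2_cos2 (IZR i * grid_step M)) /Rsqr; ring. Qed.

(** * Contact points pushed into strictly convex position *)

Section Perturbed.
Variables (M : Z) (N : nat) (gamma : R -> plane) (eps : R).
Hypothesis M_gt1 : (1 < M)%Z.
Hypothesis N_spec : Z.of_nat N = (10 * M)%Z.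
Hypothesis gamma_cont : continuous_on (fun t => 0 <= t <= 1) gamma.
Hypothesis eps_pos : 0 < eps.
Let h := grid_step M.
Let M_pos : (0 < M)%Z. Proof. lia. Qed.

Definition contact_time (i : nat) : R := contact gamma_cont (IZR (Z.of_nat i) * grid_step M).
Definition contact_point (i : nat) : plane := gamma (contact_time i).
(** Contact points of different directions may coincide. Pushing gains [eps] in the own direction
    but only [eps] times the cosine of a nonzero angle in any other, which makes the support
    strict. *)
Definition pushed_point (i : nat) : plane :=
  (fst (contact_point i) + eps * dirx M (Z.of_nat i), snd (contact_point i) + eps * diry M (Z.of_nat i)).

Lemma contact_point_max i t : 0 <= t <= 1 ->
  dotp (dirx M (Z.of_nat i)) (diry M (Z.of_nat i)) (gamma t) <=
  dotp (dirx M (Z.of_nat i)) (diry M (Z.of_nat i)) (contact_point i).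
Proof. exact: contact_max. Qed.

Lemma pushed_strict_support i j : (i < N)%N -> (j < N)%N -> i != j ->
  dotp (dirx M (Z.of_nat i)) (diry M (Z.of_nat i)) (pushed_point j) <
  dotp (dirx M (Z.of_nat i)) (diry M (Z.of_nat i)) (pushed_point i).
Proof.
move=> hi hj hij.
have := @contact_point_max i (contact_time j) (contact_range gamma_cont _).
rewrite -/(contact_point j) /pushed_point /dotp /=; set P := contact_point i; set Q := contact_point j.
have e := dir_unit M (Z.of_nat i).
have hcos : dirx M (Z.of_nat i) * dirx M (Z.of_nat j) + diry M (Z.of_nat i) * diry M (Z.of_nat j) < 1.
  have -> : dirx M (Z.of_nat i) * dirx M (Z.of_nat j) + diry M (Z.of_nat i) * diry M (Z.of_nat j)
    = cos (2 * (IZR (Z.of_nat i - Z.of_nat j) * h / 2)).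
    rewrite (_ : 2 * (IZR (Z.of_nat i - Z.of_nat j) * h / 2) = IZR (Z.of_nat i) * h - IZR (Z.of_nat j) * h).
      by rewrite cos_minus /dirx /diry -/h; ring.
    by rewrite minus_IZR; field.
  rewrite cos_2a_sin; have hp := grid_step_pos M_pos; have hpi := five_M_step M_pos.
  rewrite mult_IZR in hpi.
  have k (m : Z) : (0 < m < 10 * M)%Z -> 0 < sin (IZR m * h / 2).
    move=> [m1 m2]; move: (IZR_lt _ _ m1) (IZR_lt _ _ m2); rewrite mult_IZR => q1 q2.
    by apply: sin_gt_0; rewrite -/h in hp hpi *; nra.
  have [hlt|hlt] : (i < j)%N \/ (j < i)%N by lia.
  - have := k (Z.of_nat j - Z.of_nat i)%Z ltac:(lia).
    rewrite (_ : IZR (Z.of_nat i - Z.of_nat j) * h / 2 = - (IZR (Z.of_nat j - Z.of_nat i) * h / 2)).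
      by rewrite sin_neg => q; nra.
    by rewrite !minus_IZR; field.
  - by have := k (Z.of_nat i - Z.of_nat j)%Z ltac:(lia) => q; nra.
by nra.
Qed.

Lemma dir_residue i : dirx M (Z.of_nat (residue M i)) = dirx M i /\ diry M (Z.of_nat (residue M i)) = diry M i.
Proof.
have b := Z.mod_pos_bound i (10 * M) ltac:(lia); have e := Z.div_mod i (10 * M) ltac:(lia).
rewrite /residue Z2Nat.id; last by lia.
set q := (i / (10 * M))%Z in e; set m := (i mod (10 * M))%Z in e *.
have k (n : nat) j : dirx M (j + Z.of_nat n * (10 * M)) = dirx M j /\ diry M (j + Z.of_nat n * (10 * M)) = diry M j.
  elim: n => [|n [IH1 IH2]]; first by rewrite Z.add_0_r.
  rewrite (_ : j + Z.of_nat n.+1 * (10 * M) = j + Z.of_nat n * (10 * M) + 10 * M)%Z; last by lia.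
  by have [-> ->] := dir_period M_gt1 (j + Z.of_nat n * (10 * M))%Z.
case: (Z_le_gt_dec 0 q) => hq.
- have := k (Z.to_nat q) m; rewrite Z2Nat.id // (_ : m + q * (10 * M) = i)%Z; last by lia.
  by move=> [-> ->].
- have := k (Z.to_nat (- q)) i; rewrite Z2Nat.id; last by lia.
  by rewrite (_ : i + - q * (10 * M) = m)%Z; last by lia.
Qed.

Lemma height_ge i t : 0 <= t <= 1 ->
  dotp (dirx M i) (diry M i) (gamma t) <= height M pushed_point i.
Proof.
move=> ht; have [e1 e2] := dir_residue i.
have := contact_point_max (residue M i) ht; rewrite e1 e2 /height /pushed_point /dotp /= e1 e2.
by have := dir_unit M i; nra.
Qed.

Lemma triple_height_ge F0 : (forall phi, 0 <= phi <= 2 * PI -> F0 <= width gamma_cont phi) ->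
  forall u, F0 <= triple M (height M pushed_point) u.
Proof.
move=> hF u; set phi := IZR (Z.of_nat (residue M u)) * h.
have hphi : 0 <= phi <= 2 * PI.
  have hr : (residue M u < N)%N by rewrite /residue; have := Z.mod_pos_bound u (10 * M); lia.
  have hp := grid_step_pos M_pos; have hpi := five_M_step M_pos.
  have k1 : 0 <= IZR (Z.of_nat (residue M u)) by apply: IZR_le; lia.
  have k2 : IZR (Z.of_nat (residue M u)) <= IZR (10 * M) by apply: IZR_le; lia.
  rewrite mult_IZR in hpi; rewrite mult_IZR in k2.
  by rewrite /phi; split; rewrite -/h in hp hpi *; nra.
apply: Rle_trans (hF phi hphi) _.
have [e1 e2] := dir_residue u.
have s1 : sin phi = dirx M u by rewrite -e1.
have s2 : - cos phi = diry M u by rewrite -e2.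
have s2' : cos phi = - diry M u by lra.
have h1 := height_ge u (contact_range gamma_cont phi).
have h2 := height_ge (u + 4 * M) (contact_range gamma_cont (phi + 4 * beta)).
have h3 := height_ge (u - 4 * M) (contact_range gamma_cont (phi - 4 * beta)).
have hc := c_bounds.
have z : (u - 4 * M = u + - (4 * M))%Z by lia.
have q1 P : dirdot phi P = dotp (dirx M u) (diry M u) P by rewrite /dirdot s1 s2.
have q2 P : dirdot (phi + 4 * beta) P = dotp (dirx M (u + 4 * M)) (diry M (u + 4 * M)) P.
  rewrite /dirdot dirx_add diry_add cos_4M // sin_4M // sin_plus cos_plus cos_4beta sin_4beta s1 s2'.
  by congr dotp; ring.
have q3 P : dirdot (phi - 4 * beta) P = dotp (dirx M (u - 4 * M)) (diry M (u - 4 * M)) P.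
  rewrite /dirdot z dirx_add diry_add opp_IZR -Ropp_mult_distr_l cos_neg sin_neg cos_4M // sin_4M //.
  by rewrite sin_minus cos_minus cos_4beta sin_4beta s1 s2'; congr dotp; ring.
rewrite -q1 in h1; rewrite -q2 in h2; rewrite -q3 in h3.
rewrite /width /triple /support.
have : c * dirdot phi (gamma (contact gamma_cont phi)) <= c * height M pushed_point u.
  by apply: Rmult_le_compat_l => //; lra.
by lra.
Qed.

Lemma pushed_path_le (o : seq nat) : (size o <= N)%N ->
  plen (fun i j => pdist (pushed_point i) (pushed_point j)) o <=
  plen (fun i j => pdist (contact_point i) (contact_point j)) o + 2 * eps * INR N.
Proof.
move=> ho; rewrite !plen_sumN.
have k i : pdist (pushed_point i) (contact_point i) = eps.
  rewrite /pdist /pushed_point /= (_ : fst _ - _ = eps * - dirx M (Z.of_nat i)); last by ring.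
  rewrite (_ : snd _ - _ = eps * - diry M (Z.of_nat i)); last by ring.
  by rewrite norm2_scal ?norm2_opp /norm2 ?dir_unit ?sqrt_1; lra.
have hb i j : pdist (pushed_point i) (pushed_point j) <= pdist (contact_point i) (contact_point j) + 2 * eps.
  have := pdist_triangle (pushed_point i) (contact_point i) (pushed_point j).
  have := pdist_triangle (contact_point i) (contact_point j) (pushed_point j).
  by rewrite k (pdist_sym (contact_point j)) k; lra.
apply: Rle_trans (sumN_le (G := fun m => 1 * pdist (contact_point (nth 0%N o m)) (contact_point (nth 0%N o m.+1)) + 2 * eps * 1) _) _.
  by move=> m _; have := hb (nth 0%N o m) (nth 0%N o m.+1); lra.
rewrite sumN_lin.
have : sumN (size o).-1 (fun=> 1) <= INR N.
  have [_ q] := @sumN_bounds (size o).-1 (fun=> 1) 1 1 (fun _ _ => conj (Rle_refl 1) (Rle_refl 1)).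
  by apply: Rle_trans q _; rewrite Rmult_1_r; apply: le_INR; lia.
by nra.
Qed.

End Perturbed.

Lemma covers_min_width (gamma : R -> plane) (hg : continuous_on (fun t => 0 <= t <= 1) gamma) F0 :
  is_lub (inscribed_length gamma) 1 ->
  (forall phi, 0 <= phi <= 2 * PI -> F0 <= width hg phi) -> F0 * caliper_length <= 1.
Proof.
move=> hL hF; apply: Rnot_lt_le => hlt.
have hT := caliper_length_bounds.
have F0pos : 0 < F0 by nra.
(* Pushing will cost total length [delta], so the path bound reads [F0 * (caliper_length - delta) <=
   (1 + delta) ^ 2], and the right side is at most [1 + 3 * delta]: a contradiction for this
   [delta]. *)
pose delta := Rmin 0.01 ((F0 * caliper_length - 1) / (F0 + 3) / 2).
have hq : 0 < (F0 * caliper_length - 1) / (F0 + 3) / 2.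
  by apply: Rdiv_lt_0_compat; [apply: Rdiv_lt_0_compat|]; lra.
have d0 : 0 < delta by apply: Rmin_pos; lra.
have d1 : delta <= 0.01 by apply: Rmin_l.
have d2 : delta * (F0 + 3) < F0 * caliper_length - 1.
  have : delta <= (F0 * caliper_length - 1) / (F0 + 3) / 2 by apply: Rmin_r.
  set q := _ / (F0 + 3) in hq * => hd.
  have e : q * (F0 + 3) = F0 * caliper_length - 1 by rewrite /q; field; lra.
  by nra.
have [M [hM hstep]] := @exists_fine_grid (delta / 20) ltac:(lra).
pose N := Z.to_nat (10 * M).
have hN : Z.of_nat N = (10 * M)%Z by rewrite /N; lia.
have N0 : 0 < INR N by apply: lt_0_INR; lia.
pose eps := delta / (2 * INR N).
have e0 : 0 < eps by apply: Rdiv_lt_0_compat; lra.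
pose T := contact_time M hg.
pose leT i j := if Rle_dec (T i) (T j) then true else false.
pose o := sort leT (iota 0 N).
have ho : perm_eq o (iota 0 N) by rewrite /o perm_sort.
have hso : sorted leT o.
  apply: sort_sorted => i j; rewrite /leT; case: Rle_dec => //= h1; case: Rle_dec => //= h2.
  by exfalso; lra.
have hsz : size o = N by rewrite (perm_size ho) size_iota.
have hne : o != [::] by rewrite -size_eq0 hsz; lia.
have len1 := inscribed_order_le hL hne (fun i => contact_range hg _) hso.
have len2 : plen (fun i j => pdist (pushed_point M eps hg i) (pushed_point M eps hg j)) o <=
    plen (fun i j => pdist (contact_point M hg i) (contact_point M hg j)) o + 2 * eps * INR N.
  by apply: pushed_path_le => //; rewrite hsz.
have key : F0 * (caliper_length - delta) <=
    (1 + delta) * plen (fun i j => pdist (pushed_point M eps hg i) (pushed_point M eps hg j)) o.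
  apply: (support_path_bound hM hN d0) => //; try lra.
  - by apply: pushed_strict_support.
  - by apply: (triple_height_ge (N := N)).
have ee : 2 * eps * INR N = delta by rewrite /eps; field; lra.
rewrite ee in len2; rewrite -/(T) in len1.
set p1 := plen _ _ in key len2; set p2 := plen _ _ in len2.
have {}len1 : p2 <= 1 by [].
by have : (1 + delta) * p1 <= (1 + delta) * (1 + delta); [apply: Rmult_le_compat_l; lra | nra].
Qed.

Lemma gnomon_covers : covers_unit_arcs (homothet (/ C_gnomon) gnomon).
Proof.
move=> gamma [hg hL].
have [phi0 hmin] := width_min hg.
have := covers_min_width hL hmin; have hT := caliper_length_bounds => hw.
have hs := s_bounds; have hc := c_bounds.
have C0 : 0 < C_gnomon by rewrite C_gnomon_eq; apply: Rmult_lt_0_compat; [nra | lra].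
apply: (@fits_of_width _ phi0 (support hg phi0) (support hg (phi0 + 4 * beta)) (support hg (phi0 - 4 * beta))).
- exact: Rinv_0_lt_compat.
- by move=> P [t [ht ->]]; apply: contact_max.
- by move=> P [t [ht ->]]; apply: contact_max.
- by move=> P [t [ht ->]]; apply: contact_max.
- have -> : 2 * s * c * / C_gnomon = / caliper_length.
    by rewrite C_gnomon_eq; field; repeat split; lra.
  apply: (Rmult_le_reg_r caliper_length); first by lra.
  by rewrite Rinv_l; [rewrite /width in hw | lra].
Qed.

(** * Sharpness: the caliper *)

Definition seg_point (P Q : plane) (t : R) : plane :=
  (fst P + t * (fst Q - fst P), snd P + t * (snd Q - snd P)).

Lemma pdist_refl P : pdist P P = 0.
Proof. by rewrite /pdist /norm2 !Rminus_diag; rewrite (_ : _ + _ = 0) ?sqrt_0 //; ring. Qed.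

Lemma pdist_ge0 P Q : 0 <= pdist P Q.
Proof. exact: norm2_ge0. Qed.

Lemma pdist_seg P Q t u : pdist (seg_point P Q t) (seg_point P Q u) = Rabs (u - t) * pdist P Q.
Proof.
rewrite /pdist /seg_point /= -norm2_scal; last exact: Rabs_pos.
rewrite /norm2; congr sqrt; rewrite !Rpow_mult_distr !pow2_abs; ring.
Qed.

(* The parameter is the arc length. *)
Fixpoint polyline (m : nat) (V : nat -> plane) (t : R) : plane :=
  if m is m'.+1 then
    if Rle_dec t 0 then V 0%N
    else if Rle_dec t (pdist (V 0%N) (V 1%N)) then seg_point (V 0%N) (V 1%N) (t / pdist (V 0%N) (V 1%N))
    else polyline m' (fun k => V k.+1) (t - pdist (V 0%N) (V 1%N))
  else V 0%N.

Lemma polyline_start m V t : t <= 0 -> polyline m V t = V 0%N.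
Proof. by case: m => [//|m] ht /=; case: Rle_dec. Qed.

Lemma polyline_lipschitz m V t u : t <= u -> pdist (polyline m V t) (polyline m V u) <= u - t.
Proof.
elim: m V t u => [|m IH] V t u htu; first by rewrite /= pdist_refl; lra.
rewrite /=; set l := pdist (V 0%N) (V 1%N); have hl : 0 <= l by apply: pdist_ge0.
case: (Rle_dec t 0) => ht; case: (Rle_dec u 0) => hu; try lra; first by rewrite pdist_refl; lra.
- have e0 : V 0%N = seg_point (V 0%N) (V 1%N) 0.
    by rewrite /seg_point; case: (V 0%N) => x y /=; congr pair; ring.
  have e1 : V 1%N = seg_point (V 0%N) (V 1%N) 1.
    by rewrite /seg_point; case: (V 1%N) => x y /=; congr pair; ring.
  case: (Rle_dec u l) => hul.
  + rewrite {1}e0 pdist_seg -/l; have hl0 : 0 < l by lra.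
    rewrite Rabs_pos_eq; first by rewrite Rminus_0_r /Rdiv Rmult_assoc Rinv_l; lra.
    by rewrite Rminus_0_r; apply: Rdiv_le_0_compat; lra.
  + apply: Rle_trans (pdist_triangle _ (V 1%N) _) _; rewrite -/l.
    have := IH (fun k => V k.+1) 0 (u - l) ltac:(lra).
    by rewrite polyline_start; lra.
- have e1 : V 1%N = seg_point (V 0%N) (V 1%N) 1.
    by rewrite /seg_point; case: (V 1%N) => x y /=; congr pair; ring.
  case: (Rle_dec t l) => htl; case: (Rle_dec u l) => hul /=; try lra.
  + rewrite pdist_seg -/l; have hl0 : 0 < l by lra.
    rewrite (_ : u / l - t / l = (u - t) / l); last by field; lra.
    rewrite Rabs_pos_eq; first by rewrite /Rdiv Rmult_assoc Rinv_l; lra.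
    by apply: Rdiv_le_0_compat; lra.
  + apply: Rle_trans (pdist_triangle _ (V 1%N) _) _.
    have := IH (fun k => V k.+1) 0 (u - l) ltac:(lra); rewrite polyline_start; last by lra.
    move=> k; have hl0 : 0 < l by lra.
    rewrite {2}e1 pdist_seg -/l Rabs_pos_eq.
      by rewrite (_ : (1 - t / l) * l = l - t); [lra | field; lra].
    have : t / l <= 1 by apply: (Rmult_le_reg_r l) => //; rewrite /Rdiv Rmult_assoc Rinv_l; lra.
    by lra.
  + by have := IH (fun k => V k.+1) (t - l) (u - l) ltac:(lra); lra.
Qed.

Definition arc_time (V : nat -> plane) (k : nat) : R := sumN k (fun i => pdist (V i) (V i.+1)).

Lemma arc_time_ge0 V k : 0 <= arc_time V k.
Proof.
rewrite /arc_time; elim: k => [|k IH]; rewrite ?sumN_0 ?sumN_S; first by lra.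
by have := pdist_ge0 (V k) (V k.+1); lra.
Qed.

Lemma polyline_vertex m V k : (k <= m)%N -> polyline m V (arc_time V k) = V k.
Proof.
elim: m V k => [|m IH] V k hk; first by have -> : k = 0%N by lia.
case: k hk => [|k] hk; first by rewrite polyline_start // /arc_time sumN_0; lra.
rewrite /arc_time sumN_front /=; set l := pdist (V 0%N) (V 1%N).
have hl : 0 <= l by apply: pdist_ge0.
have ht := arc_time_ge0 (fun k => V k.+1) k; rewrite /arc_time in ht.
have hV := IH (fun k => V k.+1) k hk; rewrite /arc_time in hV.
set t := sumN k _ in ht hV *.
case: Rle_dec => h1 /=; last case: Rle_dec => h2 /=.
(* A degenerate first edge: the first two vertices coincide. *)
- have e : t = 0 by lra.
  have l0 : l = 0 by lra.
  rewrite -hV e polyline_start; last by lra.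
  have := norm2_sq (fst (V 1%N) - fst (V 0%N)) (snd (V 1%N) - snd (V 0%N)).
  rewrite -/(pdist (V 0%N) (V 1%N)) -/l l0.
  case: (V 0%N) => x y; case: (V 1%N) => x' y' /= q.
  have p1 := Rle_0_sqr (x' - x); have p2 := Rle_0_sqr (y' - y); rewrite /Rsqr in p1 p2.
  have a1 : x' - x = 0 by apply: Rsqr_0_uniq; rewrite /Rsqr; lra.
  have a2 : y' - y = 0 by apply: Rsqr_0_uniq; rewrite /Rsqr; lra.
  by congr pair; lra.
- have e : t = 0 by lra.
  rewrite -hV e polyline_start; last by lra.
  rewrite Rplus_0_r /Rdiv Rinv_r; last by lra.
  by rewrite /seg_point; case: (V 1%N) => x y /=; congr pair; ring.
- by rewrite (_ : l + t - l = t) //; ring.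
Qed.

(** The parametrization is 1-Lipschitz, which gives continuity and the bound 1 for inscribed
    polygons; the subdivision at the vertices attains it. *)
Lemma polyline_arc m V : (0 < m)%N -> arc_time V m = 1 -> rectifiable_arc (polyline m V) 1.
Proof.
move=> hm h1.
have lip t u : pdist (polyline m V t) (polyline m V u) <= Rabs (u - t).
  case: (Rle_or_lt t u) => htu.
  - by rewrite Rabs_pos_eq; [apply: polyline_lipschitz | lra].
  - by rewrite pdist_sym Rabs_minus_sym Rabs_pos_eq; [apply: polyline_lipschitz | ]; lra.
have coord P Q : Rabs (fst Q - fst P) <= pdist P Q /\ Rabs (snd Q - snd P) <= pdist P Q.
  have p1 := pow2_ge_0 (fst Q - fst P); have p2 := pow2_ge_0 (snd Q - snd P).
  by rewrite /pdist /norm2 -!sqrt_Rsqr_abs; split; apply: sqrt_le_1_alt; rewrite /Rsqr; lra.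
split.
- move=> t _; apply/filterlim_locally => eps; exists eps => u hu _.
  have := lip t u; have [c1 c2] := coord (polyline m V t) (polyline m V u).
  rewrite /ball /= /AbsRing_ball /abs /minus /plus /opp /= in hu.
  move=> k; rewrite /ball /= /prod_ball /ball /= /AbsRing_ball /abs /minus /plus /opp /=.
  by split; apply: Rle_lt_trans hu; apply: Rle_trans k.
- split.
  + move=> l [n [u [u0 [u1 [hu ->]]]]]; rewrite sum_f_R0_sumN.
    apply: Rle_trans (sumN_le (G := fun i => u i.+1 - u i) _) _.
      move=> i hi; rewrite -pdist_dist; apply: Rle_trans (lip _ _) _.
      have hi2 : (i <= n)%coq_nat by apply/leP; lia.
      by have hi3 := hu i hi2; rewrite Rabs_pos_eq; lra.
    have tel k : sumN k (fun i => u i.+1 - u i) = u k - u 0%N.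
      by elim: k => [|k IH]; [rewrite sumN_0 | rewrite sumN_S IH]; ring.
    by rewrite tel u0 u1; lra.
  + move=> b hb; apply: hb; exists m.-1, (arc_time V).
    rewrite prednK //; split; first by rewrite /arc_time sumN_0.
    split=> //; split.
    * by move=> i _; rewrite /arc_time sumN_S; have := pdist_ge0 (V i) (V i.+1); lra.
    * rewrite sum_f_R0_sumN prednK // -h1; apply: sumN_ext => k hk.
      by rewrite -pdist_dist !polyline_vertex //; lia.
Qed.

Lemma polyline_trace m V k : (k <= m)%N -> arc_time V m = 1 -> trace (polyline m V) (V k).
Proof.
move=> hk h1; exists (arc_time V k); split; last by rewrite polyline_vertex.
split; first exact: arc_time_ge0.
rewrite -h1 -(subnKC hk); elim: (m - k)%N => [|j IH]; first by rewrite addn0; lra.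
by rewrite addnS [X in _ <= X]/arc_time sumN_S -/(arc_time V (k + j)); have := pdist_ge0 (V (k + j)%N) (V (k + j).+1); lra.
Qed.

(* The width functional at angle phi with contact points P, Q, T, where S = sin phi and C = cos phi.
   It is linear in (S, C), so lower bounds propagate from two directions to the cone they span. *)
Definition gform (S C : R) (P Q T : plane) : R :=
  2 * c * (S * fst P - C * snd P)
  + (s * (fst Q * C + snd Q * S) + c * (snd Q * C - fst Q * S))
  + (- (s * (fst T * C + snd T * S)) + c * (snd T * C - fst T * S)).

Lemma gform_dirdot phi P Q T : gform (sin phi) (cos phi) P Q T =
  2 * c * dirdot phi P + dirdot (phi + 4 * beta) Q + dirdot (phi - 4 * beta) T.
Proof.
have [-> _ _] := dirdot_rotated phi P; have [_ -> _] := dirdot_rotated phi Q.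
have [_ _ ->] := dirdot_rotated phi T; rewrite /gform /xr /yr; ring.
Qed.

Definition turn (e1 e2 : R * R) : R := snd e1 * fst e2 - fst e1 * snd e2.

(** Up to the factor [turn e1 e2], the vector e is the combination of e1 and e2 with coefficients
    [turn e e2] and [turn e1 e]; [gform] is linear and [norm2] sublinear. *)
Lemma gform_cone k e1 e2 e P Q T : 0 <= k -> 0 < turn e1 e2 -> 0 <= turn e1 e -> 0 <= turn e e2 ->
  k * norm2 (fst e1) (snd e1) <= gform (fst e1) (snd e1) P Q T ->
  k * norm2 (fst e2) (snd e2) <= gform (fst e2) (snd e2) P Q T ->
  k * norm2 (fst e) (snd e) <= gform (fst e) (snd e) P Q T.
Proof.
move=> hk h12 h1 h2 k1 k2; apply: (Rmult_le_reg_r (turn e1 e2)) => //.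
have -> : gform (fst e) (snd e) P Q T * turn e1 e2 =
   turn e e2 * gform (fst e1) (snd e1) P Q T + turn e1 e * gform (fst e2) (snd e2) P Q T.
  by rewrite /gform /turn; ring.
have hn : norm2 (fst e) (snd e) * turn e1 e2 <= turn e e2 * norm2 (fst e1) (snd e1) + turn e1 e * norm2 (fst e2) (snd e2).
  rewrite Rmult_comm -!norm2_scal //; last by lra.
  apply: Rle_trans (norm2_triangle _ _ _ _); right; rewrite /turn; congr norm2; ring.
have m1 := Rmult_le_compat_l _ _ _ h2 k1; have m2 := Rmult_le_compat_l _ _ _ h1 k2.
by have m3 := Rmult_le_compat_l _ _ _ hk hn; lra.
Qed.

Lemma norm2_le x y r : 0 <= r -> x ^ 2 + y ^ 2 <= r ^ 2 -> norm2 x y <= r.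
Proof. by move=> hr h; rewrite /norm2 -(sqrt_pow2 r) //; apply: sqrt_le_1_alt. Qed.

Notation sA := (sin start_angle).
Notation cA := (cos start_angle).
Notation sO := (sin end_angle).
Notation cO := (cos end_angle).

Lemma angle_values :
  [/\ 0.997357747 <= sA <= 0.997357748, -0.072646573 <= cA <= -0.072646572,
      0.971592754 <= sO <= 0.971592755 & -0.236659081 <= cO <= -0.236659080].
Proof.
have [[h1 h2] [h3 h4]] := sin_cos_ab_bounds.
by rewrite /start_angle /end_angle !sin_shift !cos_shift; split; lra.
Qed.

(* Tangency conditions determining the optimal arc: the endpoints (-x, 0), (x, 0), the corners
   (-d, y), (d, y), and arcs of radius 1/(2c) centred at (Zx, Zy) and its mirror image. *)
Definition caliper_params (x d y : R) : Prop :=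
  [/\ 2 * (s * d + c * y) = 1,
      2 * c * (x * sA) = 1 + cA * (- (s * x) + s * d - c * y) + sA * (- (c * x) - c * d - s * y) &
      2 * c * (d * sO - y * cO) =
        1 + cO * (- (s * x) + s * d - c * y) + sO * (- (c * x) - c * d - s * y)] /\
  [/\ 0.24615 <= x <= 0.24616, 0.19013 <= d <= 0.19015 & 0.47988 <= y <= 0.4799].

Lemma caliper_params_ex : exists x d y, caliper_params x d y.
Proof.
have hs := s_bounds; have hc := c_bounds; have [a1 a2 a3 a4] := angle_values.
set k := s / c; have ek : k * c = s by rewrite /k; field; lra.
have hk : 0.72654252 <= k <= 0.72654253 by split; nra.
(* Eliminating y by the first condition leaves two linear equations for x and d, solved by Cramer's
   rule. *)
set a11 := 3 * c * sA + s * cA; set a12 := - (2 * s * cA) + (c - k * s) * sA.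
set r1 := 1 - cA / 2 - k * sA / 2.
set a21 := s * cO + c * sO; set a22 := (3 * c - k * s) * sO; set r2 := 1 + cO / 2 - k * sO / 2.
have ks : 0.42705098 <= k * s <= 0.42705099 by split; nra.
have b11 : 2.3779375 <= a11 <= 2.3779376 by rewrite /a11; split; nra.
have b12 : 0.4663578 <= a12 <= 0.4663581 by rewrite /a12; split; nra.
have br1 : 0.6740118 <= r1 <= 0.6740120 by rewrite /r1; split; nra.
have b21 : 0.6469302 <= a21 <= 0.6469305 by rewrite /a21; split; nra.
have b22 : 1.9431854 <= a22 <= 1.9431856 by rewrite /a22; split; nra.
have br2 : 0.5287186 <= r2 <= 0.5287189 by rewrite /r2; split; nra.
set det := a11 * a22 - a12 * a21.
have bdet : 4.319071 <= det <= 4.319074.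
  have p1 := @mul_bounds _ _ _ _ _ _ _ _ b11 b22; have p2 := @mul_bounds _ _ _ _ _ _ _ _ b12 b21.
  by rewrite /det; have {}p1 := p1 ltac:(lra) ltac:(lra); have {}p2 := p2 ltac:(lra) ltac:(lra); lra.
set x := (r1 * a22 - a12 * r2) / det; set d := (a11 * r2 - r1 * a21) / det.
have ex : x * det = r1 * a22 - a12 * r2 by rewrite /x; field; lra.
have ed : d * det = a11 * r2 - r1 * a21 by rewrite /d; field; lra.
have l1 : a11 * x + a12 * d = r1.
  apply: (Rmult_eq_reg_r det); last by lra.
  by transitivity (a11 * (x * det) + a12 * (d * det)); [ring | rewrite ex ed /det; ring].
have l2 : a21 * x + a22 * d = r2.
  apply: (Rmult_eq_reg_r det); last by lra.
  by transitivity (a21 * (x * det) + a22 * (d * det)); [ring | rewrite ex ed /det; ring].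
have bx : 0.24615 <= x <= 0.24616.
  have p1 := @mul_bounds _ _ _ _ _ _ _ _ br1 b22; have p2 := @mul_bounds _ _ _ _ _ _ _ _ b12 br2.
  apply: div_bounds; first by lra.
  by have {}p1 := p1 ltac:(lra) ltac:(lra); have {}p2 := p2 ltac:(lra) ltac:(lra); lra.
have bd : 0.19013 <= d <= 0.19015.
  have p1 := @mul_bounds _ _ _ _ _ _ _ _ b11 br2; have p2 := @mul_bounds _ _ _ _ _ _ _ _ br1 b21.
  apply: div_bounds; first by lra.
  by have {}p1 := p1 ltac:(lra) ltac:(lra); have {}p2 := p2 ltac:(lra) ltac:(lra); lra.
set y := (1 / 2 - s * d) / c; have ey : c * y = 1 / 2 - s * d by rewrite /y; field; lra.
have esy : s * y = k / 2 - k * s * d by rewrite -{1}ek Rmult_assoc ey; field.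
exists x, d, y; split; split=> //.
- by rewrite ey; field.
- rewrite ey esy; move: l1; rewrite /a11 /a12 /r1 => l1; lra.
- move: l2; rewrite /a21 /a22 /r2 => l2; rewrite ey esy.
  transitivity (2 * c * d * sO - 2 * (c * y) * cO); [ring | rewrite ey; lra].
- by clear - ey bd hs hc; split; nra.
Qed.

(** * The optimal arc and its inscribed polygons *)

Section Caliper.
Variables x d y : R.
Hypothesis params : caliper_params x d y.

Definition Zx : R := (c * x + c * d + s * y) / (2 * c).
Definition Zy : R := (s * x - s * d + c * y) / (2 * c).
Definition end_left : plane := (- x, 0).
Definition corner_left : plane := (- d, y).
(** The point of the left circular arc with outer normal at angle [- psi]; its image under [flipx]
    has outer normal at angle [psi]. *)
Definition rim (psi : R) : plane := (Zx - sin psi / (2 * c), Zy - cos psi / (2 * c)).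
Definition flipx (P : plane) : plane := (- fst P, snd P).

(** With the other two contact points fixed, the base lines that give width exactly 1 envelop a
    circle of radius 1/(2c); [Zx] and [Zy] are chosen as the coordinates of its centre, up to
    reflection. *)
Lemma gform_rim psi : gform (sin psi) (cos psi) (flipx (rim psi)) corner_left end_left = 1.
Proof.
have hc := c_bounds; have := sin2_cos2 psi; rewrite /Rsqr => e.
rewrite /gform /flipx /rim /corner_left /end_left /Zx /Zy /=; field_simplify_eq; last by lra.
by apply: (Rplus_eq_reg_r (- (sin psi * sin psi + cos psi * cos psi))); rewrite {2}e; ring.
Qed.

Lemma gform_start : gform sA cA (flipx end_left) corner_left end_left = 1.
Proof. by have [[p1 p2 p3] _] := params; rewrite /gform /flipx /corner_left /end_left /=; lra. Qed.

Lemma gform_end : gform sO cO (flipx corner_left) corner_left end_left = 1.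
Proof. by have [[p1 p2 p3] _] := params; rewrite /gform /flipx /corner_left /end_left /=; lra. Qed.

Lemma gform_base : gform 0 1 (flipx end_left) (flipx corner_left) corner_left = 1.
Proof. by have [[p1 p2 p3] _] := params; rewrite /gform /flipx /corner_left /end_left /=; lra. Qed.

Lemma pdist_flipx P Q : pdist (flipx P) (flipx Q) = pdist P Q.
Proof. by rewrite /pdist /flipx /norm2 /=; congr sqrt; ring. Qed.

Lemma rim_dist psi chi : pdist (rim psi) (rim chi) <= Rabs (chi - psi) / (2 * c).
Proof.
have hc := c_bounds; have hi : 0 < / (2 * c) by apply: Rinv_0_lt_compat; lra.
rewrite /pdist /rim /=.
have -> : Zx - sin chi / (2 * c) - (Zx - sin psi / (2 * c)) = / (2 * c) * (sin psi - sin chi) by field; lra.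
have -> : Zy - cos chi / (2 * c) - (Zy - cos psi / (2 * c)) = / (2 * c) * (cos psi - cos chi) by field; lra.
rewrite norm2_scal; last by lra.
rewrite /Rdiv Rmult_comm; apply: Rmult_le_compat_r; first by lra.
apply: norm2_le; first exact: Rabs_pos.
have e : chi - psi = 2 * ((chi - psi) / 2) by field.
have h1 := cos_minus chi psi; rewrite {1}e cos_2a_sin in h1.
have h2 := sin_lipschitz ((chi - psi) / 2) 0; rewrite sin_0 !Rminus_0_r in h2.
have h3 : sin ((chi - psi) / 2) * sin ((chi - psi) / 2) <= ((chi - psi) / 2) * ((chi - psi) / 2).
  by apply: Rsqr_le_abs_1.
have e1 := sin2_cos2 chi; have e2 := sin2_cos2 psi; rewrite /Rsqr in e1 e2.
by rewrite pow2_abs; nra.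
Qed.

Definition lead_length : R := pdist end_left (rim start_angle).
Definition tail_length : R := pdist (rim end_angle) corner_left.

Lemma caliper_products :
  [/\ 0.199139 <= c * x <= 0.199148, 0.153818 <= c * d <= 0.153835 & 0.388231 <= c * y <= 0.388248] /\
  [/\ 0.144683 <= s * x <= 0.14469, 0.111755 <= s * d <= 0.111768 & 0.282066 <= s * y <= 0.282079].
Proof.
have [_ [b1 b2 b3]] := params; have hc := c_bounds; have hs := s_bounds.
have q1 : 0.80901699 * 0.24615 <= c * x <= 0.809017 * 0.24616 by apply: mul_bounds; lra.
have q2 : 0.80901699 * 0.19013 <= c * d <= 0.809017 * 0.19015 by apply: mul_bounds; lra.
have q3 : 0.80901699 * 0.47988 <= c * y <= 0.809017 * 0.4799 by apply: mul_bounds; lra.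
have q4 : 0.58778525 * 0.24615 <= s * x <= 0.58778526 * 0.24616 by apply: mul_bounds; lra.
have q5 : 0.58778525 * 0.19013 <= s * d <= 0.58778526 * 0.19015 by apply: mul_bounds; lra.
have q6 : 0.58778525 * 0.47988 <= s * y <= 0.58778526 * 0.4799 by apply: mul_bounds; lra.
by clear - q1 q2 q3 q4 q5 q6; do 2!split; lra.
Qed.

Lemma Z_bounds : 0.39245 <= Zx <= 0.3925 /\ 0.26025 <= Zy <= 0.26035.
Proof.
have [[q1 q2 q3] [q4 q5 q6]] := caliper_products; have hc := c_bounds.
by rewrite /Zx /Zy; split; apply: div_bounds; lra.
Qed.

Lemma norm2_along u v w z l : v ^ 2 + u ^ 2 = 1 -> u * w + v * z = 0 -> l = - v * w + u * z -> 0 <= l ->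
  norm2 w z = l.
Proof.
move=> h1 h2 hl l0; rewrite -[RHS]sqrt_pow2 // /norm2; congr sqrt.
transitivity ((v ^ 2 + u ^ 2) * (w ^ 2 + z ^ 2)); first by rewrite h1; ring.
transitivity ((u * w + v * z) ^ 2 + l ^ 2); first by rewrite hl; ring.
by rewrite h2; ring.
Qed.

(** Strong duality. Lead and tail are tangent to the rim, so their lengths are tangential
    components. What remains is a combination of the optimality equations [f1], [f2], [f3] with
    coefficients -x, -d, y, together with s d + c y = 1/2. *)
Lemma lead_tail_lengths : 2 * lead_length + 2 * tail_length + 2 * d = lambda.
Proof.
have [[p1 p2 p3] [b1 b2 b3]] := params; have hc := c_bounds; have hs := s_bounds.
have [z1 z2] := Z_bounds; have [a1 a2 a3 a4] := angle_values.
have eA : cA ^ 2 + sA ^ 2 = 1 by rewrite -(sin2_cos2 start_angle) /Rsqr; ring.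
have eO : cO ^ 2 + sO ^ 2 = 1 by rewrite -(sin2_cos2 end_angle) /Rsqr; ring.
have ez1 : 2 * c * Zx = c * x + c * d + s * y by rewrite /Zx; field; lra.
have ez2 : 2 * c * Zy = s * x - s * d + c * y by rewrite /Zy; field; lra.
have L1 : lead_length = - cA * (Zx + x) + sA * Zy.
  apply: (norm2_along (u := sA) (v := cA)) => //=.
  - apply: (Rmult_eq_reg_l (2 * c)); last by lra.
    transitivity (sA * (2 * c * Zx) + cA * (2 * c * Zy) + 2 * c * (x * sA) - (cA ^ 2 + sA ^ 2)); first by field; lra.
    by rewrite ez1 ez2 p2 eA; ring.
  - by field; lra.
  - by nra.
have L2 : tail_length = - cO * (- d - Zx) + sO * (y - Zy).
  apply: (norm2_along (u := sO) (v := cO)) => //=.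
  - apply: (Rmult_eq_reg_l (2 * c)); last by lra.
    transitivity (- (2 * c * (d * sO - y * cO)) - sO * (2 * c * Zx) - cO * (2 * c * Zy) + (cO ^ 2 + sO ^ 2)); first by field; lra.
    by rewrite ez1 ez2 p3 eO; ring.
  - by field; lra.
  - by nra.
have [e1 _] := ideal_after_R; have [e2 e3] := ideal_after_S.
have k4 u : cos (4 * beta - u) = - c * cos u + s * sin u by rewrite cos_minus cos_4beta sin_4beta.
have s6 : sin (6 * beta) = - s by rewrite (_ : 6 * beta = beta + PI) ?neg_sin //; rewrite /beta; field.
have c6 : cos (6 * beta) = - c by rewrite (_ : 6 * beta = beta + PI) ?neg_cos //; rewrite /beta; field.
have k6 u : cos (6 * beta - u) = - c * cos u - s * sin u by rewrite cos_minus c6 s6; ring.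
have k7 u : sin (6 * beta - u) = - s * cos u + c * sin u by rewrite sin_minus c6 s6; ring.
rewrite !k4 in e1; rewrite !k6 in e2; rewrite !k7 in e3.
have f1 : - c * cO + s * sO - (- c * cA + s * sA) + 2 * c * cA = 0.
  have -> : 2 * c * cA = - (2 * c * (cA * -1)) by ring.
  by rewrite -e1; field; lra.
have f2 : - (2 * c * cO) + (- c * cO - s * sO - (- c * cA - s * sA)) + 2 * c * s * lambda - 2 * c = 0.
  have q := congr1 (Rmult (2 * c)) e2; rewrite Rmult_1_r in q.
  by rewrite -[X in _ - X]q; field; lra.
have f3 : 2 * c * sO + (- s * cA + c * sA - (- s * cO + c * sO)) - 2 * c * c * lambda = 0.
  have := congr1 (Rmult (2 * c)) e3; rewrite Rmult_0_r => <-; field; lra.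
have key : c * (lead_length + tail_length + d) = c * lambda * (s * d + c * y).
  rewrite L1 L2; apply: (Rmult_eq_reg_l 2); last by lra.
  transitivity ((2 * c * Zx) * (cO - cA) + (2 * c * Zy) * (sA - sO) + 2 * c * (- cA * x + cO * d + sO * y + d)).
    by ring.
  rewrite ez1 ez2; apply: Rminus_diag_uniq.
  transitivity (- x * (- c * cO + s * sO - (- c * cA + s * sA) + 2 * c * cA)
    - d * (- (2 * c * cO) + (- c * cO - s * sO - (- c * cA - s * sA)) + 2 * c * s * lambda - 2 * c)
    + y * (2 * c * sO + (- s * cA + c * sA - (- s * cO + c * sO)) - 2 * c * c * lambda)); first by ring.
  by rewrite f1 f2 f3; ring.
have : lead_length + tail_length + d = lambda * (s * d + c * y).
  by apply: (Rmult_eq_reg_l c); [rewrite key; ring | lra].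
have -> : s * d + c * y = 1 / 2 by lra.
by move=> q; lra.
Qed.

Variable n : nat.
Hypothesis n_pos : (0 < n)%N.
Let eta := (end_angle - start_angle) / INR n.
Let psi (k : nat) := start_angle + INR k * eta.

Let INRn_pos : 0 < INR n.
Proof. by apply: lt_0_INR; apply/ltP. Qed.

Lemma eta_pos : 0 < eta <= 0.2.
Proof.
have ha := a_angle_bounds; have hb := b_angle_bounds.
have n1 : 1 <= INR n by rewrite -[1]/(INR 1); apply: le_INR; apply/leP.
have e : eta * INR n = end_angle - start_angle by rewrite /eta; field; lra.
by rewrite /start_angle /end_angle in e; split; nra.
Qed.

Lemma psi_n : psi n = end_angle.
Proof. by rewrite /psi /eta; field; lra. Qed.

Definition half_vertex (k : nat) : plane :=
  if k is k'.+1 then if (k' <= n)%N then rim (psi k') else corner_left else end_left.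

(** There are [2 * n + 6] vertices; the indices [n.+2] and [n.+3] are the two corners, joined by the
    top edge. *)
Definition caliper_vertex (k : nat) : plane :=
  if (k <= n.+2)%N then half_vertex k else flipx (half_vertex (2 * n + 5 - k)).

Lemma sumN_add a b F : sumN (a + b) F = sumN a F + sumN b (fun k => F (a + k)%N).
Proof. by elim: b => [|b IH]; [rewrite addn0 sumN_0; ring | rewrite addnS !sumN_S IH; ring]. Qed.

Lemma sumN_rev m F : sumN m (fun k => F (m.-1 - k)%N) = sumN m F.
Proof.
elim: m F => [//|m IH] F; rewrite sumN_front sumN_S subn0 /= -IH Rplus_comm; congr (_ + _).
by apply: sumN_ext => k hk; congr F; lia.
Qed.

Lemma half_length_le :
  sumN n.+2 (fun k => pdist (half_vertex k) (half_vertex k.+1)) <=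
  lead_length + tail_length + (b_angle - a_angle) / (2 * c).
Proof.
have hc := c_bounds; have [e0 _] := eta_pos.
have psi_0 : psi 0 = start_angle by rewrite /psi Rmult_0_l Rplus_0_r.
rewrite sumN_S sumN_front /= leqnn ltnn psi_0 psi_n.
rewrite -/lead_length -/tail_length.
have : sumN n (fun k => pdist (half_vertex k.+1) (half_vertex k.+2)) <= INR n * (eta / (2 * c)).
  apply: Rle_trans (sumN_le (G := fun=> 0 * 0 + eta / (2 * c) * 1) _) _.
    move=> k hk; rewrite /= hk (ltnW hk).
    apply: Rle_trans (rim_dist _ _) _; right.
    rewrite (_ : psi k.+1 - psi k = eta); last by rewrite /psi S_INR; ring.
    by rewrite Rabs_pos_eq; [ring | lra].
  have [_ q] := @sumN_bounds n (fun=> 0 * 0 + eta / (2 * c) * 1) (eta / (2 * c)) (eta / (2 * c)) (fun _ _ => ltac:(lra)).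
  exact: q.
have -> : INR n * (eta / (2 * c)) = (b_angle - a_angle) / (2 * c).
  by rewrite /eta /start_angle /end_angle; field; lra.
by rewrite /=; lra.
Qed.

Lemma caliper_vertex_length : 0 < arc_time caliper_vertex (2 * n + 5) <= caliper_length.
Proof.
have [[p1 p2 p3] [b1 b2 b3]] := params; have hc := c_bounds.
have hm : pdist (caliper_vertex n.+2) (caliper_vertex n.+3) = 2 * d.
  rewrite /caliper_vertex leqnn ltnn (_ : 2 * n + 5 - n.+3 = n.+2)%N; last by clear; lia.
  rewrite /= ltnn /pdist /corner_left /flipx /= (_ : y - y = 0); last by ring.
  rewrite /norm2 (_ : (- - d - - d) ^ 2 + 0 ^ 2 = (2 * d) ^ 2); last by ring.
  by rewrite sqrt_pow2; lra.
have e : arc_time caliper_vertex (2 * n + 5) =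
    2 * sumN n.+2 (fun k => pdist (half_vertex k) (half_vertex k.+1)) + 2 * d.
  rewrite /arc_time (_ : 2 * n + 5 = n.+2 + n.+3)%N; last by clear; lia.
  have e1 : sumN n.+2 (fun k => pdist (caliper_vertex k) (caliper_vertex k.+1))
      = sumN n.+2 (fun k => pdist (half_vertex k) (half_vertex k.+1)).
    by apply: sumN_ext => k hk; rewrite /caliper_vertex (ltnW hk) hk.
  have e2 : sumN n.+2 (fun k => pdist (caliper_vertex (n.+2 + k.+1)) (caliper_vertex (n.+2 + k.+1).+1))
      = sumN n.+2 (fun k => pdist (half_vertex k) (half_vertex k.+1)).
    rewrite -[RHS]sumN_rev; apply: sumN_ext => k hk; rewrite /caliper_vertex.
    have h1 : (n.+2 + k.+1 <= n.+2)%N = false by clear; lia.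
    have h2 : (n.+2 + k.+1 < n.+2)%N = false by clear; lia.
    have h3 : (2 * n + 5 - (n.+2 + k.+1) = (n.+2.-1 - k).+1)%N by clear - hk; lia.
    have h4 : (2 * n + 5 - (n.+2 + k.+1).+1 = n.+2.-1 - k)%N by clear - hk; lia.
    by rewrite h1 h2 pdist_flipx pdist_sym h3 h4.
  have e3 : sumN n.+3 (fun k => pdist (caliper_vertex (n.+2 + k)) (caliper_vertex (n.+2 + k).+1))
      = 2 * d + sumN n.+2 (fun k => pdist (half_vertex k) (half_vertex k.+1)).
    by rewrite -e2 sumN_front; congr (_ + _); rewrite addn0 hm.
  by rewrite sumN_add e1 e3; ring.
have hl := half_length_le; have hlt := lead_tail_lengths.
have hs : 0 <= sumN n.+2 (fun k => pdist (half_vertex k) (half_vertex k.+1)).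
  exact: (@arc_time_ge0 half_vertex n.+2).
rewrite e; split; first by lra.
have -> : caliper_length = lambda + 2 * ((b_angle - a_angle) / (2 * c)).
  by rewrite /caliper_length; field; lra.
by lra.
Qed.

Definition is_vertex (P : plane) : Prop := exists2 k, (k <= 2 * n + 5)%N & P = caliper_vertex k.

Lemma is_vertex_flip P : is_vertex P -> is_vertex (flipx P).
Proof.
move=> [k hk ->]; exists (2 * n + 5 - k)%N; first by lia.
rewrite /caliper_vertex; case: (leqP k n.+2) => h1.
- rewrite (_ : (2 * n + 5 - k <= n.+2)%N = false); last by lia.
  by congr (flipx (half_vertex _)); lia.
- rewrite (_ : (2 * n + 5 - k <= n.+2)%N = true); last by lia.
  by case: (half_vertex _) => u v; rewrite /flipx /= Ropp_involutive.
Qed.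

Lemma is_vertex_half k : (k <= n.+2)%N -> is_vertex (half_vertex k).
Proof. by move=> hk; exists k; [lia | rewrite /caliper_vertex hk]. Qed.

Lemma is_vertex_end : is_vertex end_left.
Proof. exact: (@is_vertex_half 0). Qed.

Lemma is_vertex_corner : is_vertex corner_left.
Proof. by have := @is_vertex_half n.+2 (leqnn _); rewrite /half_vertex ltnn. Qed.

Lemma is_vertex_rim k : (k <= n)%N -> is_vertex (rim (psi k)).
Proof. by move=> hk; have := @is_vertex_half k.+1; rewrite /half_vertex hk; apply; lia. Qed.

(** Homogeneous in e, so that the directions bounding the cones need not be unit vectors. The loss
    [eta] pays for replacing the rim by chords. *)
Definition wide (e : R * R) : Prop := exists P Q T, [/\ is_vertex P, is_vertex Q, is_vertex T &
  (1 - eta) * norm2 (fst e) (snd e) <= gform (fst e) (snd e) P Q T].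

Lemma wide_between e1 e2 e P Q T : is_vertex P -> is_vertex Q -> is_vertex T ->
  0 < turn e1 e2 -> 0 <= turn e1 e -> 0 <= turn e e2 ->
  norm2 (fst e1) (snd e1) <= gform (fst e1) (snd e1) P Q T ->
  norm2 (fst e2) (snd e2) <= gform (fst e2) (snd e2) P Q T -> wide e.
Proof.
move=> hP hQ hT h12 h1 h2 k1 k2; exists P, Q, T; split=> //; have [e0 e3] := eta_pos.
have q := norm2_ge0.
apply: (gform_cone (e1 := e1) (e2 := e2)) => //; first by lra.
- by apply: Rle_trans k1; have := q (fst e1) (snd e1); nra.
- by apply: Rle_trans k2; have := q (fst e2) (snd e2); nra.
Qed.

Lemma norm2_angle t : norm2 (sin t) (cos t) = 1.
Proof. by rewrite /norm2 -[RHS]sqrt_1 -(sin2_cos2 t) /Rsqr; congr sqrt; ring. Qed.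

(** Between two consecutive rim angles the vertex at the first serves as contact point throughout.
    At the second angle it is at most [eta / (2 * c)] away from the true one, which costs at most
    [eta] of width. *)
Lemma wide_rim e : 0 <= turn (sA, cA) e -> 0 <= turn e (sO, cO) -> wide e.
Proof.
move=> h1 h2; have [e0 e3] := eta_pos; have hc := c_bounds.
pose E k := (sin (psi k), cos (psi k)).
have E0 : E 0%N = (sA, cA) by rewrite /E /psi Rmult_0_l Rplus_0_r.
have En : E n = (sO, cO) by rewrite /E psi_n.
have tsym a b : turn a b = - turn b a by rewrite /turn; ring.
have [k [hk k1 k2]] : exists k, [/\ (k < n)%N, 0 <= turn (E k) e & 0 <= turn e (E k.+1)].
  have : 0 <= turn e (E n) by rewrite En.
  move: n_pos; elim: (n) => [//|m IH] _ hm.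
  case: (Rle_or_lt 0 (turn (E m) e)) => hme; first by exists m.
  have m0 : (0 < m)%N by case: (m) hme => [|//]; rewrite E0; lra.
  have hm' : 0 <= turn e (E m) by rewrite tsym; lra.
  have [k [k0 k1 k2]] := IH m0 hm'.
  by exists k; split=> //; apply: ltnW.
have estep : psi k.+1 - psi k = eta by rewrite /psi S_INR; ring.
exists (flipx (rim (psi k))), corner_left, end_left; split.
- by apply: is_vertex_flip; apply: is_vertex_rim; lia.
- exact: is_vertex_corner.
- exact: is_vertex_end.
- apply: (gform_cone (e1 := E k) (e2 := E k.+1)) => //=; first by lra.
  + rewrite /turn /= (_ : _ - _ = sin (psi k.+1 - psi k)); last by rewrite sin_minus; ring.
    by rewrite estep; apply: sin_gt_0; have := PI2_3_2; lra.
  + by rewrite norm2_angle gform_rim; lra.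
  + rewrite norm2_angle -(gform_rim (psi k.+1)).
    have hd := rim_dist (psi k.+1) (psi k); rewrite -Rabs_Ropp Ropp_minus_distr estep Rabs_pos_eq in hd; last by lra.
    have hn := dot_le_norm2 (sin (psi k.+1)) (- cos (psi k.+1))
      (fst (flipx (rim (psi k.+1))) - fst (flipx (rim (psi k)))) (snd (flipx (rim (psi k.+1))) - snd (flipx (rim (psi k)))).
    have nn : norm2 (sin (psi k.+1)) (- cos (psi k.+1)) = 1.
      by rewrite -(norm2_angle (psi k.+1)) /norm2; congr sqrt; ring.
    rewrite nn Rmult_1_l -/(pdist (flipx (rim (psi k))) (flipx (rim (psi k.+1)))) pdist_flipx pdist_sym in hn.
    have e5 : eta / (2 * c) * (2 * c) = eta by field; lra.
    have e6 := gform_rim (psi k.+1).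
    set g1 := gform _ _ (flipx (rim (psi k.+1))) _ _ in e6 *.
    have -> : gform (sin (psi k.+1)) (cos (psi k.+1)) (flipx (rim (psi k))) corner_left end_left
      = g1 - 2 * c * (sin (psi k.+1) * (fst (flipx (rim (psi k.+1))) - fst (flipx (rim (psi k))))
        + - cos (psi k.+1) * (snd (flipx (rim (psi k.+1))) - snd (flipx (rim (psi k))))).
      by rewrite /g1 /gform; ring.
    rewrite e6; set v := sin _ * _ + _ in hn *.
    by have : 2 * c * v <= 2 * c * (eta / (2 * c)); [apply: Rmult_le_compat_l; lra | lra].
Qed.


(* The half circle of directions is cut into seven cones, each with its contact points. *)
Lemma wide_right e : 0 <= fst e -> wide e.
Proof.
move=> he; have hc := c_bounds; have hs := s_bounds; have [a1 a2 a3 a4] := angle_values.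
have [[q1 q2 q3] [q4 q5 q6]] := caliper_products.
have vA := is_vertex_end; have vD := is_vertex_corner.
have vB := is_vertex_flip vA; have vE := is_vertex_flip vD.
have vU : is_vertex (rim start_angle).
  have e0 : psi 0 = start_angle by rewrite /psi Rmult_0_l Rplus_0_r.
  by rewrite -e0; apply: is_vertex_rim.
have [z1 z2] := Z_bounds; have hi := inv_2c_bounds.
have u1 : 0.2238 <= - fst (rim start_angle) <= 0.224.
  have m : 0.618 * 0.997357747 <= / (2 * c) * sA <= 0.61804 * 0.997357748 by apply: mul_bounds; lra.
  by rewrite /rim /= /Rdiv (Rmult_comm sA); lra.
have u2 : 0.305 <= snd (rim start_angle) <= 0.3054.
  have m : 0.618 * 0.072646572 <= / (2 * c) * - cA <= 0.61804 * 0.072646573 by apply: mul_bounds; lra.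
  by rewrite /rim /= /Rdiv (Rmult_comm cA); lra.
move: (rim start_angle) vU u1 u2 => U vU u1 u2.
have r1 : 0.80901699 * 0.2238 <= c * - fst U <= 0.809017 * 0.224 by apply: mul_bounds; lra.
have r2 : 0.80901699 * 0.305 <= c * snd U <= 0.809017 * 0.3054 by apply: mul_bounds; lra.
have r3 : 0.58778525 * 0.2238 <= s * - fst U <= 0.58778526 * 0.224 by apply: mul_bounds; lra.
have r4 : 0.58778525 * 0.305 <= s * snd U <= 0.58778526 * 0.3054 by apply: mul_bounds; lra.
have small u v : u ^ 2 + v ^ 2 <= 1.001 -> norm2 u v <= 1.001.
  by move=> h; apply: norm2_le; lra.
(* Sine and cosine of 42, 116, 123 and 146 degrees to three digits. At each of them both
   neighbouring triples of contact points give at least 1.001, an upper bound for the norm. *)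
pose g1 := (0.669, 0.743); pose g4 := (0.899, - 0.438); pose g5 := (0.839, - 0.545).
pose g6 := (0.559, - 0.829).
have n1 := small 0.669 0.743 ltac:(lra); have n4 := small 0.899 (- 0.438) ltac:(lra).
have n5 := small 0.839 (- 0.545) ltac:(lra); have n6 := small 0.559 (- 0.829) ltac:(lra).
have nu u v : u ^ 2 + v ^ 2 = 1 -> norm2 u v = 1 by move=> h; rewrite /norm2 h sqrt_1.
have n0 := nu 0 1 ltac:(ring); have n7 := nu 0 (- 1) ltac:(ring).
have tsym a b : turn a b = - turn b a by rewrite /turn; ring.
have h7 : 0 <= turn e (0, - 1) by rewrite /turn /=; lra.
have next g : turn g e < 0 -> 0 <= turn e g by rewrite tsym; lra.
have h0 : 0 <= turn (0, 1) e by rewrite /turn /=; lra.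
case: (Rlt_or_le (turn g1 e) 0) => h1.
  apply: (wide_between vB vE vD _ h0 (next _ h1)); rewrite /= ?n0 ?gform_base.
  - by rewrite /turn /=; lra.
  - by lra.
  - by apply: Rle_trans n1 _; rewrite /gform /=; lra.
case: (Rlt_or_le (turn (sA, cA) e) 0) => h2.
  apply: (wide_between vB vD vA _ h1 (next _ h2)); rewrite /= ?norm2_angle ?gform_start.
  - by rewrite /turn /=; lra.
  - by apply: Rle_trans n1 _; rewrite /gform /=; lra.
  - by lra.
case: (Rlt_or_le (turn (sO, cO) e) 0) => h3; first by apply: wide_rim; last exact: next.
case: (Rlt_or_le (turn g4 e) 0) => h4.
  apply: (wide_between vE vD vA _ h3 (next _ h4)); rewrite /= ?norm2_angle ?gform_end.
  - by rewrite /turn /=; lra.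
  - by lra.
  - by apply: Rle_trans n4 _; rewrite /gform /=; lra.
case: (Rlt_or_le (turn g5 e) 0) => h5.
  apply: (wide_between vE vU vA _ h4 (next _ h5)); rewrite /=.
  - by rewrite /turn /=; lra.
  - by apply: Rle_trans n4 _; rewrite /gform /=; lra.
  - by apply: Rle_trans n5 _; rewrite /gform /=; lra.
case: (Rlt_or_le (turn g6 e) 0) => h6.
  apply: (wide_between vE vA vA _ h5 (next _ h6)); rewrite /=.
  - by rewrite /turn /=; lra.
  - by apply: Rle_trans n5 _; rewrite /gform /=; lra.
  - by apply: Rle_trans n6 _; rewrite /gform /=; lra.
apply: (wide_between vE vA vB _ h6 h7); rewrite /= ?n7.
- by rewrite /turn /=; lra.
- by apply: Rle_trans n6 _; rewrite /gform /=; lra.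
- by rewrite /gform /=; lra.
Qed.

Lemma caliper_wide e : wide e.
Proof.
case: (Rle_or_lt 0 (fst e)) => he; first exact: wide_right.
have [|P [Q [T [hP hQ hT h]]]] := @wide_right (- fst e, snd e); first by rewrite /=; lra.
exists (flipx P), (flipx T), (flipx Q); split; try exact: is_vertex_flip.
have en : norm2 (fst e) (snd e) = norm2 (- fst e) (snd e) by rewrite /norm2; congr sqrt; ring.
rewrite en; apply: Rle_trans h _; right; rewrite /gform /flipx /=; ring.
Qed.

End Caliper.

Lemma pdist_scale k P Q : 0 <= k ->
  pdist (k * fst P, k * snd P) (k * fst Q, k * snd Q) = k * pdist P Q.
Proof. by move=> hk; rewrite /pdist -norm2_scal //=; congr norm2; ring. Qed.

Lemma arc_time_scale k V m : 0 <= k ->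
  arc_time (fun j => (k * fst (V j), k * snd (V j))) m = k * arc_time V m.
Proof.
move=> hk; rewrite /arc_time; elim: m => [|m IH]; first by rewrite !sumN_0; ring.
by rewrite !sumN_S IH pdist_scale //; ring.
Qed.

Lemma smaller_homothet_fails r : 0 < r < / C_gnomon -> ~ covers_unit_arcs (homothet r gnomon).
Proof.
move=> [r0 rC] hcov; have hs := s_bounds; have hc := c_bounds; have hL := caliper_length_bounds.
have C0 : 0 < C_gnomon by rewrite C_gnomon_eq; do !apply: Rmult_lt_0_compat; lra.
set L := caliper_length in hL; set k := 2 * s * c * r.
have kL : k * L < 1.
  have e : / C_gnomon * C_gnomon = 1 by field; lra.
  have -> : k * L = r * C_gnomon by rewrite C_gnomon_eq /k -/L; ring.
  by rewrite -e; apply: Rmult_lt_compat_r.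
(* The polygon is taken so fine that its loss [eta] is smaller than the gap [1 - k * L], then
   rescaled by [/ l] to length exactly 1; since [l <= L] this does not help it to fit. *)
have [m hm] := INR_unbounded ((end_angle - start_angle) / (1 - k * L)).
set n := m.+1.
have n0 : (0 < n)%N by [].
have hn : (end_angle - start_angle) / INR n < 1 - k * L.
  have N0 : 0 < INR n by apply: lt_0_INR; apply/ltP.
  have hmn : INR m < INR n by rewrite /n S_INR; lra.
  apply: (Rmult_lt_reg_r (INR n)) => //; rewrite /Rdiv Rmult_assoc Rinv_l; last by lra.
  have e : (end_angle - start_angle) / (1 - k * L) * (1 - k * L) = end_angle - start_angle by field; lra.
  by nra.
have [x [d [y hp]]] := caliper_params_ex.
have [l0 lL] := caliper_vertex_length hp n0.
have hw := caliper_wide hp n0.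
set V := caliper_vertex x d y n in l0 lL; set l := arc_time V _ in l0 lL.
pose V' j := (/ l * fst (V j), / l * snd (V j)).
have il : 0 < / l by apply: Rinv_0_lt_compat.
have h1 : arc_time V' (2 * n + 5) = 1.
  by rewrite /V' arc_time_scale; [rewrite -/l; field; lra | lra].
have hm5 : (0 < 2 * n + 5)%N by clear; lia.
have [phi hphi] := width_of_fits r0 (hcov _ (polyline_arc hm5 h1)).
have [P [Q [T [[i hi ->] [j hj ->] [q hq ->] h]]]] := hw (sin phi, cos phi).
have := hphi _ _ _ (polyline_trace hi h1) (polyline_trace hj h1) (polyline_trace hq h1).
rewrite -gform_dirdot -/k.
have -> : gform (sin phi) (cos phi) (V' i) (V' j) (V' q) = / l * gform (sin phi) (cos phi) (V i) (V j) (V q).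
  by rewrite /V' /gform /=; ring.
rewrite [fst _]/(sin phi) [snd _]/(cos phi) norm2_angle Rmult_1_r -/V in h; set g := gform _ _ _ _ _ in h * => h2.
have : g <= k * l.
  by have -> : g = / l * g * l; [field; lra | apply: Rmult_le_compat_r; lra].
have k0 : 0 <= k by rewrite /k; do !apply: Rmult_le_pos; lra.
by have : k * l <= k * L; [apply: Rmult_le_compat_l | lra].
Qed.

Theorem corollary1p3 :
  covers_unit_arcs (homothet (/ C_gnomon) gnomon) /\
  (forall r : R, 0 < r < / C_gnomon -> ~ covers_unit_arcs (homothet r gnomon)) /\
  0.779620091240 <= / C_gnomon < 0.779620091241.
Proof.
split; first exact: gnomon_covers.
by split; [exact: smaller_homothet_fails | exact: inv_C_gnomon_bounds].
Qed.
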